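(* Fix integers $k\ge 2$ and $k\le\delta\le 2k-1$, and put $h=\delta-k$. There exists an integer $n_0(k,\delta)$ such that for every $n\ge n_0(k,\delta)$ the following holds. Every $G\in\mathcal{G}_{n,\delta}$ satisfies $$\tau(G)\le k-1\ \Longrightarrow\ \rho(G)\le\rho\bigl(G^\star_{h,k,n}\bigr),$$ with equality if and only if $G\cong G^\star_{h,k,n}$. Equivalently, for every $G\in\mathcal{G}_{n,\delta}$, $$\rho(G)\ge\rho\bigl(G^\star_{h,k,n}\bigr)\ \Longrightarrow\ \tau(G)\ge k\ \text{ or }\ G\cong G^\star_{h,k,n}.$$ In particular, $\rho(G)>\rho(G^\star_{h,k,n})$ implies $\tau(G)\ge k$. The sharp threshold $\rho(G^\star_{h,k,n})$ is the Perron root (spectral radius) of the matrix $Q^\star_{0,k,n}$, $Q^\star_{1,k,n}$, or $Q^\star_{h,k,n}$ according as $h=0$, $h=1$, or $h\ge 2$.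
   Context: All graphs are finite, simple and undirected. $\mathcal{G}_{n,\delta}$ is the class of connected graphs with $n$ vertices and minimum degree $\delta$; $\tau(G)$ is the maximum number of pairwise edge-disjoint spanning trees in $G$; $\rho$ is the (adjacency) spectral radius. Graph $G^\star_{h,k,n}$: its vertex set is a disjoint union $X\cup W\cup Y$ with $|X|=2h+2$, $|W|=k-h-1$, $|Y|=n-k-h-1$. The set $W\cup Y$ induces a clique and every vertex of $W$ is adjacent to every vertex of $X$. The graph induced on $X$ is $K_X$ with the edges of a graph $M^\star$ on $X$ deleted. The remaining edges join $X$ to $Y$; $N_Y(x)$ is the set of neighbors in $Y$ of $x\in X$. - If $h=0$: $M^\star$ has no edges and there are no $X$--$Y$ edges. - If $h=1$: $M^\star$ has a single edge $uv$, $N_Y(u)=N_Y(v)=\{y_1\}$ for some $y_1\in Y$, and the other two vertices of $X$ have no neighbor in $Y$. - If $h\ge 2$: $M^\star\cong K_{1,h}\cup(h+1)K_1$ with star center $c$ and leaves $\ell_1,\dots,\ell_h$; $N_Y(c)=\{y_1,\dots,y_h\}$ for distinct $y_1,\dots,y_h\in Y$, $N_Y(\ell_i)=\{y_1\}$ for all $i$, and the other vertices of $X$ have no neighbor in $Y$. Matrices: $$Q^\star_{0,k,n}=\begin{pmatrix}1&k-1&0\\2&k-2&n-k-1\\0&k-1&n-k-2\end{pmatrix},\qquad Q^\star_{1,k,n}=\begin{pmatrix}0&2&k-2&1&0\\2&1&k-2&0&0\\2&2&k-3&1&n-k-3\\2&0&k-2&0&n-k-3\\0&0&k-2&1&n-k-4\end{pmatrix},$$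 where for $k=2$ the third row and third column of $Q^\star_{1,k,n}$ are deleted (before substituting $k=2$). For $h\ge2$, with $w=k-h-1$ and $q_\star=n-k-2h-1$, $$Q^\star_{h,k,n}=\begin{pmatrix}0&0&h+1&w&1&h-1&0\\0&h-1&h+1&w&1&0&0\\1&h&h&w&0&0&0\\1&h&h+1&w-1&1&h-1&q_\star\\1&h&0&w&0&h-1&q_\star\\1&0&0&w&1&h-2&q_\star\\0&0&0&w&1&h-1&q_\star-1\end{pmatrix},$$ where for $w=0$ the fourth row and fourth column are deleted. *)

(* Defs.v *)
From HB Require Import structures.
From mathcomp Require Import all_boot all_order all_algebra.
Set Implicit Arguments.
Unset Strict Implicit.
Unset Printing Implicit Defensive.
Import Order.TTheory GRing.Theory Num.Theory.
Local Open Scope ring_scope.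

Record sgraph := SGraph {
  vertex :> finType;
  edge : rel vertex;
  edge_sym : symmetric edge;
  edge_irr : irreflexive edge }.

Definition isomorphic (G H : sgraph) : Prop :=
  exists2 f : G -> H, bijective f & forall x y, edge (f x) (f y) = edge x y.

Definition connected_rel (T : finType) (e : rel T) : bool :=
  [forall x, forall y, connect e x y].

Definition degree (G : sgraph) (x : G) : nat := #|[set y | edge x y]|.

(* A degree is always smaller than #|G|, so the default value of the minimum
   is irrelevant as soon as G has a vertex. *)
Definition min_degree (G : sgraph) : nat :=
  \big[minn/#|G|]_(x : G) degree x.

Definition graph_class (n d : nat) (G : sgraph) : Prop :=
  [/\ connected_rel (@edge G), #|G| = n & min_degree G = d].

Definition edge_set (G : sgraph) : {set {set G}} :=
  [set [set p.1; p.2] | p : G * G & edge p.1 p.2].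

Definition edge_rel (T : finType) (F : {set {set T}}) : rel T :=
  [rel x y | [set x; y] \in F].

(* No closed walk through at least three, pairwise distinct, vertices; the
   bound on the length makes this decidable, see acyclicP. *)
Definition acyclic (T : finType) (e : rel T) : bool :=
  [forall m : 'I_#|T|.+1, forall s : m.-tuple T,
     ~~ [&& (2 < size s)%N, uniq s & cycle e s]].

Lemma acyclicP (T : finType) (e : rel T) :
  reflect (forall s : seq T, (2 < size s)%N -> uniq s -> ~~ cycle e s)
          (acyclic e).
Proof.
apply: (iffP forallP) => [acy s s_gt2 Us | acy m].
  have s_lt : (size s < #|T|.+1)%N by rewrite ltnS -(card_uniqP Us) max_card.
  have /forallP/(_ (in_tuple s)) := acy (Ordinal s_lt).
  by rewrite /= s_gt2 Us.
apply/forallP => s; apply/negP => /and3P[s_gt2 Us].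
by apply/negP; apply: acy.
Qed.

Definition spanning_tree (G : sgraph) (F : {set {set G}}) : bool :=
  [&& F \subset edge_set G, connected_rel (edge_rel F)
    & acyclic (edge_rel F)].

(* For graphs with at least two vertices, spanning trees are nonempty edge
   sets, so that edge-disjoint spanning trees are distinct and a family of
   them is the same thing as a set of them. *)
Definition tree_packing (G : sgraph) (P : {set {set {set G}}}) : bool :=
  [forall F in P, spanning_tree F] &&
  [forall F1 in P, forall F2 in P, (F1 != F2) ==> [disjoint F1 & F2]].

Definition tau (G : sgraph) : nat :=
  \max_(P : {set {set {set G}}} | tree_packing P) #|P|.

Section SpectralRadius.
Variable C : numClosedFieldType.

Definition char_roots n (A : 'M[C]_n) : seq C :=
  sval (closed_field_poly_normal (char_poly A)).

Definition spectral_radius n (A : 'M[C]_n) : C :=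
  \big[Num.max/0]_(z <- char_roots A) `|z|.

Lemma mem_char_roots n (A : 'M[C]_n) z :
  (z \in char_roots A) = eigenvalue A z.
Proof.
rewrite eigenvalue_root_char /char_roots.
case: closed_field_poly_normal => r /= ->.
by rewrite (monicP (char_poly_monic A)) scale1r root_prod_XsubC.
Qed.

Lemma spectral_radius_spec n (A : 'M[C]_n) :
  (forall z, eigenvalue A z -> `|z| <= spectral_radius A) /\
  ((0 < n)%N -> exists2 z, eigenvalue A z & `|z| = spectral_radius A).
Proof.
have max_real_seq (s : seq C) : \big[Num.max/0]_(z <- s) `|z| \is Num.real.
  elim: s => [|x s IHs]; rewrite ?big_nil ?big_cons ?real0 //.
  by rewrite max_real ?normr_real.
split=> [z | n_gt0].
  rewrite -mem_char_roots /spectral_radius.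
  elim: (char_roots A) => //= a s IHs; rewrite inE big_cons.
  rewrite comparable_le_max ?real_comparable ?normr_real //.
  by case/predU1P=> [->|/IHs->]; rewrite ?lexx ?orbT.
have [z0 s_z0] : exists z0, z0 \in char_roots A.
  have : size (char_poly A) != 1 by rewrite size_char_poly eqSS -lt0n.
  by move/closed_rootP=> [z]; rewrite -eigenvalue_root_char -mem_char_roots; exists z.
suff [z s_z zE] : exists2 z, z \in char_roots A & `|z| = spectral_radius A.
  by exists z; rewrite -?mem_char_roots.
rewrite /spectral_radius; elim: (char_roots A) z0 s_z0 => // a s IHs _ _.
rewrite big_cons maxEle; case: ifP => [a_le|_]; last by exists a; rewrite ?mem_head.
case: s => [|b s] in IHs a_le *; last first.
  by have [z s_z <-] := IHs b (mem_head _ _); exists z; rewrite // inE s_z orbT.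
exists a; rewrite ?mem_head //; apply/le_anti.
by rewrite a_le big_nil normr_ge0.
Qed.

Definition adj_mx (G : sgraph) : 'M[C]_#|G| :=
  \matrix_(i, j) (edge (enum_val i) (enum_val j))%:R.

Definition rho (G : sgraph) : C := spectral_radius (adj_mx G).

End SpectralRadius.

(* In the vertices of X = 'I_(2h+2), the indices 0 and 1 are u and v when
   h = 1; when h >= 2, the index 0 is c and 1, ..., h are l_1, ..., l_h.
   The vertex y_i has index i - 1 in Y. *)
Definition Mstar (h : nat) : rel nat := fun a b =>
  match h with
  | 0 => false
  | 1 => (a == 0) && (b == 1) || (b == 0) && (a == 1)
  | _ => (a == 0) && (0 < b <= h)%N || (b == 0) && (0 < a <= h)%N
  end%N.

Definition XYstar (h : nat) : rel nat := fun a y =>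
  match h with
  | 0 => false
  | 1 => ((a == 0) || (a == 1)) && (y == 0)
  | _ => (a == 0) && (y < h)%N || (0 < a <= h)%N && (y == 0)
  end%N.

(* X + W + Y *)
Definition star_vertex (h k n : nat) : finType :=
  ('I_(2 * h + 2) + 'I_(k - h - 1) + 'I_(n - k - h - 1))%type.

Definition star_edge (h k n : nat) : rel (star_vertex h k n) := fun p q =>
  match p, q with
  | inl (inl a), inl (inl b) => (a != b) && ~~ Mstar h a b
  | inl (inl _), inl (inr _) | inl (inr _), inl (inl _) => true
  | inl (inl a), inr y | inr y, inl (inl a) => XYstar h a y
  | _, _ => p != q
  end.

Lemma star_edge_sym h k n : symmetric (@star_edge h k n).
Proof.
move=> [[a|w]|y] [[b|w']|y'] //=; rewrite 1?eq_sym //.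
by rewrite /Mstar; case: h a b => [|[|h]] a b //; rewrite orbC.
Qed.

Lemma star_edge_irr h k n : irreflexive (@star_edge h k n).
Proof. by move=> [[a|w]|y] /=; rewrite eqxx. Qed.

Definition Gstar (h k n : nat) : sgraph :=
  SGraph (@star_edge_sym h k n) (@star_edge_irr h k n).

Section QuotientMatrices.
Variable C : numClosedFieldType.

Definition mx_of_rows m (s : seq (seq C)) : 'M[C]_m :=
  \matrix_(i, j) (nth [::] s i)`_j.

Definition Q0 (k n : nat) : 'M[C]_3 :=
  let K : C := k%:R in let N : C := n%:R in
  mx_of_rows 3
   [:: [:: 1; K - 1; 0];
       [:: 2; K - 2; N - K - 1];
       [:: 0; K - 1; N - K - 2]].

Definition Q1 (k n : nat) : 'M[C]_5 :=
  let K : C := k%:R in let N : C := n%:R in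
  mx_of_rows 5
   [:: [:: 0; 2; K - 2; 1; 0];
       [:: 2; 1; K - 2; 0; 0];
       [:: 2; 2; K - 3; 1; N - K - 3];
       [:: 2; 0; K - 2; 0; N - K - 3];
       [:: 0; 0; K - 2; 1; N - K - 4]].

Definition Q2 (h k n : nat) : 'M[C]_7 :=
  let H : C := h%:R in
  let w : C := k%:R - H - 1 in
  let q : C := n%:R - k%:R - 2 * H - 1 in
  mx_of_rows 7
   [:: [:: 0; 0; H + 1; w; 1; H - 1; 0];
       [:: 0; H - 1; H + 1; w; 1; 0; 0];
       [:: 1; H; H; w; 0; 0; 0];
       [:: 1; H; H + 1; w - 1; 1; H - 1; q];
       [:: 1; H; 0; w; 0; H - 1; q];
       [:: 1; 0; 0; w; 1; H - 2; q];
       [:: 0; 0; 0; w; 1; H - 1; q - 1]].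

Definition del_row_col m (i : 'I_m) (A : 'M[C]_m) : 'M[C]_m.-1 :=
  row' i (col' i A).

(* The spectral radius of the matrix Q*_{h,k,n}, whose size depends on h and
   on whether W is empty. *)
Definition rhoQ (h k n : nat) : C :=
  match h with
  | 0 => spectral_radius (Q0 k n)
  | 1 => if k == 2 then spectral_radius (del_row_col (inord 2) (Q1 k n))
         else spectral_radius (Q1 k n)
  | _ => if k == h.+1 then spectral_radius (del_row_col (inord 3) (Q2 h k n))
         else spectral_radius (Q2 h k n)
  end%N.

End QuotientMatrices.

(* Main.v *)
Require Import Defs.
From HB Require Import structures.
From mathcomp Require Import all_boot all_order all_algebra.
From mathcomp Require Import spectral sesquilinear.
From mathcomp Require Import zify ring lra.
Set Implicit Arguments.
Unset Strict Implicit.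
Unset Printing Implicit Defensive.
Import Order.TTheory GRing.Theory Num.Theory.
Local Open Scope ring_scope.

(** Write h = d - k, so that 0 <= h < k, and let G have minimum degree d,
    tau(G) < k and spectral radius at least that of the graph G* of the
    statement. Since G* contains a clique on n - 2h - 2 vertices, the radius r
    of G is at least n - 2h - 3, and everything is about graphs that are almost
    complete.

    Sparse cut. By the theorem of Nash-Williams and Tutte
    ([nash_williams_tutte]), tau(G) < k yields a partition of the vertices into
    q + 1 classes with fewer than kq crossing edges. The inequality
    r^2 <= 2 |E(G)| leaves only boundedly many vertices outside the largest
    class B, and a two-valued test vector then shows that U, the complement
    of B, has at most 2h + 2 vertices. For such a small U the partition may be
    refined to singletons on U and still has too few crossing edges; with all
    degrees at least k + h this forces |U| = 2h + 2 ([sparse_cut]).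

    Reduction to a clique. Adding all missing edges inside B changes no degree
    in U and no edge that touches U, and strictly increases the radius unless
    there is nothing to add. So B may be taken to be a clique on N vertices.

    Expansion. Eliminate the coordinates of the Perron vector on B. With A the
    adjacency matrix on U, L_xy the number of common neighbours of x and y in B
    and d_x the number of neighbours of x in B, the remaining coordinates satisfy
    r x = d + A x + L x / (r + 1), and (r + 1) (r + 1 - N) = d.x
    ([perron_sigma]). Iterating the first equation,
    r^3 d.x = r^2 d.d + r d.Ad + Ad.Ad + r/(r+1) d.Ld + O(1/r)
    ([sigma_expansion]). Hence, for large n, comparing radii means comparing the
    four integers d.d, d.Ad, Ad.Ad, d.Ld lexicographically
    ([compare_invariants]).

    Optimisation. Let m_x be the number of non-neighbours of x in U and
    a = k - h - 1. Counting degrees and edges gives d_x = a + m_x + f_x with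
    f >= 0 and sum m + 2 sum f <= 2h. The largest value of d.d forces f = 0 and
    makes any two missing edges of U meet, so that they form a star (or a
    triangle when h = 3); the largest value of d.Ad leaves only the star with h
    edges; Ad.Ad is then determined; and d.Ld is largest exactly when the
    neighbourhoods in B are nested ([extremal_structure]). A nested family is
    determined up to isomorphism by the sizes of its members, and G* realises
    this configuration ([threshold_isomorphic]).

    Finally, the matrices Q* are quotients of G* by equitable partitions, and an
    equitable quotient has the same spectral radius as the graph
    ([equitable_quotient_radius]). *)

(** * The real elements of a numerically closed field *)

Section RealSubfield.
Variable C : numClosedFieldType.

(** The order of a numerically closed field is only partial. Perron vectors and
    radii are moved to this subfield, where it is total and linear arithmetic
    applies. *)
Record real_of := RealOf { real_val : C; real_valP : real_val \is Num.real }.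

HB.instance Definition _ := [isSub of real_of for real_val].
HB.instance Definition _ := [Choice of real_of by <:].
HB.instance Definition _ := [SubChoice_isSubIntegralDomain of real_of by <:].
HB.instance Definition _ := [SubIntegralDomain_isSubField of real_of by <:].

Let rle (x y : real_of) := real_val x <= real_val y.
Let rlt (x y : real_of) := real_val x < real_val y.
Let rnorm (x : real_of) := RealOf (normr_real (real_val x)).

Fact rle0_add x y : rle 0 x -> rle 0 y -> rle 0 (x + y).
Proof. exact: addr_ge0. Qed.
Fact rle0_mul x y : rle 0 x -> rle 0 y -> rle 0 (x * y).
Proof. exact: mulr_ge0. Qed.
Fact rle0_anti x : rle 0 x -> rle x 0 -> x = 0.
Proof. by move=> x0 x1; apply/val_inj/le_anti; rewrite /= [_ <= _]x1 [_ <= _]x0. Qed.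
Fact rsub_ge0 x y : rle 0 (y - x) = rle x y.
Proof. exact: subr_ge0. Qed.
Fact rle0_total x : rle 0 x || rle x 0.
Proof. exact: real_valP. Qed.
Fact rnormN x : rnorm (- x) = rnorm x.
Proof. by apply: val_inj; rewrite /= normrN. Qed.
Fact rge0_norm x : rle 0 x -> rnorm x = x.
Proof. by move=> x0; apply: val_inj; rewrite /= ger0_norm. Qed.
Fact rlt_def x y : rlt x y = (y != x) && rle x y.
Proof. exact: lt_def. Qed.

HB.instance Definition _ := Num.IntegralDomain_isLeReal.Build real_of
  rle0_add rle0_mul rle0_anti rsub_ge0 rle0_total rnormN rge0_norm rlt_def.

Lemma real_val_le (x y : real_of) : (real_val x <= real_val y) = (x <= y).
Proof. by []. Qed.

Lemma real_val_lt (x y : real_of) : (real_val x < real_val y) = (x < y).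
Proof. by []. Qed.

Lemma real_val_natr n : real_val n%:R = n%:R.
Proof. by elim: n => // n IHn; rewrite !mulrS -IHn. Qed.

Lemma real_valM (x y : real_of) : real_val (x * y) = real_val x * real_val y.
Proof. by []. Qed.

Lemma real_val_sum (I : Type) (r : seq I) (P : pred I) (F : I -> real_of) :
  real_val (\sum_(i <- r | P i) F i) = \sum_(i <- r | P i) real_val (F i).
Proof. exact: (big_morph real_val). Qed.
End RealSubfield.

(** * Perron pairs of connected graphs *)

Section PerronMatrix.
Variable C : numClosedFieldType.
Local Open Scope sesquilinear_scope.

(** Let v be an eigenvector for an eigenvalue of largest modulus rho. The vector
    |v| has Rayleigh quotient at least rho, by the triangle inequality and the
    nonnegativity of A, while rho I - A is positive semidefinite by the spectral
    theorem. So |v| is a zero of a positive semidefinite form, hence in its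
    kernel. *)
Lemma nonneg_symmetric_perron n (A : 'M[C]_n) :
    (0 < n)%N -> A^T = A -> (forall i j, 0 <= A i j) ->
  exists2 p : 'rV[C]_n, p != 0 /\ (forall i, 0 <= p 0 i) &
    p *m A = spectral_radius A *: p.
Proof.
move=> n_gt0 Asym Age0.
have [rho_max /(_ n_gt0)[z z_eig z_rho]] := spectral_radius_spec A.
set rho := spectral_radius A in rho_max z_rho *.
have rho_ge0 : 0 <= rho by rewrite -z_rho.
have Aherm : A^t* = A.
  rewrite Asym; apply/matrixP => i j; rewrite mxE.
  by apply/CrealP; rewrite ger0_real.
have Anormal : A \is normalmx by apply/normalmxP; rewrite Aherm.
have /orthomx_spectralP := Anormal.
set P := spectralmx A; set D := spectral_diag A.
have Pu : P \is unitarymx by apply: spectral_unitarymx.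
have PtP : P^t* *m P = 1%:M.
  by rewrite -invmx_unitary // mulVmx // unitarymx_unit.
have PPt : P *m P^t* = 1%:M by apply/unitarymxP.
rewrite invmx_unitary // => Aeq.
have Dreal i : D 0 i \is Num.real.
  have /mxOverP : D \is a realmx; last exact.
  apply: hermitian_spectral_diag_real; apply/is_hermitianmxP.
  by rewrite expr0 scale1r Aherm.
have Dle i : D 0 i <= rho.
  apply: le_trans (real_ler_norm (Dreal i)) _; apply: rho_max.
  apply/eigenvalueP; exists (row i P).
    rewrite -row_mul {1}Aeq !mulmxA PPt mul1mx.
    by apply/rowP => j; rewrite mul_diag_mx !mxE.
  apply/negP => /eqP Pi0; have := PPt.
  move=> /(congr1 (row i)); rewrite row_mul Pi0 mul0mx row1.
  by move=> /rowP/(_ i)/eqP; rewrite !mxE !eqxx eq_sym oner_eq0.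
have [v vA v_neq0] := eigenvalueP z_eig.
pose w : 'rV[C]_n := \row_i `|v 0 i|.
pose y := w *m P^t*.
have wE : w = y *m P by rewrite /y -mulmxA PtP mulmx1.
have wA : w *m A = (y *m diag_mx D) *m P by rewrite {1}Aeq !mulmxA.
clearbody y.
(* the quadratic form of rho I - A, diagonalised by the unitary matrix P *)
have formE : (w *m (rho%:M - A) *m w^t*) 0 0
           = \sum_i (rho - D 0 i) * `|y 0 i| ^+ 2.
  have -> : w *m (rho%:M - A) *m w^t* = (y *m (rho%:M - diag_mx D)) *m y^t*.
    have -> : w *m (rho%:M - A) = (y *m (rho%:M - diag_mx D)) *m P.
      by rewrite !mulmxBr wA mulmxBl !mul_mx_scalar wE scalemxAl.
    by rewrite wE trmx_mul map_mxM -!mulmxA (mulmxA P) PPt mul1mx.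
  rewrite mxE; apply: eq_bigr => i _.
  rewrite -diag_const_mx -raddfB mul_mx_diag !mxE normCK.
  by rewrite [y 0 i * _]mulrC -mulrA.
(* nonpositive on |v|, by the triangle inequality for v *)
have form_le0 : (w *m (rho%:M - A) *m w^t*) 0 0 <= 0.
  rewrite mulmxBr mulmxBl mxE [X in _ + X]mxE subr_le0.
  have -> : (w *m rho%:M *m w^t*) 0 0 = `|(v *m A *m v^t*) 0 0|.
    rewrite mul_mx_scalar vA -!scalemxAl !mxE normrM z_rho; congr (_ * _).
    rewrite ger0_norm ?sumr_ge0 // => [|i _]; last by rewrite !mxE mul_conjC_ge0.
    by apply: eq_bigr => i _; rewrite !mxE conj_normC -normCK expr2.
  rewrite [in X in X <= _]mxE; apply: le_trans (ler_norm_sum _ _ _) _.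
  rewrite [X in _ <= X]mxE; apply: ler_sum => i _.
  rewrite normrM !mxE norm_conjC conj_normC ler_wpM2r //.
  apply: le_trans (ler_norm_sum _ _ _) _; apply: ler_sum => j _.
  by rewrite normrM mxE (ger0_norm (Age0 _ _)).
have yD i : (rho - D 0 i) * y 0 i = 0.
  have ge0 j : true -> 0 <= (rho - D 0 j) * `|y 0 j| ^+ 2.
    by rewrite mulr_ge0 ?subr_ge0 ?exprn_ge0.
  have := form_le0; rewrite formE => le0.
  have /eqP := le_anti (introT andP (conj le0 (sumr_ge0 _ ge0))).
  rewrite psumr_eq0 // => /allP/(_ i (mem_index_enum _))/=.
  rewrite mulf_eq0 expf_eq0 normr_eq0 /= => /orP[|] /eqP->;
  by rewrite ?mul0r ?mulr0.
exists w; last first.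
  rewrite wA wE scalemxAl; congr (_ *m P); apply/rowP => i.
  rewrite mul_mx_diag !mxE; apply/eqP; rewrite -subr_eq0 mulrC -mulrBl.
  by rewrite -opprB mulNr yD oppr0.
split=> [|i]; last by rewrite mxE.
apply: contraNneq v_neq0 => w0; apply/eqP/rowP => i.
rewrite [RHS]mxE; apply/normr0_eq0.
by have /rowP/(_ i) := w0; rewrite !mxE.
Qed.
End PerronMatrix.

Section PerronGraph.
Variable C : numClosedFieldType.
Local Notation R := (real_of C).

Lemma eigenvalue_adjP (G : sgraph) (z : C) :
  reflect (exists2 f : G -> C, (exists x, f x != 0) &
             forall x, \sum_y (edge x y)%:R * f y = z * f x)
          (eigenvalue (adj_mx C G) z).
Proof.
have reidx (f : G -> C) : \sum_(i < #|G|) f (enum_val i) = \sum_x f x.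
  rewrite [RHS](reindex_onto enum_val enum_rank) /= => [|x _].
    by apply: eq_bigl => i; rewrite enum_valK eqxx.
  exact: enum_rankK.
apply: (iffP eigenvalueP) => [[v vA v_neq0] | [f [x fx_neq0] fA]].
  exists (fun x => v 0 (enum_rank x)).
    have [i vi] : exists i, v 0 i != 0.
      apply/existsP; apply: contraNT v_neq0 => /existsPn v0.
      by apply/eqP/rowP => i; rewrite mxE; apply/eqP; rewrite -[_ == _]negbK v0.
    by exists (enum_val i); rewrite enum_valK.
  move=> x; have /rowP/(_ (enum_rank x)) := vA; rewrite !mxE => <-.
  rewrite -reidx; apply: eq_bigr => i _.
  by rewrite mxE !enum_rankK enum_valK mulrC edge_sym.
exists (\row_i f (enum_val i)).
  apply/rowP => i; rewrite !mxE -fA -reidx; apply: eq_bigr => j _.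
  by rewrite !mxE mulrC edge_sym.
apply: contraNneq fx_neq0 => /rowP/(_ (enum_rank x)).
by rewrite !mxE enum_rankK => ->.
Qed.

Definition perron_pair (G : sgraph) (r : R) (p : G -> R) : Prop :=
  (forall x, 0 < p x) /\ forall x, \sum_y (edge x y)%:R * p y = r * p x.

Lemma connected_relP (T : finType) (e : rel T) (S : T -> Prop) (x0 : T) :
    connected_rel e -> S x0 -> (forall x y, e x y -> S x -> S y) ->
  forall x, S x.
Proof.
move=> /forallP/(_ x0)/forallP conn S0 Se x.
have /connectP[q path_q ->] := conn x.
elim: q x0 S0 path_q {conn} => //= y q IHq x0 S0 /andP[e_xy path_q].
exact: IHq (Se _ _ e_xy S0) path_q.
Qed.

(** A zero coordinate of a nonnegative eigenvector makes all neighbouring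
    coordinates vanish, hence all coordinates when G is connected. *)
Lemma perron_exists (G : sgraph) : (0 < #|G|)%N -> connected_rel (@edge G) ->
  exists r : R, real_val r = rho C G /\ exists p, @perron_pair G r p.
Proof.
move=> G_gt0 conn.
have [||p [p_neq0 p_ge0] pA] := nonneg_symmetric_perron (A := adj_mx C G) G_gt0.
- by apply/matrixP => i j; rewrite !mxE edge_sym.
- by move=> i j; rewrite mxE.
have rho_eig : eigenvalue (adj_mx C G) (rho C G) by apply/eigenvalueP; exists p.
have rho_real : rho C G \is Num.real.
  rewrite /rho; have [_ /(_ G_gt0)[z _ <-]] := spectral_radius_spec (adj_mx C G).
  exact: normr_real.
pose f x := RealOf (ger0_real (p_ge0 (enum_rank x : 'I_#|G|))).
have fA x : \sum_y (edge x y)%:R * f y = RealOf rho_real * f x.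
  apply: val_inj; rewrite /= real_val_sum.
  have /rowP/(_ (enum_rank x)) := pA; rewrite !mxE => <-.
  rewrite (reindex_onto enum_val enum_rank) /= => [|y _]; last first.
    exact: enum_rankK.
  rewrite (eq_bigl xpredT) => [|i]; last by rewrite enum_valK eqxx.
  apply: eq_bigr => i _.
  by rewrite real_val_natr mxE !enum_rankK /= enum_valK mulrC edge_sym.
have f_ge0 x : 0 <= f x by exact: p_ge0.
exists (RealOf rho_real); split=> //; exists f; split=> // x.
rewrite lt0r f_ge0 andbT; apply: contraNneq p_neq0 => fx0.
suff f0 y : f y = 0.
  apply/eqP/rowP => i; rewrite mxE -[i]enum_valK.
  exact: (congr1 (@real_val C) (f0 (enum_val i))).
apply: (@connected_relP _ _ (fun y => f y = 0) x conn fx0) => {}y z e_yz fy0.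
have /eqP := fA y; rewrite fy0 mulr0 psumr_eq0 => [|t _]; last first.
  by rewrite mulr_ge0.
by move=> /allP/(_ z (mem_index_enum _)); rewrite e_yz mul1r => /eqP.
Qed.

(** As the adjacency matrix is symmetric, pairing a test vector z with the Perron
    vector turns entrywise bounds on A z into bounds on r. *)
Lemma perron_symm (G : sgraph) r p (z : G -> R) : @perron_pair G r p ->
  \sum_x p x * \sum_y (edge x y)%:R * z y = r * \sum_x p x * z x.
Proof.
move=> [_ pA]; rewrite mulr_sumr.
under eq_bigr do rewrite mulr_sumr.
rewrite exchange_big; apply: eq_bigr => y _ /=.
rewrite mulrA -pA mulr_suml; apply: eq_bigr => x _.
by rewrite edge_sym; ring.
Qed.

Lemma perron_weight_gt0 (G : sgraph) r p (z : G -> R) x0 :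
    @perron_pair G r p -> (forall x, 0 <= z x) -> 0 < z x0 ->
  0 < \sum_x p x * z x.
Proof.
move=> [p_gt0 _] z_ge0 zx0; rewrite (bigD1 x0) //= ltr_wpDr ?mulr_gt0 //.
by rewrite sumr_ge0 // => x _; rewrite mulr_ge0 // ltW.
Qed.

Lemma perron_test_le (G : sgraph) r p (z : G -> R) c : @perron_pair G r p ->
    (forall x, 0 <= z x) -> (exists x, 0 < z x) ->
    (forall x, \sum_y (edge x y)%:R * z y <= c * z x) ->
  r <= c.
Proof.
move=> pp z_ge0 [x0 zx0] zA; have [p_gt0 _] := pp.
have s_gt0 := perron_weight_gt0 pp z_ge0 zx0.
rewrite -(ler_pM2r s_gt0) -(perron_symm z pp) mulr_sumr.
by apply: ler_sum => x _; rewrite mulrCA ler_pM2l.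
Qed.

Lemma perron_test_lt (G : sgraph) r p (z : G -> R) c : @perron_pair G r p ->
    (forall x, 0 <= z x) ->
    (forall x, \sum_y (edge x y)%:R * z y <= c * z x) ->
    (exists x, \sum_y (edge x y)%:R * z y < c * z x) ->
  r < c.
Proof.
move=> pp z_ge0 zA [x0 zx0]; have [p_gt0 _] := pp.
have s_ge0 : 0 <= \sum_x p x * z x.
  by rewrite sumr_ge0 // => x _; rewrite mulr_ge0 // ltW.
have : r * \sum_x p x * z x < c * \sum_x p x * z x.
  rewrite -(perron_symm z pp) mulr_sumr (bigD1 x0) //= [X in _ < X](bigD1 x0) //=.
  apply: ltr_leD; first by rewrite mulrCA ltr_pM2l.
  by apply: ler_sum => x _; rewrite mulrCA ler_pM2l.
by apply: contraTT; rewrite -!leNgt => rc; rewrite ler_wpM2r.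
Qed.

Lemma perron_test_ge (G : sgraph) r p (z : G -> R) c : @perron_pair G r p ->
    (forall x, 0 <= z x) -> (exists x, 0 < z x) ->
    (forall x, c * z x <= \sum_y (edge x y)%:R * z y) ->
  c <= r.
Proof.
move=> pp z_ge0 [x0 zx0] zA; have [p_gt0 _] := pp.
have s_gt0 := perron_weight_gt0 pp z_ge0 zx0.
rewrite -(ler_pM2r s_gt0) -(perron_symm z pp) mulr_sumr.
by apply: ler_sum => x _; rewrite mulrCA ler_pM2l.
Qed.

(** Take the Perron vector of H, read through f, as a test vector on G. *)
Lemma perron_monotone (G H : sgraph) (f : G -> H) r p r' p' (x0 : G) :
    bijective f -> {homo f : x y / edge x y} ->
    @perron_pair G r p -> @perron_pair H r' p' ->
  r <= r' /\ (r = r' -> forall x y, edge (f x) (f y) = edge x y).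
Proof.
move=> f_bij f_edge pp pp'; have [p_gt0 _] := pp; have [p'_gt0 p'A] := pp'.
have p'fA x : r' * p' (f x) = \sum_y (edge (f x) (f y))%:R * p' (f y).
  by rewrite -p'A (reindex f) //; apply: onW_bij.
have le_edge x y : (edge x y)%:R * p' (f y) <= (edge (f x) (f y))%:R * p' (f y).
  rewrite ler_pM2r // ler_nat; have := f_edge x y.
  by case: (edge x y) => // ->.
have le_sum x : \sum_y (edge x y)%:R * p' (f y) <= r' * p' (f x).
  by rewrite p'fA; apply: ler_sum => y _.
split; first by apply: (perron_test_le pp _ _ le_sum) => [x|]; [apply: ltW | exists x0].
move=> r_eq x y; apply/idP/idP; last exact: f_edge.
apply: contraLR => nxy; apply/negP => fxy.
suff : r < r' by rewrite r_eq ltxx.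
apply: (perron_test_lt pp _ le_sum) => [z|]; first exact: ltW.
exists x; rewrite p'fA (bigD1 y) //= [X in _ < X](bigD1 y) //=.
by rewrite fxy (negbTE nxy) mul0r mul1r ltr_leD // ler_sum.
Qed.

Lemma perron_iso (G H : sgraph) r p r' p' (x0 : G) :
  isomorphic G H -> @perron_pair G r p -> @perron_pair H r' p' -> r = r'.
Proof.
move=> [f f_bij f_edge] pp pp'; have [g fK gK] := f_bij.
have fg_edge x y : edge (g x) (g y) = edge x y by rewrite -f_edge !gK.
have f_homo : {homo f : x y / edge x y} by move=> x y; rewrite f_edge.
have g_homo : {homo g : x y / edge x y} by move=> x y; rewrite fg_edge.
have g_bij : bijective g by exists f.
apply/le_anti; have [-> _] := perron_monotone x0 f_bij f_homo pp pp'.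
by have [-> _] := perron_monotone (f x0) g_bij g_homo pp' pp.
Qed.

(** Pair the Perron vector with the constant vector: the entries of A^2 1 are
    sums of degrees over a neighbourhood. *)
Lemma perron_sqr_le (G : sgraph) r p (x0 : G) : @perron_pair G r p ->
  r ^+ 2 <= (\sum_(x : G) degree x)%:R.
Proof.
move=> pp; have [p_gt0 _] := pp.
have s_gt0 : 0 < \sum_x p x.
  by rewrite (bigD1 x0) //= ltr_wpDr // sumr_ge0 // => x _; apply: ltW.
have sE : \sum_x p x = \sum_x p x * 1 by apply: eq_bigr => x _; rewrite mulr1.
rewrite -(ler_pM2r s_gt0) expr2 -mulrA {1}sE -(perron_symm _ pp) -(perron_symm _ pp).
rewrite mulr_sumr; apply: ler_sum => x _; rewrite mulrC ler_pM2r //.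
rewrite natr_sum; apply: ler_sum => y _.
have -> : \sum_z (edge y z)%:R * 1 = (degree y)%:R :> R.
  rewrite /degree -sum1_card natr_sum [RHS]big_mkcond; apply: eq_bigr => z _.
  by rewrite inE mulr1; case: (edge y z).
by case: (edge x y); rewrite ?mul1r ?mul0r ?ler0n.
Qed.
End PerronGraph.

(** * Quotients by equitable partitions *)

Lemma char_poly_trmx (C : comNzRingType) n (A : 'M[C]_n) :
  char_poly A^T = char_poly A.
Proof.
by rewrite /char_poly /char_poly_mx -[RHS]det_tr linearB /= tr_scalar_mx map_trmx.
Qed.

(** Summing the Perron vector over the cells gives a left eigenvector of Q, so
    rho(G) is an eigenvalue of Q. Conversely a right eigenvector of Q lifts to an
    eigenvector of G that is constant on the cells, so every eigenvalue of Q is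
    one of G. *)
Lemma equitable_quotient_radius (C : numClosedFieldType) (G : sgraph) m
    (Q : 'M[C]_m) (cell : G -> 'I_m) :
    (0 < #|G|)%N -> connected_rel (@edge G) ->
    (forall i, exists x, cell x = i) ->
    (forall x i, (\sum_(y | cell y == i) edge x y)%:R = Q (cell x) i) ->
  spectral_radius Q = rho C G.
Proof.
move=> G_gt0 conn cell_surj QE.
have [r [rE [p [p_gt0 pA]]]] := perron_exists C G_gt0 conn.
have [Qmax _] := spectral_radius_spec Q.
have [Amax _] := spectral_radius_spec (adj_mx C G).
have m_gt0 : (0 < m)%N.
  by case/card_gt0P: G_gt0 => x _; apply: leq_ltn_trans (ltn_ord (cell x)).
have rho_ge0 : 0 <= rho C G.
  have [_ /(_ G_gt0)[z _]] := spectral_radius_spec (adj_mx C G).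
  by rewrite /rho => <-.
apply/le_anti/andP; split.
  have [_ /(_ m_gt0)[z z_eig <-]] := spectral_radius_spec Q.
  apply: Amax; move: z_eig.
  rewrite eigenvalue_root_char -char_poly_trmx -eigenvalue_root_char.
  move=> /eigenvalueP[v vQ v_neq0]; apply/eigenvalue_adjP.
  exists (fun x => v 0 (cell x)).
    have [i vi] : exists i, v 0 i != 0.
      apply/existsP; apply: contraNT v_neq0 => /existsPn v0.
      by apply/eqP/rowP => i; rewrite mxE; apply/eqP; rewrite -[_ == _]negbK v0.
    by have [x xi] := cell_surj i; exists x; rewrite xi.
  move=> x; have /rowP/(_ (cell x)) := vQ; rewrite !mxE => <-.
  rewrite (partition_big cell xpredT) //=; apply: eq_bigr => i _.
  rewrite mxE -QE natr_sum mulr_sumr; apply: eq_bigr => y /eqP <-.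
  by rewrite mulrC.
rewrite -(ger0_norm rho_ge0) /rho; apply: Qmax; apply/eigenvalueP.
exists (\row_i \sum_(x | cell x == i) real_val (p x)).
  apply/rowP => i; rewrite !mxE -/(rho C G) -rE mulr_sumr.
  under [RHS]eq_bigr => y _.
    rewrite -real_valM -pA real_val_sum.
    under eq_bigr do rewrite real_valM real_val_natr edge_sym. over.
  rewrite /= exchange_big (partition_big cell xpredT) //=.
  apply: eq_bigr => j _; rewrite mxE mulr_suml; apply: eq_bigr => y /eqP <-.
  by rewrite -QE natr_sum mulr_sumr; apply: eq_bigr => x _; rewrite mulrC.
case/card_gt0P: G_gt0 => x _.
apply/negP => /eqP/rowP/(_ (cell x)); rewrite !mxE => /eqP.
rewrite psumr_eq0 => [/allP/(_ x (mem_index_enum _))|y _]; last exact: ltW (p_gt0 y).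
by rewrite eqxx /= => /eqP px0; have := p_gt0 x; rewrite -real_val_lt /= px0 ltxx.
Qed.

(** * Components and forests *)

Section Components.
Local Open Scope nat_scope.
Variable G : sgraph.
Implicit Types (F A : {set {set G}}) (x y a b : G).

Definition linked F : rel G := connect (edge_rel F).
Definition component F x : {set G} := [set y | linked F x y].
Definition components F : {set {set G}} := [set component F x | x : G].
Definition ncomp F : nat := #|components F|.

Lemma linked_sym F : symmetric (linked F).
Proof. by apply: sym_connect_sym => u v; rewrite /edge_rel /= setUC. Qed.

Lemma linked_trans F : transitive (linked F).
Proof. exact: connect_trans. Qed.

Lemma linked_refl F x : linked F x x.
Proof. exact: connect0. Qed.

Lemma linked_edge F x y : [set x; y] \in F -> linked F x y.
Proof. exact: (@connect1 _ (edge_rel F)). Qed.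

Lemma linked_ind F (S : G -> Prop) a b :
  (forall u v, [set u; v] \in F -> S u -> S v) -> linked F a b -> S a -> S b.
Proof.
move=> step /connectP[q + ->]; elim: q a => //= c q IHq a /andP[ac cq] Sa.
exact: IHq cq (step _ _ ac Sa).
Qed.

Lemma linked_span F A a b :
  (forall u v, [set u; v] \in F -> linked A u v) -> linked F a b -> linked A a b.
Proof.
move=> FA /(linked_ind (S := linked A a)); apply; last exact: linked_refl.
by move=> u v /FA uv au; apply: linked_trans au uv.
Qed.

Lemma linkedS F A a b : F \subset A -> linked F a b -> linked A a b.
Proof.
by move=> FA; apply: linked_span => u v uvF; apply/linked_edge/(subsetP FA).
Qed.

Lemma pair_set_inj a b u v : [set a; b] = [set u; v] :> {set G} ->
  (a = u /\ b = v) \/ (a = v /\ b = u).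
Proof.
move=> E; have := set21 a b; rewrite E !inE => /orP[]/eqP a_eq.
  move: E; rewrite a_eq => E; left; split=> //.
  have := set22 u b; rewrite E !inE => /orP[]/eqP // b_eq.
  by have := set22 u v; rewrite -E !inE => /orP[]/eqP ->.
move: E; rewrite a_eq => E; right; split=> //.
have := set22 v b; rewrite E !inE => /orP[]/eqP // b_eq.
by have := set21 u v; rewrite -E !inE => /orP[]/eqP ->.
Qed.

Lemma linked_add F x y a b : linked ([set x; y] |: F) a b ->
  [|| linked F a b, linked F a x && linked F y b | linked F a y && linked F x b].
Proof.
move=> /(linked_ind (S := fun b => [|| linked F a b,
  linked F a x && linked F y b | linked F a y && linked F x b])).
apply; last by rewrite linked_refl.
move=> u v; rewrite in_setU1 => /orP[/eqP uv|/linked_edge uv].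
  case: (pair_set_inj uv) => -[-> ->].
    by case/or3P=> [->|/andP[-> _]|/andP[-> _]]; rewrite ?linked_refl ?orbT.
  by case/or3P=> [->|/andP[-> _]|/andP[-> _]]; rewrite ?linked_refl ?orbT.
case/or3P=> [au|/andP[-> yu]|/andP[-> xu]].
- by rewrite (linked_trans au uv).
- by rewrite (linked_trans yu uv) orbT.
- by rewrite (linked_trans xu uv) !orbT.
Qed.

Lemma component_eqP F x y : reflect (component F x = component F y) (linked F x y).
Proof.
apply: (iffP idP) => [xy|E]; last first.
  by have := linked_refl F y; rewrite -in_set -/(component F y) -E inE.
apply/setP => z; rewrite !inE; apply/idP/idP; apply: linked_trans => //.
by rewrite linked_sym.
Qed.

Lemma ncomp_span F A : (forall a b, linked F a b = linked A a b) ->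
  ncomp F = ncomp A.
Proof.
move=> FA; rewrite /ncomp /components; congr #|pred_of_set _|.
by apply: eq_imset => x; apply/setP => y; rewrite !inE FA.
Qed.

Lemma ncomp_add_linked F x y : linked F x y ->
  ncomp ([set x; y] |: F) = ncomp F.
Proof.
move=> xy; apply: ncomp_span => a b; apply/idP/idP; last exact/linkedS/subsetUr.
apply: linked_span => u v; rewrite in_setU1 => /orP[/eqP uv|]; last exact: linked_edge.
by case: (pair_set_inj uv) => -[-> ->] //; rewrite linked_sym.
Qed.

Lemma ncomp_add F x y : ~~ linked F x y ->
  (ncomp ([set x; y] |: F)).+1 = ncomp F.
Proof.
move=> nxy; set F' := _ |: F.
have FF' : F \subset F' by apply: subsetUr.
have xy' : linked F' x y by apply/linked_edge/setU11.
have compx : component F' x = component F x :|: component F y.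
  apply/setP => z; rewrite !inE; apply/idP/orP.
    by case/linked_add/or3P=> [->|/andP[_ ->]|/andP[]]; [left|right|rewrite (negbTE nxy)].
  by case=> /(linkedS FF') // yz; apply: linked_trans xy' yz.
have comp_other z : ~~ linked F z x -> ~~ linked F z y ->
    component F' z = component F z.
  move=> zx zy; apply/setP => w; rewrite !inE; apply/idP/idP; last exact: linkedS.
  by case/linked_add/or3P=> [->|/andP[]|/andP[]] //; rewrite ?(negbTE zx) ?(negbTE zy).
have mem_y : component F y \in components F by apply: imset_f.
have mem_x : component F x \in components F by apply: imset_f.
have xNy : component F x != component F y by apply: contra nxy => /eqP/component_eqP.
have -> : ncomp F' = #|component F' x |: (components F :\ component F x :\ component F y)|.
  rewrite /ncomp /components; congr #|pred_of_set _|; apply/setP => K.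
  rewrite !inE; apply/imsetP/idP => [[z _ ->]|].
    case zx : (linked F z x).
      by rewrite (_ : component F' z = component F' x) ?eqxx //;
         apply/component_eqP/(linkedS FF').
    case zy : (linked F z y).
      rewrite (_ : component F' z = component F' x) ?eqxx //.
      apply/component_eqP; apply: linked_trans (linkedS FF' zy) _.
      by rewrite linked_sym.
    rewrite comp_other ?zx ?zy //; apply/orP; right; rewrite imset_f // andbT.
    by apply/andP; split; apply/negP => /eqP/component_eqP; rewrite ?zx ?zy.
  case/orP=> [/eqP ->|]; first by exists x.
  case/and3P=> Ky Kx /imsetP[z _ KE]; exists z => //; rewrite comp_other //.
    by apply: contra Kx => /component_eqP <-; rewrite KE.
  by apply: contra Ky => /component_eqP <-; rewrite KE.
rewrite cardsU1 (_ : component F' x \notin _) /=; last first.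
  rewrite !inE; apply/negP => /and3P[_ _ /imsetP[z _ E]].
  have : x \in component F z by rewrite -E inE linked_refl.
  have : y \in component F z by rewrite -E inE.
  rewrite !inE => zy; rewrite linked_sym => xz.
  by case/negP: nxy; apply: linked_trans xz zy.
rewrite add1n /ncomp [RHS](cardsD1 (component F x)) mem_x.
by rewrite [in RHS](cardsD1 (component F y)) !inE mem_y andbT eq_sym xNy.
Qed.

Lemma edge_setP (f : {set G}) :
  reflect (exists x y, f = [set x; y] /\ edge x y) (f \in edge_set G).
Proof.
apply: (iffP imsetP) => [[[x y] + ->]|[x [y [-> exy]]]].
  by rewrite inE => exy; exists x, y.
by exists (x, y); rewrite ?inE.
Qed.

Lemma edge_setE x y : ([set x; y] \in edge_set G) = edge x y.
Proof.
apply/edge_setP/idP => [[u [v [/pair_set_inj[]]]]|]; last by exists x, y.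
  by case=> -> ->.
by case=> -> ->; rewrite edge_sym.
Qed.

Lemma ncomp_unionU A F : A \subset edge_set G ->
  (ncomp F <= ncomp (A :|: F) + #|A|)%N.
Proof.
have [n] := ubnP #|A|; elim: n A => // n IHn A An AE.
have [->|[f fA]] := set_0Vmem A; first by rewrite set0U leq_addr.
have fE := subsetP AE _ fA; case/edge_setP: (fE) => x [y [fxy _]]; subst f.
move: An; rewrite -(setD1K fA) cardsU1 !inE eqxx /= add1n ltnS => An.
have AE' : A :\ [set x; y] \subset edge_set G by apply: subset_trans AE; apply: subsetDl.
apply: leq_trans (IHn _ An AE') _; rewrite -setUA.
have [xy|nxy] := boolP (linked (A :\ [set x; y] :|: F) x y).
  by rewrite ncomp_add_linked // leq_add2l.
by rewrite -(ncomp_add nxy) addSnnS.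
Qed.

Lemma ncomp0 : ncomp set0 = #|G|.
Proof.
rewrite /ncomp card_imset // => x y /component_eqP xy.
by apply: (linked_ind (S := fun z => x = z)) xy _ => // u v; rewrite inE.
Qed.

Lemma ncomp_lower A : A \subset edge_set G -> (#|G| <= #|A| + ncomp A)%N.
Proof. by move=> /(ncomp_unionU set0); rewrite ncomp0 setU0 addnC. Qed.

(** Since each new edge removes at most one component, this numerical condition
    says that no edge is redundant. It is easier to exchange edges with it than
    with the absence of cycles, which it implies by [forest_acyclic]. *)
Definition forest F := (F \subset edge_set G) && (#|F| + ncomp F == #|G|).

Lemma forest_edges F : forest F -> F \subset edge_set G.
Proof. by case/andP. Qed.

Lemma forest0 : forest set0.
Proof. by rewrite /forest sub0set cards0 ncomp0 eqxx. Qed.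

Lemma forestS F A : A \subset F -> forest F -> forest A.
Proof.
move=> AF /andP[FE /eqP Fn]; have AE := subset_trans AF FE.
rewrite /forest AE eqn_leq ncomp_lower // andbT -Fn.
have := @ncomp_unionU (F :\: A) A (subset_trans (subsetDl _ _) FE).
have -> : F :\: A :|: A = F.
  by have := setID F A; rewrite (setIidPr AF) setUC.
by have := cardsID A F; have /setIidPr -> := AF; lia.
Qed.

Lemma forest_bridge F x y : forest F -> [set x; y] \in F ->
  ~~ linked (F :\ [set x; y]) x y.
Proof.
move=> Ff xyF; apply/negP => xy; have := forestS (subsetDl F [set [set x; y]]) Ff.
case/andP: Ff => _ /eqP; rewrite -{1 2}(setD1K xyF) ncomp_add_linked //.
by rewrite cardsU1 !inE eqxx /= => En /andP[_]; rewrite -En add1n addSn eqn_leq ltnn andbF.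
Qed.

Lemma forest_add F x y : forest F -> edge x y -> ~~ linked F x y ->
  forest ([set x; y] |: F).
Proof.
move=> /andP[FE /eqP Fn] exy nxy; apply/andP; split.
  by rewrite subUset FE sub1set edge_setE exy.
have xyF : [set x; y] \notin F by apply: contra nxy => /linked_edge.
by rewrite cardsU1 xyF; have := ncomp_add nxy; lia.
Qed.

(** The rest of a cycle would still join the ends of its first edge after that
    edge is removed. *)
Lemma forest_acyclic F : forest F -> acyclic (edge_rel F).
Proof.
move=> Ff; apply/acyclicP => -[|x [|y [|z s]]] //= _.
rewrite !inE !negb_or -!andbA => /and5P[xy xz xs yz /and3P[ys zs Us]].
apply/negP => /andP[xyF /andP[yzF path_s]].
have /negP := forest_bridge Ff xyF; apply.
rewrite linked_sym; apply: (@linked_trans _ z).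
  apply: linked_edge; rewrite !inE; apply/andP; split; last by [].
  apply/eqP => /pair_set_inj[[yx _]|[_ zx]]; first by rewrite yx eqxx in xy.
  by rewrite zx eqxx in xz.
have y_notin : all (predC1 y) (z :: rcons s x).
  rewrite /= all_rcons /= xy eq_sym yz /=.
  by apply/allP => t ts; apply: contraNneq ys => <-.
apply/connectP; exists (rcons s x); last by rewrite last_rcons.
elim: (rcons s x) {Us zs ys xs xz yz yzF} z path_s y_notin => //= b q IHq a.
move=> /andP[abF path_q] /and3P[ay by_ q_y]; rewrite IHq //= ?by_ // andbT.
rewrite /edge_rel /= in_setD1; apply/andP; split; last by [].
apply/eqP => /pair_set_inj[[_ E]|[E _]]; first by rewrite E eqxx in by_.
by rewrite E eqxx in ay.
Qed.

Lemma ncomp_connected F : (ncomp F <= 1)%N -> connected_rel (edge_rel F).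
Proof.
move=> le1; apply/forallP => x; apply/forallP => y; apply/component_eqP.
have := le1; rewrite leqNgt => /negP nlt; apply/eqP/negP => /negP xNy.
apply: nlt; apply: leq_trans (_ : #|[set component F x; component F y]| <= _)%N.
  by rewrite cards2 xNy.
by apply/subset_leq_card/subsetP => K; rewrite !inE => /orP[]/eqP ->; apply: imset_f.
Qed.

Lemma connected_ncomp F : connected_rel (edge_rel F) -> (ncomp F <= 1)%N.
Proof.
move=> conn; have [G0|] := posnP #|G|.
  by apply: leq_trans (leq_imset_card _ _) _; rewrite G0.
case/card_gt0P=> x0 _; rewrite -(cards1 (component F x0)).
apply/subset_leq_card/subsetP => K /imsetP[z _ ->]; rewrite inE; apply/eqP/component_eqP.
by have /forallP/(_ z)/forallP/(_ x0) := conn.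
Qed.

End Components.

(** * The tree packing theorem *)

Lemma card_ordered_edges (G : sgraph) (A : {set {set G}}) :
    A \subset edge_set G ->
  #|[set p : G * G | [set p.1; p.2] \in A]| = (2 * #|A|)%N.
Proof.
move=> AE; rewrite -sum1_card.
rewrite (partition_big (fun p : G * G => [set p.1; p.2]) (mem A)) /=; last first.
  by move=> p; rewrite inE.
transitivity (\sum_(e in A) 2)%N; last by rewrite sum_nat_const mulnC.
apply: eq_bigr => e eA; have /edge_setP[x [y [eE exy]]] := subsetP AE _ eA.
have xy : x != y by apply: contraTneq exy => ->; rewrite edge_irr.
rewrite sum1_card (_ : 2 = #|[set (x, y); (y, x)]|)%N; last first.
  by rewrite cards2 xpair_eqE (negbTE xy).
apply: eq_card => -[u v]; rewrite !inE unfold_in /= !xpair_eqE inE /=.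
apply/andP/orP => [[_ /eqP]|].
  by rewrite eE => /pair_set_inj[[-> ->]|[-> ->]]; rewrite !eqxx; [left|right].
by case=> /andP[/eqP -> /eqP ->]; rewrite -?eE ?eA // setUC -eE eA.
Qed.

Section TreePacking.
Variables (G : sgraph) (k : nat).
Local Open Scope nat_scope.
Local Notation family := {ffun 'I_k -> {set {set G}}}.
Implicit Types (F : family) (e f : {set G}).

Definition forest_packing F :=
  [forall i, forest (F i)] &&
  [forall i, forall j, (i != j) ==> [disjoint F i & F j]].
Definition packing_size F := \sum_i #|F i|.
Definition covered F e := [exists i, e \in F i].
Definition replace F i (X : {set {set G}}) : family :=
  [ffun j => if j == i then X else F j].

(** An uncovered edge e enters the i-th forest and an edge f leaves it. Such a
    step keeps the total size, so it stays among the packings of largest size. *)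
Definition exchange : rel family := fun F F' =>
  [exists i, exists e, exists f,
    [&& e \in edge_set G, ~~ covered F e, f \in F i,
        forest (e |: F i :\ f) & F' == replace F i (e |: F i :\ f)]].

Lemma exchangeP F F' :
  reflect (exists i e f, [/\ e \in edge_set G, ~~ covered F e, f \in F i,
             forest (e |: F i :\ f) & F' = replace F i (e |: F i :\ f)])
          (exchange F F').
Proof.
apply: (iffP existsP) => [[i /existsP[e /existsP[f /and5P[? ? ? ? /eqP ->]]]]|].
  by exists i, e, f.
move=> [i [e [f [? ? ? ? ->]]]]; exists i; apply/existsP; exists e.
by apply/existsP; exists f; rewrite eqxx andbT; apply/and4P.
Qed.

Lemma packing_forest F i : forest_packing F -> forest (F i).
Proof. by case/andP=> /forallP. Qed.

Lemma packing_disjoint F i j e : forest_packing F -> e \in F i -> e \in F j -> i = j.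
Proof.
case/andP=> _ /forallP/(_ i)/forallP/(_ j) + ei ej.
by case: eqP => //= _ /pred0P/(_ e); rewrite /= ei ej.
Qed.

Lemma replace_packing F i X : forest_packing F -> forest X ->
    (forall e, e \in X -> e \in F i \/ ~~ covered F e) ->
  forest_packing (replace F i X).
Proof.
move=> Fp Xf XF; apply/andP; split.
  by apply/forallP => j; rewrite ffunE; case: eqP => // _; apply: packing_forest.
have disjX j e : j != i -> e \in X -> e \in F j -> False.
  move=> ji /XF[ei ej|/negP ncov ej]; last by case: ncov; apply/existsP; exists j.
  by case/eqP: ji; apply: packing_disjoint ej ei.
apply/forallP => j; apply/forallP => l; apply/implyP => jl.
rewrite !ffunE disjoint_subset; apply/subsetP => e; rewrite !inE.
have [jE|/eqP ji] := eqP; have [lE|/eqP li] := eqP => e1; apply/negP => e2.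
- by rewrite jE lE eqxx in jl.
- exact: disjX li e1 e2.
- exact: disjX ji e2 e1.
by move/eqP: jl; apply; apply: packing_disjoint e1 e2.
Qed.

Lemma replace_size F i X : packing_size (replace F i X) + #|F i| = packing_size F + #|X|.
Proof.
rewrite /packing_size (bigD1 i) //= [in RHS](bigD1 i) //= ffunE eqxx.
rewrite (eq_bigr (fun j => #|F j|)) => [|j /negbTE ji]; last by rewrite ffunE ji.
by rewrite addnC addnA addnAC.
Qed.

Lemma exchange_packing F F' : exchange F F' -> forest_packing F ->
  forest_packing F' /\ packing_size F' = packing_size F.
Proof.
move=> /exchangeP[i [e [f [eE ncov fF Xf ->]]]] Fp; split.
  apply: replace_packing => // e'; rewrite !inE => /orP[/eqP ->|/andP[]]; by [right|left].
have eF : e \notin F i by apply: contra ncov => eF; apply/existsP; exists i.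
apply/eqP; rewrite -(eqn_add2r #|F i|) replace_size eqn_add2l.
by rewrite cardsU1 !inE (negbTE eF) andbF (cardsD1 f (F i)) fF.
Qed.

(** The two halves of a path that a deleted edge used to join. *)
Lemma linked_del (H : {set {set G}}) u v x y :
    [set u; v] \in H -> linked H x y -> ~~ linked (H :\ [set u; v]) x y ->
  linked (H :\ [set u; v]) x u && linked (H :\ [set u; v]) v y ||
  linked (H :\ [set u; v]) x v && linked (H :\ [set u; v]) u y.
Proof. by move=> uvH; rewrite -{1}(setD1K uvH) => /linked_add/or3P[-> //|->|->]; rewrite ?orbT. Qed.

Variable F0 : family.
Hypothesis F0p : forest_packing F0.
Hypothesis F0max : forall F, forest_packing F -> packing_size F <= packing_size F0.

Definition reachable F := connect exchange F0 F.

(** The edges that some packing reachable from F0 leaves uncovered. The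
    components of this set form the partition with few crossing edges. *)
Definition missed_edges : {set {set G}} :=
  [set e in edge_set G | [exists F, reachable F && ~~ covered F e]].
Local Notation D := missed_edges.

Lemma reachable_packing F : reachable F ->
  forest_packing F /\ packing_size F = packing_size F0.
Proof.
case/connectP=> s + ->; have := F0p.
suff : forall F1, forest_packing F1 -> path exchange F1 s ->
  forest_packing (last F1 s) /\ packing_size (last F1 s) = packing_size F1 by exact.
elim: s => //= F2 s IHs F1 F1p /andP[ex path_s].
by have [F2p <-] := exchange_packing ex F1p; apply: IHs.
Qed.

Lemma missed_edgesP e :
  reflect (e \in edge_set G /\ exists2 F, reachable F & ~~ covered F e) (e \in D).
Proof.
rewrite inE; apply: (iffP andP) => -[eE]; first by case/existsP=> F /andP[]; split=> //; exists F.
by case=> F rF nc; split=> //; apply/existsP; exists F; rewrite rF.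
Qed.

Lemma uncovered_linked F x y i : reachable F -> edge x y ->
  ~~ covered F [set x; y] -> linked (F i) x y.
Proof.
move=> /reachable_packing[Fp Fs] exy ncov; apply/negPn/negP => nxy.
have Xf := forest_add (packing_forest i Fp) exy nxy.
have eF : [set x; y] \notin F i by apply: contra ncov => eF; apply/existsP; exists i.
have := @replace_size F i ([set x; y] |: F i).
have /F0max : forest_packing (replace F i ([set x; y] |: F i)).
  by apply: replace_packing => // e; rewrite !inE => /orP[/eqP ->|]; [right|left].
by rewrite cardsU1 eF -Fs; lia.
Qed.

Lemma exchange_missed F i e f : reachable F -> e \in edge_set G ->
    ~~ covered F e -> f \in F i -> forest (e |: F i :\ f) ->
  reachable (replace F i (e |: F i :\ f)) /\ f \in D.
Proof.
move=> rF eE ncov fF Xf; have [Fp _] := reachable_packing rF.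
have ex : exchange F (replace F i (e |: F i :\ f)) by apply/exchangeP; exists i, e, f.
have rF' : reachable (replace F i (e |: F i :\ f)).
  exact: connect_trans rF (connect1 ex).
split=> //; apply/missed_edgesP; split.
  exact: subsetP (forest_edges (packing_forest i Fp)) _ fF.
exists (replace F i (e |: F i :\ f)) => //; apply/existsP => -[j]; rewrite ffunE.
case: eqP => [_|ji fj]; last by case: ji; apply: packing_disjoint fj fF.
rewrite !inE eqxx orbF => /eqP fe; case/negP: ncov.
by apply/existsP; exists i; rewrite -fe.
Qed.

(** Every edge f of the path of F i that joins the ends of an uncovered edge can
    be exchanged for it, and is then uncovered itself; so the whole path consists
    of missed edges. Formally, the edges that are not missed are removed from the
    forest one by one. *)
Lemma uncovered_linked_missed F x y i : reachable F -> edge x y ->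
  ~~ covered F [set x; y] -> linked (F i :&: D) x y.
Proof.
move=> rF exy ncov; have [Fp _] := reachable_packing rF.
have Ff := packing_forest i Fp.
suff main (A : {set {set G}}) : A \subset F i :\: D -> linked (F i :\: A) x y.
  by have := main _ (subxx _); rewrite setDDr setDv set0U.
have [n] := ubnP #|A|; elim: n A => // n IHn A An AF.
have [->|[f fA]] := set_0Vmem A.
  by rewrite setD0; apply: uncovered_linked.
have := subsetP AF _ fA; rewrite inE => /andP[fD fF].
have fE := subsetP (forest_edges Ff) _ fF; have /edge_setP[u [v [fuv _]]] := fE.
have AE : F i :\: A = (F i :\: (A :\ f)) :\ f.
  apply/setP => g; rewrite !inE; case: (eqVneq g f) => [->|] //=.
  by rewrite fA.
have xyA : linked (F i :\: (A :\ f)) x y.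
  apply: IHn; last by apply: subset_trans AF; apply: subsetDl.
  by move: An; rewrite (cardsD1 f A) fA.
have xyf : linked (F i :\ f) x y.
  apply/negPn/negP => nxy; have Xf : forest ([set x; y] |: F i :\ f).
    by apply: forest_add nxy => //; apply: forestS Ff; apply: subsetDl.
  have xyE : [set x; y] \in edge_set G by rewrite edge_setE.
  by have [_] := exchange_missed rF xyE ncov fF Xf; rewrite (negbTE fD).
rewrite AE; apply/negPn/negP => nxy; subst f.
have uvA : [set u; v] \in F i :\: (A :\ [set u; v]) by rewrite !inE eqxx.
have sub : (F i :\: (A :\ [set u; v])) :\ [set u; v] \subset F i :\ [set u; v].
  by apply/setSD/subsetDl.
have /negP := forest_bridge Ff fF; apply.
case/orP: (linked_del uvA xyA nxy) => /andP[/(linkedS sub) xu /(linkedS sub) vy].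
  rewrite linked_sym in xu; apply: linked_trans xu (linked_trans xyf _).
  by rewrite linked_sym.
rewrite linked_sym; rewrite linked_sym in xu; apply: linked_trans xu (linked_trans xyf _).
by rewrite linked_sym.
Qed.

(** Both the entering edge e and the leaving edge f are missed edges, and f lies
    on the cycle that e closes, so replacing f by e does not change which
    vertices the missed edges of the forest join. This invariance replaces the
    usual choice of a shortest exchange sequence. *)
Lemma exchange_span F F' i a b : reachable F -> exchange F F' ->
  linked (F' i :&: D) a b = linked (F i :&: D) a b.
Proof.
move=> rF /exchangeP[j [e [f [eE ncov fF Xf ->]]]]; rewrite ffunE.
case: eqP => [->|] // {i}; have [Fp _] := reachable_packing rF.
have [_ fD] := exchange_missed rF eE ncov fF Xf.
have eD : e \in D by apply/missed_edgesP; split=> //; exists F.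
have /edge_setP[x [y [exy edge_xy]]] := eE.
have fE := subsetP (forest_edges (packing_forest j Fp)) _ fF.
have /edge_setP[u [v [fuv _]]] := fE; subst e f.
have eF : [set x; y] \notin F j by apply: contra ncov => eF; apply/existsP; exists j.
have xyF := uncovered_linked_missed j rF edge_xy ncov.
have -> : ([set x; y] |: F j :\ [set u; v]) :&: D =
          [set x; y] |: (F j :&: D) :\ [set u; v].
  apply/setP => g; rewrite !in_setI !in_setU1 !in_setD1 in_setI.
  by case: eqP => [->|_] /=; rewrite ?eD // andbA.
have fFD : [set u; v] \in F j :&: D by rewrite inE fF.
have nxy : ~~ linked ((F j :&: D) :\ [set u; v]) x y.
  have := forest_bridge Xf (setU11 _ _); apply: contra; apply: linkedS.
  apply/subsetP => g; rewrite !inE => /and3P[gf gF _].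
  by rewrite gf gF orbT andbT; apply: contraNneq eF => <-.
apply/idP/idP; apply: linked_span => s t.
  rewrite in_setU1 => /orP[/eqP st|]; last first.
    by rewrite in_setD1 => /andP[_]; apply: linked_edge.
  by case: (pair_set_inj st) => -[-> ->] //; rewrite linked_sym.
set X := (X in linked X).
have sub : (F j :&: D) :\ [set u; v] \subset X by apply: subsetUr.
have xyX : linked X x y by apply/linked_edge/setU11.
have uvX : linked X u v.
  case/orP: (linked_del fFD xyF nxy) => /andP[/(linkedS sub) xu /(linkedS sub) vy].
    rewrite linked_sym in xu; apply: linked_trans xu (linked_trans xyX _).
    by rewrite linked_sym.
  rewrite linked_sym; rewrite linked_sym in xu.
  by apply: linked_trans xu (linked_trans xyX _); rewrite linked_sym.
case: (eqVneq [set s; t] [set u; v]) => [/pair_set_inj[[-> ->]|[-> ->]] _ //|st stF].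
  by rewrite linked_sym.
by apply/linked_edge/(subsetP sub); rewrite in_setD1 st.
Qed.

Lemma reachable_span F i a b : reachable F ->
  linked (F i :&: D) a b = linked (F0 i :&: D) a b.
Proof.
case/connectP=> s path_s ->; elim/last_ind: s path_s => //= s F' IHs.
rewrite rcons_path last_rcons => /andP[path_s ex]; rewrite -IHs //.
by apply: exchange_span ex; apply/connectP; exists s.
Qed.

Lemma ncomp_missed i : ncomp (F0 i :&: D) = ncomp D.
Proof.
apply: ncomp_span => a b; apply/idP/idP; first exact/linkedS/subsetIr.
apply: linked_span => u v /missed_edgesP[]; rewrite edge_setE => uv [F rF ncov].
by rewrite -(reachable_span _ _ _ rF); apply: uncovered_linked_missed.
Qed.

(** By [ncomp_missed] each forest has |G| - ncomp D edges inside D, and every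
    edge outside D is covered, so at most the remaining edges of the forests lie
    outside D. *)
Lemma missed_crossing :
  #|edge_set G :\: D| + k * #|G| <= packing_size F0 + k * ncomp D.
Proof.
have cov : edge_set G :\: D \subset \bigcup_i (F0 i :\: D).
  apply/subsetP => e; rewrite inE => /andP[eD eE].
  have /existsP[i ei] : covered F0 e.
    apply: contraNT eD => ncov; apply/missed_edgesP; split=> //.
    by exists F0 => //; apply: connect0.
  by apply/bigcupP; exists i; rewrite // inE eD.
have le_sum : #|edge_set G :\: D| <= \sum_i #|F0 i :\: D|.
  apply: leq_trans (subset_leq_card cov) _.
  elim/big_rec2: _ => [|i m B _ Bm]; first by rewrite cards0.
  by apply: leq_trans (leq_card_setU _ _) _; rewrite leq_add2l.
apply: leq_trans (leq_add le_sum (leqnn _)) _.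
have -> : k * #|G| = \sum_(i < k) #|G| by rewrite sum_nat_const card_ord.
have -> : k * ncomp D = \sum_(i < k) ncomp D by rewrite sum_nat_const card_ord.
rewrite -!big_split /=; apply: leq_sum => i _.
have /(forestS (subsetIl _ D))/andP[_ /eqP <-] := packing_forest i F0p.
by rewrite ncomp_missed addnA -(cardsID D (F0 i)) [X in X + _]addnC.
Qed.
End TreePacking.

Lemma spanning_tree_neq0 (G : sgraph) (F : {set {set G}}) :
  (1 < #|G|)%N -> spanning_tree F -> F != set0.
Proof.
move=> G_gt1 /and3P[_ /connected_ncomp + _]; apply: contraTneq => ->.
by rewrite ncomp0 -ltnNge.
Qed.

Lemma tau_ge (G : sgraph) k (F : {ffun 'I_k -> {set {set G}}}) :
    (1 < #|G|)%N -> (forall i, spanning_tree (F i)) ->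
    (forall i j e, e \in F i -> e \in F j -> i = j) ->
  (k <= tau G)%N.
Proof.
move=> G_gt1 Ft Fd; have Finj : injective F.
  move=> i j Fij; have /set0Pn[e ei] := spanning_tree_neq0 G_gt1 (Ft i).
  by apply: (Fd i j e ei); rewrite -Fij.
have packP : tree_packing [set F i | i : 'I_k].
  apply/andP; split; first by apply/forall_inP => _ /imsetP[i _ ->].
  apply/forall_inP => _ /imsetP[i _ ->]; apply/forall_inP => _ /imsetP[j _ ->].
  apply/implyP => Fij; rewrite disjoint_subset; apply/subsetP => e ei.
  by rewrite !inE; apply: contra Fij => ej; rewrite (Fd _ _ _ ei ej).
apply: leq_trans (leq_bigmax_cond _ packP).
by rewrite card_imset // card_ord.
Qed.

(** If the largest packing by k forests has k (|G| - 1) edges, its members are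
    edge-disjoint spanning trees. Otherwise [missed_crossing] bounds the number
    of edges between the components of D. Crossing edges are counted here as
    ordered pairs, hence twice. *)
Theorem nash_williams_tutte (G : sgraph) k : (1 < #|G|)%N -> (tau G < k)%N ->
  exists D : {set {set G}},
    (#|[set p : G * G | edge p.1 p.2 & ~~ linked D p.1 p.2]| + 2
       <= 2 * k * (ncomp D).-1)%N.
Proof.
move=> G_gt1 tau_lt.
have packing0 : forest_packing [ffun _ : 'I_k => set0 : {set {set G}}].
  apply/andP; split; first by apply/forallP => i; rewrite ffunE forest0.
  by apply/forallP => i; apply/forallP => j; rewrite !ffunE disjoints_subset sub0set implybT.
have [F Fp Fmax] := arg_maxnP (@packing_size G k) packing0.
have crossing := missed_crossing Fp Fmax; set D := missed_edges F in crossing.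
have n_ge1 A : (0 < @ncomp G A)%N.
  by case/card_gt0P: (ltnW G_gt1) => x _; apply/card_gt0P; exists (component A x); apply: imset_f.
(* otherwise all forests are spanning trees *)
have size_lt : (packing_size F < k * (#|G|).-1)%N.
  rewrite ltnNge; apply/negP => size_ge.
  have Fi_le i : (#|F i| <= (#|G|).-1)%N.
    have /andP[_ /eqP <-] := packing_forest i Fp.
    by case: (ncomp (F i)) (n_ge1 (F i)) => // c _; rewrite addnS leq_addr.
  have arith q a m S : (0 < q -> q * m <= a + S -> S <= q.-1 * m -> m <= a)%N.
    by case: q => // q _; rewrite mulSn /=; lia.
  have Fi_eq i : #|F i| = (#|G|).-1.
    apply/eqP; rewrite eqn_leq Fi_le /=; move: size_ge; rewrite /packing_size (bigD1 i) //=.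
    have le_rest : (\sum_(j < k | j != i) #|F j| <= k.-1 * (#|G|).-1)%N.
      apply: (@leq_trans (\sum_(j < k | j != i) (#|G|).-1)%N).
        by apply: leq_sum => j _; apply: Fi_le.
      by rewrite sum_nat_const cardC1 card_ord.
    have : (0 < k)%N by apply: leq_ltn_trans (ltn_ord i).
    move=> k_gt0 le_sum; apply: arith k_gt0 le_sum le_rest.
  suff : (k <= tau G)%N by rewrite leqNgt tau_lt.
  apply: (tau_ge (F := F)) => // [i|i j e]; last exact: packing_disjoint.
  have Ff := packing_forest i Fp; apply/and3P; split.
  - exact: (forest_edges Ff).
  - apply: ncomp_connected; have /andP[_ /eqP] := Ff.
    by rewrite Fi_eq; lia.
  - exact: (forest_acyclic Ff).
exists D; apply: leq_trans (_ : 2 * #|edge_set G :\: D| + 2 <= _)%N.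
  rewrite leq_add2r -card_ordered_edges ?subsetDl //.
  apply/subset_leq_card/subsetP => -[x y]; rewrite in_set /= => /andP[exy nxy].
  rewrite in_set /= in_setD edge_setE exy andbT.
  by apply: contra nxy; apply: linked_edge.
move: crossing size_lt; have := n_ge1 D; move: (ncomp D) => c.
move: (packing_size F) #|_ :\: _| => s m; case: #|G| G_gt1 => // n _.
by case: c => // c _ /=; rewrite !mulnS; nia.
Qed.

(** * Edges that touch a vertex set *)

Section Cuts.
Variable G : sgraph.
Local Open Scope nat_scope.
Implicit Types (U : {set G}) (x y : G).

Definition deg_in U x : nat := \sum_(y in U) edge x y.

(** Twice the number of edges with an end in U, see [touch_edges]. *)
Definition touch U : nat := \sum_(x in U) (deg_in U x + 2 * deg_in (~: U) x).

Lemma deg_in_card U x : deg_in U x = #|[set y in U | edge x y]|.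
Proof.
rewrite /deg_in -sum1_card [RHS]big_mkcond [LHS]big_mkcond /=.
by apply: eq_bigr => y _; rewrite inE; case: (y \in U); case: edge.
Qed.

Lemma degree_split U x : degree x = deg_in U x + deg_in (~: U) x.
Proof.
rewrite !deg_in_card /degree -(cardsID U); congr (_ + _); apply: eq_card => y;
by rewrite !inE andbC.
Qed.

Lemma deg_in_le U x : deg_in U x <= #|U|.
Proof. by rewrite deg_in_card; apply/subset_leq_card/subsetP => y; rewrite inE => /andP[]. Qed.

Lemma deg_in_lt U x : x \in U -> deg_in U x < #|U|.
Proof.
move=> xU; rewrite deg_in_card; apply/proper_card/properP; split.
  by apply/subsetP => y; rewrite inE => /andP[].
by exists x; rewrite // inE edge_irr andbF.
Qed.

Lemma deg_in_exchange U V : \sum_(x in U) deg_in V x = \sum_(x in V) deg_in U x.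
Proof.
rewrite /deg_in exchange_big; apply: eq_bigr => y _.
by apply: eq_bigr => x _; rewrite edge_sym.
Qed.

Lemma touchE U :
  touch U = #|[set p : G * G | edge p.1 p.2 & (p.1 \in U) || (p.2 \in U)]|.
Proof.
rewrite -sum1dep_card big_mkcond -(pair_big xpredT xpredT
  (fun x y => if edge x y && ((x \in U) || (y \in U)) then 1 else 0)) /=.
rewrite (bigID (mem U)) /= /touch big_split /= -[X in _ + X]big_distrr /=.
rewrite mul2n -addnn addnA -big_split /=; congr (_ + _).
  apply: eq_bigr => x xU; rewrite -degree_split /degree -sum1_card big_mkcond /=.
  by apply: eq_bigr => y _; rewrite inE xU /= andbT.
rewrite deg_in_exchange big_mkcond [RHS]big_mkcond; apply: eq_bigr => x _.
rewrite inE; case: (boolP (x \in U)) => //= xU; rewrite /deg_in big_mkcond.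
by apply: eq_bigr => y _; case: (y \in U); case: edge.
Qed.

Definition touching_edges U : {set {set G}} :=
  [set e in edge_set G | ~~ [disjoint e & U]].

Lemma touching_pair U x y : edge x y ->
  ([set x; y] \in touching_edges U) = (x \in U) || (y \in U).
Proof.
move=> exy; rewrite inE edge_setE exy /= disjoints_subset subUset !sub1set !inE.
by rewrite negb_and !negbK.
Qed.

Lemma touch_edges U : touch U = 2 * #|touching_edges U|.
Proof.
rewrite touchE -card_ordered_edges; last by apply/subsetP => e; rewrite inE => /andP[].
apply: eq_card => -[x y]; rewrite [LHS]in_set [RHS]in_set /=.
have [exy|nxy] := boolP (edge x y); first by rewrite touching_pair.
by rewrite inE edge_setE (negbTE nxy).
Qed.

(** Without the edges that touch U, each vertex of U is a component of its own
    and there is at least one more component; each edge put back merges at most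
    two of them. *)
Lemma spanning_tree_touching U x0 (F : {set {set G}}) : x0 \notin U ->
  spanning_tree F -> #|U| <= #|F :&: touching_edges U|.
Proof.
move=> x0U /and3P[FE /connected_ncomp F1 _].
have := @ncomp_unionU _ (F :&: touching_edges U) (F :\: touching_edges U).
rewrite setID => /(_ (subset_trans (subsetIl _ _) FE)).
suff : #|U| + 1 <= ncomp (F :\: touching_edges U) by lia.
set A := F :\: _.
have iso x y : x \in U -> linked A x y -> x = y.
  move=> xU xy; apply: (linked_ind (S := fun z => x = z) _ xy erefl) => u v + xu.
  rewrite -xu => {xu} uvA.
  move: uvA; rewrite inE => /andP[+ xvF]; have := subsetP FE _ xvF.
  by rewrite edge_setE => xv; rewrite touching_pair // xU.
have injU : {in U &, injective (component A)}.
  by move=> x y xU yU /component_eqP; apply: iso.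
rewrite -(card_in_imset injU) addn1 -[_.+1]add1n.
have <- : (component A x0 \notin component A @: U) = 1 :> nat.
  case: imsetP => // -[x xU /esym/component_eqP/(iso _ _ xU) xx0].
  by rewrite -xx0 xU in x0U.
rewrite -cardsU1; apply/subset_leq_card/subsetP => K; rewrite in_setU1.
by case/orP=> [/eqP ->|/imsetP[x _ ->]]; apply: imset_f.
Qed.

Lemma tau_lt_touch U x0 k : x0 \notin U -> touch U < 2 * k * #|U| -> tau G < k.
Proof.
move=> x0U lt; have k_gt0 : 0 < k by case: k lt => //; rewrite muln0.
rewrite -(prednK k_gt0) ltnS; apply/bigmax_leqP => P /andP[/forall_inP Ptree].
move=> /forall_inP Pdis; rewrite -ltnS (prednK k_gt0).
(* the trees of P use disjoint sets of edges that touch U *)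
suff le : #|P| * #|U| <= #|touching_edges U|.
  move: lt; rewrite touch_edges -mulnA ltn_pmul2l // => lt.
  by have := leq_ltn_trans le lt; rewrite ltn_mul2r => /andP[].
rewrite -sum_nat_const.
apply: (@leq_trans (\sum_(F in P) #|F :&: touching_edges U|)).
  by apply: leq_sum => F /Ptree; apply: spanning_tree_touching x0U.
rewrite -sum1_card; under eq_bigr do rewrite -sum1_card big_mkcond.
rewrite exchange_big [X in _ <= X]big_mkcond /=; apply: leq_sum => e _.
under eq_bigr do rewrite inE andbC; case: ifP => [eU|_]; last by rewrite big1.
have [[F FP eF]|none] := altP (@exists_inP _ (mem P) (fun F : {set {set G}} => e \in F)).
  rewrite (bigD1 F FP) /= eF big1 // => F' /andP[F'P F'F].
  have /forall_inP/(_ F' F'P)/implyP := Pdis F FP.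
  by rewrite eq_sym F'F => /(_ isT)/pred0P/(_ e)/=; rewrite eF /= => ->.
rewrite big1 // => F FP; case: ifP => // eF.
by case/exists_inP: none; exists F.
Qed.

End Cuts.

(** * A sparse cut around 2h + 2 vertices *)

Section SmallCut.
Variables (C : numClosedFieldType) (G : sgraph).
Local Notation R := (real_of C).
Implicit Types (U : {set G}) (x y : G).

(** Test with the vector that is 1 outside U and 1/(2|U| + 2) on U. The small
    value keeps the contribution of U to a vertex outside below 1/2, while
    |~: U| is large enough to absorb the K outer neighbours of a vertex of U. *)
Lemma perron_cut_le (r : R) p U K : @perron_pair C G r p ->
    (forall x, x \in U -> (deg_in (~: U) x <= K)%N) ->
    ((K + 1) * (2 * #|U| + 2) < #|~: U|)%N ->
  r <= #|~: U|%:R - 2^-1.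
Proof.
move=> pp dK N_big; set s := #|U| in N_big; set N := #|~: U| in N_big *.
pose eps : R := (2 * s%:R + 2)^-1.
have s_ge0 : 0 <= s%:R :> R by [].
have eps_gt0 : 0 < eps by rewrite invr_gt0; lra.
have eps_s : s%:R * eps <= 2^-1.
  by rewrite ler_pdivrMr; lra.
pose z x : R := if x \in U then eps else 1.
have zA x : \sum_y (edge x y)%:R * z y
          = (deg_in (~: U) x)%:R + (deg_in U x)%:R * eps.
  rewrite (bigID (mem U)) /= addrC /deg_in !natr_sum mulr_suml; congr (_ + _).
    rewrite [RHS](eq_bigl (fun y => y \notin U)) => [|y]; last by rewrite inE.
    by apply: eq_bigr => y yU; rewrite /z (negbTE yU) mulr1.
  by apply: eq_bigr => y yU; rewrite /z yU.
have N_gt : (K%:R + 1) * (2 * s%:R + 2) < N%:R :> R.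
  have : ((K + 1) * (2 * s + 2))%N%:R < N%:R :> R by rewrite ltr_nat.
  by rewrite natrM !natrD; lra.
have K_lt : K%:R + 1 < N%:R * eps by rewrite ltr_pdivlMr //; lra.
have eps_le : eps <= 1 by rewrite invf_le1; lra.
have N_gt0 : (0 < N)%N by apply: leq_ltn_trans N_big.
apply: (perron_test_le pp (z := z)) => [x||x].
- by rewrite /z; case: ifP => // _; apply: ltW.
- have /card_gt0P[x] := N_gt0; rewrite inE => xU.
  by exists x; rewrite /z (negbTE xU).
rewrite zA /z; case: ifP => xU.
  have d_le : (deg_in (~: U) x)%:R <= K%:R :> R by rewrite ler_nat dK.
  have g_le : (deg_in U x)%:R * eps <= s%:R * eps.
    by rewrite ler_pM2r // ler_nat deg_in_le.
  by lra.
have d_le : (deg_in (~: U) x)%:R + 1 <= N%:R :> R.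
  by rewrite natr1 ler_nat deg_in_lt // inE xU.
have g_le : (deg_in U x)%:R * eps <= s%:R * eps.
  by rewrite ler_pM2r // ler_nat deg_in_le.
by lra.
Qed.

Section Classes.
Variable D : {set {set G}}.
Local Open Scope nat_scope.
Local Notation cls := (component D).

Lemma mem_cls x y : (y \in cls x) = (cls x == cls y).
Proof. by rewrite inE; apply/idP/eqP => /component_eqP. Qed.

Lemma ncomp_le_compl x0 : (ncomp D).-1 <= #|~: cls x0|.
Proof.
have sub : components D \subset cls x0 |: [set cls x | x in ~: cls x0].
  apply/subsetP => K /imsetP[x _ ->]; rewrite !inE.
  case: (boolP (linked D x0 x)) => [/component_eqP ->|nx]; first by rewrite eqxx.
  by rewrite imset_f ?orbT // !inE.
rewrite -subn1 leq_subLR; apply: leq_trans (subset_leq_card sub) _.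
rewrite cardsU1; apply: leq_add (leq_imset_card _ _).
by case: (_ \notin _).
Qed.

Definition cross : nat := #|[set p : G * G | edge p.1 p.2 & ~~ linked D p.1 p.2]|.

Lemma degree_sum_le : \sum_(x : G) degree x <= cross + \sum_x #|cls x|.
Proof.
have -> : \sum_(x : G) degree x = #|[set p : G * G | edge p.1 p.2]|.
  rewrite -sum1dep_card [in RHS]big_mkcond /= -(pair_big xpredT xpredT
    (fun x y : G => if edge x y then 1 else 0)) /=.
  apply: eq_bigr => x _; rewrite /degree -sum1_card big_mkcond /=.
  by apply: eq_bigr => y _; rewrite inE.
rewrite /cross -(cardsID [set p : G * G | ~~ linked D p.1 p.2]).
apply: leq_add; first by apply/subset_leq_card/subsetP => p; rewrite !inE.
have -> : \sum_x #|cls x| = #|[set p : G * G | linked D p.1 p.2]|.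
  rewrite -sum1dep_card [in RHS]big_mkcond /= -(pair_big xpredT xpredT
    (fun x y : G => if linked D x y then 1 else 0)) /=.
  apply: eq_bigr => x _; rewrite -sum1_card big_mkcond /=.
  by apply: eq_bigr => y _; rewrite inE.
by apply/subset_leq_card/subsetP => p; rewrite !inE negbK => /andP[].
Qed.

Lemma touch_le x0 :
  touch (~: cls x0) <= cross + \sum_(x in ~: cls x0) #|cls x|.-1.
Proof.
set U := ~: _; rewrite touchE /cross.
rewrite -(cardsID [set p : G * G | ~~ linked D p.1 p.2]); apply: leq_add.
  by apply/subset_leq_card/subsetP => p; rewrite !inE => /andP[/andP[-> _] ->].
have -> : \sum_(x in U) #|cls x|.-1 =
    #|[set p : G * G | [&& p.1 \in U, linked D p.1 p.2 & p.1 != p.2]]|.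
  rewrite -sum1dep_card [RHS]big_mkcond -(pair_big xpredT xpredT
    (fun x y : G => if [&& x \in U, linked D x y & x != y] then 1 else 0)) /=.
  rewrite big_mkcond; apply: eq_bigr => x _; case: (x \in U) => /=; last first.
    by rewrite big1.
  rewrite (cardsD1 x) inE linked_refl /= -sum1_card big_mkcond /=.
  by apply: eq_bigr => y _; rewrite !inE eq_sym andbC.
apply/subset_leq_card/subsetP => -[x y]; rewrite !inE negbK /=.
move=> /and3P[xy exy]; rewrite xy andTb => /orP xyU.
have -> : x != y by apply: contraTneq exy => ->; rewrite edge_irr.
rewrite andbT; case: xyU => // ny; apply: contra ny => nx.
exact: linked_trans nx xy.
Qed.

(** A class with t <= 2k vertices has t (t - 1) <= 2k (t - 1), so splitting it
    into singletons creates no more crossing edges than the count allows. *)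
Lemma class_sum x0 k : #|~: cls x0| <= 2 * k ->
  \sum_(x in ~: cls x0) #|cls x|.-1 + 2 * k * (ncomp D).-1 <= 2 * k * #|~: cls x0|.
Proof.
set U := ~: _ => U_le; pose cl := components D :\ cls x0.
have card_cl : (ncomp D).-1 = #|cl|.
  by rewrite /ncomp (cardsD1 (cls x0)) imset_f.
have mem_cl x : x \in U -> cls x \in cl.
  rewrite !inE => nx; rewrite imset_f // andbT.
  by apply: contra nx => /eqP/esym/component_eqP.
have fiber K x : K \in cl -> (x \in U) && (cls x == K) = (x \in K).
  rewrite in_setD1 => /andP[KN /imsetP[y _ KE]]; subst K.
  rewrite mem_cls (eq_sym (cls y)); case: eqP => [xy|_]; last by rewrite andbF.
  by rewrite andbT /U in_setC mem_cls xy eq_sym.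
rewrite (partition_big cls (mem cl)) //= card_cl.
have -> : #|U| = \sum_(K in cl) #|K|.
  rewrite -sum1_card (partition_big cls (mem cl)) //=.
  by apply: eq_bigr => K Kcl; rewrite -sum1_card; apply: eq_bigl => x; rewrite fiber.
rewrite -sum1_card !big_distrr -big_split /=; apply: leq_sum => K Kcl.
have -> : \sum_(x in U | cls x == K) #|cls x|.-1 = #|K| * #|K|.-1.
  rewrite (eq_bigr (fun _ => #|K|.-1)) => [|x /andP[_ /eqP ->]] //.
  rewrite -sum_nat_const; apply: eq_bigl => x; exact: fiber.
have K_le : #|K| <= #|U|.
  by apply/subset_leq_card/subsetP => x; rewrite -(fiber _ _ Kcl) => /andP[].
have K_gt0 : 0 < #|K|.
  move: Kcl; rewrite inE => /andP[_ /imsetP[y _ ->]].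
  by apply/card_gt0P; exists y; rewrite inE linked_refl.
have := leq_trans K_le U_le; case: #|K| K_gt0 => // m _ /=; nia.
Qed.
End Classes.

(** N is the size of the largest class, s the number of other vertices and m twice
    the number of edges. If s <= N, then 2 N s = n^2 - N^2 - s^2 is at most
    2 c0 n + 2 k s, and n <= 2 N bounds s. If N < s, then the edges inside
    classes number at most n^2 / 4, which is too few. *)
Lemma small_part_arith n N s k c0 m :
    (4 * c0 + 4 * k < n)%N -> (N + s = n)%N ->
    ((n - c0) ^ 2 <= m)%N -> (m <= 2 * k * s + N ^ 2 + s * minn N s)%N ->
  (s <= 4 * c0)%N.
Proof.
move=> n_big Nsn lo up; have := leq_trans lo up; rewrite -!mulnn.
set t := (n - c0)%N; have tE : (n = t + c0)%N by rewrite subnK //; lia.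
have t_sqr : (n * n <= t * t + 2 * (c0 * n))%N.
  by rewrite tE mulnDl !mulnDr; lia.
have [Ns|sN] := leqP N s => le; last first.
  have n_sqr : (n * n = N * N + 2 * (N * s) + s * s)%N.
    by rewrite -Nsn mulnDl !mulnDr [(s * N)%N]mulnC; lia.
  have c0n : (c0 * n <= 2 * (c0 * N))%N by rewrite mulnCA leq_mul2l; lia.
  have ks : (2 * (k * s) <= N * s)%N by rewrite mulnA leq_mul2r; lia.
  have : (s * N <= 4 * c0 * N)%N by rewrite [(s * N)%N]mulnC -mulnA; lia.
  by rewrite leq_pmul2r //; lia.
have Nn : (N * N + s * N = N * n)%N by rewrite -Nsn mulnDr [(s * N)%N]mulnC.
have Nn2 : (2 * (N * n) <= n * n)%N by rewrite mulnA leq_mul2r; lia.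
have ks : (k * s <= k * n)%N by rewrite leq_mul2l; lia.
have : (n * n <= (4 * c0 + 4 * k) * n)%N by rewrite mulnDl -!mulnA; lia.
by rewrite leq_pmul2r; lia.
Qed.

End SmallCut.

Section SparseCut.
Variables (C : numClosedFieldType) (G : sgraph) (k h : nat).
Local Open Scope nat_scope.

Lemma deg_in_cross (D : {set {set G}}) x0 x : x \notin component D x0 ->
  deg_in (component D x0) x <= cross D.
Proof.
move=> nx; rewrite deg_in_card /cross.
have inj : injective (fun y : G => (x, y)) by move=> y z [].
rewrite -(card_imset _ inj); apply/subset_leq_card/subsetP => p /imsetP[y + ->].
rewrite !inE /= => /andP[x0y ->]; apply: contra nx => xy; rewrite inE.
by apply: linked_trans x0y _; rewrite linked_sym.
Qed.

(** Each vertex of U has at most |U| - 1 neighbours in U, so the edges that touch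
    U number at least the sum of 2 (k + h) - (|U| - 1) over U, divided by 2. *)
Lemma touch_size_lower (U : {set G}) :
    (forall x : G, k + h <= degree x) -> touch U + 2 <= 2 * k * #|U| ->
  2 * h + 2 <= #|U|.
Proof.
move=> deg_ge tU.
have lower : \sum_(x in U) 2 * (k + h) <= touch U + \sum_(x in U) #|U|.-1.
  rewrite /touch -big_split /=; apply: leq_sum => x xU.
  have := deg_ge x; have := deg_in_lt xU; rewrite (degree_split U).
  by move: (deg_in U x) (deg_in _ x) #|U| => a b [|c]; lia.
move: lower tU; rewrite !sum_nat_const; case: #|U| => [|s] /=; first by rewrite muln0; lia.
by move: (touch U) => t ? ?; nia.
Qed.

(** With s the a priori bound on the number of vertices outside the largest
    class, such a vertex has at most 2ks neighbours in that class; the first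
    summand is then the size that [perron_cut_le] asks for. *)
Definition sparse_cut_bound : nat :=
  let s := 4 * (2 * h + 3) in
  (2 * k * s + 1) * (2 * s + 2) + s + 4 * k + 4 * (2 * h + 3) + 2.

(** The partition of [nash_williams_tutte] has a class that leaves out at most
    4 (2h + 3) vertices, since r^2 <= 2 |E|; these are at most 2h + 2, since
    otherwise [perron_cut_le] contradicts r >= n - 2h - 3. Refining to
    singletons and counting degrees gives equality. *)
Lemma sparse_cut r p :
    h < k -> sparse_cut_bound <= #|G| ->
    (forall x : G, k + h <= degree x) -> tau G < k ->
    @perron_pair C G r p -> (#|G|%:R - (2 * h + 3)%:R <= r)%R ->
  exists U : {set G}, #|U| = 2 * h + 2 /\ touch U + 2 <= 2 * k * (2 * h + 2).
Proof.
move=> hk n_big deg_ge tau_lt pp r_ge; set n := #|G| in n_big r_ge.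
pose s0 := 4 * (2 * h + 3).
have {}n_big : (2 * k * s0 + 1) * (2 * s0 + 2) + s0 + 4 * k + 4 * (2 * h + 3) + 2 <= n by [].
have n_gt1 : 1 < n by lia.
have [D cross_le] := nash_williams_tutte n_gt1 tau_lt.
have /card_gt0P[a _] : 0 < n by lia.
have [x0 _ x0_max] := @arg_maxnP _ a xpredT (fun x => #|component D x|) isT.
set B := component D x0; set U := ~: B; pose N := #|B|; pose s := #|U|.
have {}x0_max x : #|component D x| <= N by apply: x0_max.
have Nsn : N + s = n by apply: cardsC.
have q_le : (ncomp D).-1 <= s by apply: ncomp_le_compl.
have cross_s : cross D + 2 <= 2 * k * s.
  by apply: leq_trans cross_le _; rewrite leq_mul2l q_le orbT.
have sum_cls : \sum_x #|component D x| <= N ^ 2 + s * minn N s.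
  rewrite (bigID (mem B)) /=; apply: leq_add.
    rewrite -mulnn -sum_nat_const; by apply: leq_sum => x _; apply: x0_max.
  rewrite -sum_nat_const [X in _ <= X](eq_bigl (fun x => x \notin B)) => [|x].
    apply: leq_sum => x xB; rewrite leq_min x0_max //=.
    apply/subset_leq_card/subsetP => y; rewrite mem_cls => /eqP xy.
    by move: xB; rewrite /U in_setC /B !mem_cls xy.
  by rewrite /U in_setC.
(* r^2 <= 2 |E|, with adjacent pairs split into crossing pairs and others *)
have sqr_le : (n - (2 * h + 3)) ^ 2 <= 2 * k * s + N ^ 2 + s * minn N s.
  have : (n - (2 * h + 3)) ^ 2 <= \sum_(x : G) degree x.
    rewrite -(ler_nat (real_of C)); apply: le_trans (perron_sqr_le x0 pp).
    rewrite natrX; apply: lerXn2r; rewrite ?nnegrE ?ler0n //.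
      by apply: le_trans r_ge; rewrite subr_ge0 ler_nat; lia.
    by rewrite natrB //; lia.
  move=> /leq_trans; apply; apply: leq_trans (degree_sum_le D) _.
  by rewrite -addnA; apply: leq_add sum_cls; lia.
have s_le : s <= s0.
  by apply: (@small_part_arith n N s k (2 * h + 3) _ _ Nsn (leqnn _) sqr_le); lia.
have CU : ~: U = B by rewrite /U setCK.
have r_le : (r <= N%:R - 2^-1)%R.
  have := @perron_cut_le C G r p U (2 * k * s0) pp; rewrite CU; apply.
    move=> x; rewrite in_setC => /deg_in_cross/leq_trans; apply.
    apply: leq_trans (leq_addr 2 _) (leq_trans cross_s _).
    by rewrite leq_mul2l s_le orbT.
  apply: (@leq_ltn_trans ((2 * k * s0 + 1) * (2 * s0 + 2))); last by rewrite -/N; lia.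
  by rewrite leq_mul2l; apply/orP; right; rewrite -/s; lia.
(* the radius is within 1/2 of |B|, so |B| >= n - 2h - 2 *)
have {}s_le : s <= 2 * h + 2.
  rewrite leqNgt; apply/negP => s_gt.
  have : (n%:R = N%:R + s%:R :> real_of C)%R by rewrite -natrD Nsn.
  have : ((2 * h + 3)%:R <= s%:R :> real_of C)%R by rewrite ler_nat; lia.
  by move: r_ge r_le => /=; lra.
(* refining the partition to singletons on U *)
have tU : touch U + 2 <= 2 * k * s.
  have := @touch_le G D x0; have := @class_sum G D x0 k; rewrite -/B -/U -/s => cs tl.
  have {}cs := cs (leq_trans s_le (_ : 2 * h + 2 <= 2 * k)).
  have {}cs : \sum_(x in U) #|component D x|.-1 + 2 * k * (ncomp D).-1 <= 2 * k * s.
    by apply: cs; lia.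
  move: cross_le tl cs; rewrite -/(cross D).
  by move: (\sum_(x in U) _) (touch U) (cross D) => S t c; lia.
have s_ge := touch_size_lower deg_ge tU.
have sE : s = 2 * h + 2 by apply/eqP; rewrite eqn_leq s_le.
by exists U; rewrite -sE.
Qed.
End SparseCut.

(** * Expansion of the Perron root *)

Section Expansion.
Variables (R : realFieldType).

Definition expansion (r : R) (I1 I2 I3 I4 : nat) : R :=
  r ^+ 2 * I1%:R + r * I2%:R + I3%:R + r / (r + 1) * I4%:R.

(** Divided by r^3, each term of the expansion decreases in r; this carries a
    lower bound at r' over to a larger r. *)
Lemma expansion_mono (r r' : R) I1 I2 I3 I4 : 0 < r' -> r' <= r ->
  r' ^+ 3 * expansion r I1 I2 I3 I4 <= r ^+ 3 * expansion r' I1 I2 I3 I4.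
Proof.
move=> r'_gt0 r'r; have r_gt0 : 0 < r by apply: lt_le_trans r'r.
have r'_ge0 := ltW r'_gt0; have r_ge0 := ltW r_gt0.
have c1 : r' ^+ 3 * r ^+ 2 <= r ^+ 3 * r' ^+ 2.
  have -> : r' ^+ 3 * r ^+ 2 = r' * (r ^+ 2 * r' ^+ 2) by ring.
  have -> : r ^+ 3 * r' ^+ 2 = r * (r ^+ 2 * r' ^+ 2) by ring.
  by rewrite ler_wpM2r // mulr_ge0 // exprn_ge0.
have c2 : r' ^+ 3 * r <= r ^+ 3 * r'.
  have -> : r' ^+ 3 * r = r' ^+ 2 * (r * r') by ring.
  have -> : r ^+ 3 * r' = r ^+ 2 * (r * r') by ring.
  by rewrite ler_wpM2r ?mulr_ge0 // lerXn2r ?nnegrE.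
have c3 : r' ^+ 3 <= r ^+ 3 by rewrite lerXn2r ?nnegrE.
have c4 : r' ^+ 3 * (r / (r + 1)) <= r ^+ 3 * (r' / (r' + 1)).
  rewrite !mulrA; apply: ler_pM => //; first by rewrite mulr_ge0 // exprn_ge0.
    by rewrite invr_ge0; lra.
  by rewrite lef_pV2 ?posrE; lra.
rewrite !mulrA in c4; rewrite /expansion !mulrDr !mulrA.
apply: lerD; [apply: lerD; [apply: lerD|]|]; apply: ler_wpM2r => //.
by move: c1; rewrite !expr2 !mulrA.
Qed.

(** The terms have orders r^2, r, 1 and 1, so a unit in the first or second
    coefficient outweighs all later ones. The last two terms have the same order,
    which is why the third coefficients are equal in the last clause. *)
Lemma expansion_lex (r B : R) I1 I2 I3 I4 J1 J2 J3 J4 :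
    1 <= r -> 4 * B < r ->
    I2%:R <= B -> I3%:R <= B -> I4%:R <= B ->
    expansion r J1 J2 J3 J4 <= expansion r I1 I2 I3 I4 + B / r ->
  [/\ (I1 <= J1)%N -> I1 = J1,
      I1 = J1 -> (I2 <= J2)%N -> I2 = J2
    & I1 = J1 -> I2 = J2 -> I3 = J3 -> (J4 <= I4)%N].
Proof.
move=> r_ge1 B_lt I2B I3B I4B; rewrite /expansion.
have r_gt0 : 0 < r by lra.
have B_ge0 : 0 <= B by apply: le_trans I2B.
set q := r / (r + 1); have q_gt0 : 0 < q by rewrite divr_gt0 //; lra.
have q_le1 : q <= 1 by rewrite ler_pdivrMr; lra.
have q_ge : 2^-1 <= q by rewrite ler_pdivlMr; lra.
set b := B / r; have b_le : b <= B by rewrite ler_pdivrMr // ler_peMr.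
have b_lt : b < 4^-1 by rewrite ltr_pdivrMr; lra.
have qI4 : q * I4%:R <= B.
  by apply: le_trans I4B; rewrite ler_piMl.
have qJ4 : 0 <= q * J4%:R by rewrite mulr_ge0 // ltW.
have J2_ge0 : 0 <= r * J2%:R by rewrite mulr_ge0 // ltW.
have rI2 : r * I2%:R <= r * B by rewrite ler_pM2l.
have rB : B <= r * B by rewrite ler_peMl.
have r_sqr : r ^+ 2 > 4 * (r * B) by rewrite expr2 mulrCA ltr_pM2l.
move=> le; split.
- move=> I1J1; apply/eqP; rewrite eqn_leq I1J1 /= leqNgt; apply/negP => lt.
  have : r ^+ 2 * (I1%:R + 1) <= r ^+ 2 * J1%:R.
    by rewrite ler_pM2l ?exprn_gt0 // natr1 ler_nat.
  have : 0 <= J3%:R :> R by [].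
  by lra.
- move=> E1; move: le; rewrite E1 => le.
  move=> I2J2; apply/eqP; rewrite eqn_leq I2J2 /= leqNgt; apply/negP => lt.
  have : r * (I2%:R + 1) <= r * J2%:R by rewrite ler_pM2l // natr1 ler_nat.
  have : 0 <= J3%:R :> R by [].
  by lra.
move=> E1 E2 E3; move: le; rewrite E1 E2 E3 => le.
rewrite leqNgt; apply/negP => lt.
have : q * (I4%:R + 1) <= q * J4%:R by rewrite ler_pM2l // natr1 ler_nat.
by lra.
Qed.

Section Bounds.
Variables (V : finType) (U : {set V}) (M : nat).
Variables (d : V -> nat) (E l : V -> V -> nat) (x : V -> R) (r : R).
Hypotheses (M_ge1 : (0 < M)%N) (U_le : (#|U| <= M)%N) (d_le : forall i, i \in U -> (d i <= M)%N).
Hypotheses (E_le : forall i j, (E i j <= M)%N)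
  (l_le : forall i j, i \in U -> j \in U -> (l i j <= M)%N).
Hypotheses (E_sym : forall i j, E i j = E j i) (l_sym : forall i j, l i j = l j i).
Hypotheses (x_ge0 : forall i, 0 <= x i) (r_ge : 4 * M%:R ^+ 2 <= r).
Hypothesis x_eq : forall i, i \in U ->
  r * x i = (d i)%:R + \sum_(j in U) ((E i j)%:R + (l i j)%:R / (r + 1)) * x j.

Let m : R := M%:R.

(** The equation for x reads r x = d + T x, with T symmetric and nonnegative.
    Hence r^3 d.x = r^2 d.d + r d.Td + Td.Td + T(Td).T x, and the last term is
    O(1/r) because r >= 4 M^2 keeps the sum of x below 2 M^2 / r. *)
Let T i j : R := (E i j)%:R + (l i j)%:R / (r + 1).
Let app (v : V -> R) i := \sum_(j in U) T i j * v j.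
Let dR i : R := (d i)%:R.
Let u := app x.

Let m_ge1 : 1 <= m. Proof. by rewrite ler1n. Qed.
Let r_ge1 : 1 <= r.
Proof. by apply: le_trans r_ge; have := @exprn_ege1 R 2 m m_ge1; rewrite -/m; lra. Qed.
Let r_gt0 : 0 < r. Proof. by have := r_ge1; lra. Qed.

Let T_ge0 i j : 0 <= T i j.
Proof. by rewrite addr_ge0 // divr_ge0 //; have := r_ge1; lra. Qed.

Let lr_le i j : i \in U -> j \in U -> (l i j)%:R / (r + 1) <= m.
Proof.
move=> iU jU; have : (l i j)%:R <= m by rewrite ler_nat l_le.
rewrite ler_pdivrMr; last by have := r_ge1; lra.
by move=> /le_trans; apply; rewrite ler_peMr //; have := r_ge1; have := m_ge1; lra.
Qed.

Let T_le i j : i \in U -> j \in U -> T i j <= 2 * m.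
Proof.
move=> iU jU; have := lr_le iU jU; have : (E i j)%:R <= m by rewrite ler_nat E_le.
by rewrite /T; lra.
Qed.

Let T_sym i j : T i j = T j i. Proof. by rewrite /T E_sym l_sym. Qed.

Let sumU_le (F : V -> R) c : 0 <= c -> (forall i, i \in U -> F i <= c) ->
  \sum_(i in U) F i <= m * c.
Proof.
move=> c_ge0 Fc; apply: (@le_trans _ _ (\sum_(i in U) c)); first exact: ler_sum.
by rewrite sumr_const -mulr_natl ler_wpM2r // ler_nat.
Qed.

Let app_sym v w : \sum_(i in U) v i * app w i = \sum_(i in U) app v i * w i.
Proof.
rewrite /app; under eq_bigr do rewrite mulr_sumr.
rewrite exchange_big; apply: eq_bigr => j _ /=; rewrite mulr_suml.
by apply: eq_bigr => i _; rewrite T_sym; ring.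
Qed.

Let app_le v i : i \in U -> (forall j, 0 <= v j) ->
  app v i <= 2 * m * \sum_(j in U) v j.
Proof.
move=> iU v_ge0; rewrite mulr_sumr; apply: ler_sum => j jU.
by rewrite ler_wpM2r // T_le.
Qed.

Let app_ge0 v i : (forall j, 0 <= v j) -> 0 <= app v i.
Proof. by move=> v_ge0; rewrite sumr_ge0 // => j _; rewrite mulr_ge0. Qed.

Let x_step v : r * \sum_(i in U) v i * x i = \sum_(i in U) v i * dR i + \sum_(i in U) app v i * x i.
Proof.
rewrite -app_sym -big_split mulr_sumr; apply: eq_bigr => i iU.
by rewrite /= mulrCA x_eq // mulrDr.
Qed.

Let sum_d_le : \sum_(i in U) dR i <= m ^+ 2.
Proof. by rewrite expr2; apply: sumU_le => [|i iU]; rewrite ?ler_nat ?d_le. Qed.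

Let sum_x_le : \sum_(i in U) x i <= 2 * m ^+ 2 / r.
Proof.
set S := \sum_(i in U) x i; have S_ge0 : 0 <= S by rewrite sumr_ge0.
have u_le : \sum_(i in U) u i <= 2 * m ^+ 2 * S.
  have -> : 2 * m ^+ 2 * S = m * (2 * m * S) by ring.
  by apply: sumU_le => [|i iU]; [rewrite !mulr_ge0 //; have := m_ge1; lra | apply: app_le].
have : r * S = \sum_(i in U) dR i + \sum_(i in U) u i.
  by rewrite -big_split mulr_sumr; apply: eq_bigr => i iU; rewrite /= x_eq.
have : 4 * m ^+ 2 * S <= r * S by rewrite ler_wpM2r.
by rewrite ler_pdivlMr // [S * r]mulrC; have := sum_d_le; lra.
Qed.

Definition sq_deg := (\sum_(i in U) d i ^ 2)%N.
Definition form_adj := (\sum_(i in U) d i * \sum_(j in U) E i j * d j)%N.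
Definition sq_adj := (\sum_(i in U) (\sum_(j in U) E i j * d j) ^ 2)%N.
Definition form_codeg := (\sum_(i in U) d i * \sum_(j in U) l i j * d j)%N.

Let a i : R := \sum_(j in U) (E i j)%:R * dR j.
Let b i : R := \sum_(j in U) (l i j)%:R * dR j.

Let aE i : a i = (\sum_(j in U) E i j * d j)%N%:R.
Proof. by rewrite natr_sum; apply: eq_bigr => j _; rewrite natrM. Qed.
Let bE i : b i = (\sum_(j in U) l i j * d j)%N%:R.
Proof. by rewrite natr_sum; apply: eq_bigr => j _; rewrite natrM. Qed.

Let app_d i : app dR i = a i + b i / (r + 1).
Proof.
rewrite /app /a /b mulr_suml -big_split; apply: eq_bigr => j _ /=.
by rewrite /T; ring.
Qed.

Let a_ge0 i : 0 <= a i. Proof. by rewrite aE. Qed.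
Let b_ge0 i : 0 <= b i. Proof. by rewrite bE. Qed.
Let a_le i : a i <= m ^+ 3.
Proof.
have -> : m ^+ 3 = m * (m * m) by ring.
apply: sumU_le => [|j jU]; first by have := m_ge1; nra.
by apply: ler_pM; rewrite ?ler_nat ?d_le.
Qed.
Let b_le i : i \in U -> b i <= m ^+ 3.
Proof.
move=> iU; have -> : m ^+ 3 = m * (m * m) by ring.
apply: sumU_le => [|j jU]; first by have := m_ge1; nra.
by apply: ler_pM; rewrite ?ler_nat ?d_le ?l_le.
Qed.

(** Besides the remainder [rest] of the iteration, the term Td.Td differs from
    Ad.Ad by [extra]; they are at most 16 M^9 / r and 3 M^9 / r. *)
Lemma sigma_expansion :
  expansion r sq_deg form_adj sq_adj form_codeg <= r ^+ 3 * (\sum_(i in U) (d i)%:R * x i)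
    <= expansion r sq_deg form_adj sq_adj form_codeg + 19 * M%:R ^+ 9 / r.
Proof.
rewrite -/m; set sigma := \sum_(i in U) _.
pose ad := app dR; pose aad := app ad.
have ad_ge0 i : 0 <= ad i by apply: app_ge0 => j; rewrite /dR.
have aad_ge0 i : 0 <= aad i by apply: app_ge0.
pose rest := \sum_(i in U) app aad i * x i.
have rest_ge0 : 0 <= rest.
  by rewrite sumr_ge0 // => i _; rewrite mulr_ge0 // app_ge0.
have m3_ge0 k : 0 <= m ^+ k by rewrite exprn_ge0 //; have := m_ge1; lra.
have ad_le i : i \in U -> ad i <= 2 * m ^+ 3.
  move=> iU; apply: le_trans (app_le iU _) _ => [j|]; first by rewrite /dR.
  have -> : 2 * m ^+ 3 = 2 * m * m ^+ 2 by ring.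
  by rewrite ler_wpM2l ?sum_d_le //; have := m_ge1; lra.
have step_le v c i : i \in U -> 0 <= c -> (forall j, 0 <= v j) ->
    (forall j, j \in U -> v j <= c) -> app v i <= 2 * m ^+ 2 * c.
  move=> iU c_ge0 v_ge0 vc; apply: le_trans (app_le iU v_ge0) _.
  have -> : 2 * m ^+ 2 * c = 2 * m * (m * c) by ring.
  by rewrite ler_wpM2l ?sumU_le //; have := m_ge1; lra.
have rest_le : rest <= 16 * m ^+ 9 / r.
  have e i : i \in U -> app aad i <= 8 * m ^+ 7.
    move=> iU; have -> : 8 * m ^+ 7 = 2 * m ^+ 2 * (2 * m ^+ 2 * (2 * m ^+ 3)) by ring.
    have m2 := m3_ge0 2; have m3 := m3_ge0 3.
    apply: (step_le) => // [|j jU]; first by rewrite !mulr_ge0.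
    by apply: step_le => //; rewrite mulr_ge0.
  apply: (@le_trans _ _ (8 * m ^+ 7 * \sum_(i in U) x i)).
    by rewrite mulr_sumr; apply: ler_sum => i iU; rewrite ler_wpM2r // e.
  have -> : 16 * m ^+ 9 / r = 8 * m ^+ 7 * (2 * m ^+ 2 / r) by ring.
  by rewrite ler_wpM2l // mulr_ge0.
pose extra := \sum_(i in U) (2 * (a i * b i) / (r + 1) + b i ^+ 2 / (r + 1) ^+ 2).
have r1_ge0 : 0 <= (r + 1)^-1 by rewrite invr_ge0; have := r_gt0; lra.
have extra_ge0 : 0 <= extra.
  rewrite sumr_ge0 // => i _; rewrite -exprVn addr_ge0 // mulr_ge0 ?exprn_ge0 //.
  by rewrite !mulr_ge0.
have rV_ge0 : 0 <= r^-1 by rewrite invr_ge0; have := r_gt0; lra.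
have extra_le : extra <= 3 * m ^+ 9 / r.
  apply: (@le_trans _ _ (m * (3 * m ^+ 6 / r))); last first.
    have -> : m * (3 * m ^+ 6 / r) = m ^+ 7 * (3 / r) by ring.
    have -> : 3 * m ^+ 9 / r = m ^+ 9 * (3 / r) by ring.
    by rewrite ler_wpM2r ?mulr_ge0 // ler_weXn2l.
  apply: sumU_le => [|i iU]; first by rewrite !mulr_ge0.
  have ab_le : a i * b i <= m ^+ 6.
    have -> : m ^+ 6 = m ^+ 3 * m ^+ 3 by ring.
    by apply: ler_pM => //; apply: b_le.
  have bb_le : b i ^+ 2 <= m ^+ 6.
    have -> : m ^+ 6 = m ^+ 3 * m ^+ 3 by ring.
    by rewrite expr2; apply: ler_pM => //; apply: b_le.
  have inv_le : (r + 1)^-1 <= r^-1 by rewrite lef_pV2 ?posrE; have := r_gt0; lra.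
  have inv2_le : ((r + 1) ^+ 2)^-1 <= r^-1.
    by rewrite lef_pV2 ?posrE ?exprn_gt0 //; have := r_gt0; nra.
  have t1 : a i * b i / (r + 1) <= m ^+ 6 / r by apply: ler_pM; rewrite ?mulr_ge0.
  have t2 : b i ^+ 2 / (r + 1) ^+ 2 <= m ^+ 6 / r.
    by apply: ler_pM; rewrite ?exprn_ge0 // -exprVn exprn_ge0.
  by rewrite -!mulrA; rewrite -mulrA in t1; lra.
suff -> : r ^+ 3 * sigma = expansion r sq_deg form_adj sq_adj form_codeg + (rest + extra).
  by apply/andP; split; lra.
have s1 : r * sigma = sq_deg%:R + \sum_(i in U) ad i * x i.
  rewrite x_step; congr (_ + _); rewrite /sq_deg natr_sum; apply: eq_bigr => i _.
  by rewrite natrX expr2.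
have s2 : r * \sum_(i in U) ad i * x i =
    form_adj%:R + form_codeg%:R / (r + 1) + \sum_(i in U) aad i * x i.
  rewrite x_step; congr (_ + _). rewrite /form_adj /form_codeg !natr_sum mulr_suml -big_split.
  by apply: eq_bigr => i _; rewrite /= /ad app_d !natrM -aE -bE /dR; ring.
have s3 : r * \sum_(i in U) aad i * x i = sq_adj%:R + extra + rest.
  rewrite x_step; congr (_ + _); rewrite /aad -app_sym /sq_adj natr_sum -big_split.
  apply: eq_bigr => i _; rewrite /= -/ad /ad app_d natrX -aE.
  by field; apply: lt0r_neq0; have := r_gt0; lra.
have -> : r ^+ 3 * sigma = r ^+ 2 * (r * sigma) by ring.
have -> : r ^+ 2 * (r * sigma) =
    r ^+ 2 * sq_deg%:R + r * (r * \sum_(i in U) ad i * x i) by rewrite s1; ring.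
rewrite s2 [r * (_ + _)]mulrDr s3 /expansion.
by ring.
Qed.

End Bounds.
End Expansion.

(** * Non-adjacent pairs inside U *)

Lemma sum_le_eq (I : finType) (P : pred I) (F H : I -> nat) :
    (forall i, P i -> F i <= H i)%N ->
    (\sum_(i | P i) H i <= \sum_(i | P i) F i)%N ->
  forall i, P i -> F i = H i.
Proof.
move=> FH HF i Pi; apply/eqP; rewrite eqn_leq FH //= -(leq_add2r (\sum_(j | P j && (j != i)) F j)).
rewrite -(bigD1 i) //=; apply: leq_trans HF.
rewrite [X in (_ <= X)%N](bigD1 i) //= leq_add2l.
by apply: leq_sum => j /andP[/FH].
Qed.

Section NonAdjacency.
Variables (G : sgraph) (U : {set G}) (h : nat).
Local Open Scope nat_scope.
Hypothesis U_card : #|U| = 2 * h + 2.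
Implicit Types x y z : G.

Definition nonadj x y := (x != y) && ~~ edge x y.
Definition codeg x : nat := \sum_(y in U) nonadj x y.
Local Notation m := codeg.

Lemma nonadj_sym x y : nonadj x y = nonadj y x.
Proof. by rewrite /nonadj eq_sym edge_sym. Qed.

Lemma nonadj_irr x : nonadj x x = false.
Proof. by rewrite /nonadj eqxx. Qed.

Lemma edge_nonadj x y : edge x y + nonadj x y + (x == y) = 1.
Proof. by rewrite /nonadj; case: eqVneq => [->|_]; rewrite ?edge_irr //; case: edge. Qed.

Lemma edge_nonadj_sum x (w : G -> nat) : x \in U ->
  \sum_(y in U) edge x y * w y + \sum_(y in U) nonadj x y * w y + w x = \sum_(y in U) w y.
Proof.
move=> xU; have -> : w x = \sum_(y in U) (x == y) * w y.
  rewrite (bigD1 x) //= eqxx mul1n big1 ?addn0 // => y /andP[_ yx].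
  by rewrite eq_sym (negbTE yx).
rewrite -!big_split; apply: eq_bigr => y _ /=.
by rewrite -!mulnDl edge_nonadj mul1n.
Qed.

Lemma codeg_deg_in x : x \in U -> deg_in U x + m x = 2 * h + 1.
Proof.
move=> xU; have := edge_nonadj_sum (fun=> 1) xU.
by rewrite sum1_card U_card -!big_distrl /= !muln1 -/(deg_in U x) -/(m x); lia.
Qed.

Definition codeg_sum := \sum_(x in U) m x.
Local Notation Q := codeg_sum.

(** Count the codegree sum from below: every non-neighbour z of x or of y, other
    than x and y, contributes again through its own codegree. *)
Lemma codeg_pair x y : x \in U -> y \in U -> nonadj x y -> 2 * (m x + m y) <= Q + 2.
Proof.
move=> xU yU Nxy; have yx : y != x by case/andP: Nxy; rewrite eq_sym.
have split2 (w : G -> nat) : \sum_(z in U) w z =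
    w x + (w y + \sum_(z in U | (z != x) && (z != y)) w z).
  rewrite (bigD1 x) //= (bigD1 y) /=; last by rewrite yU.
  by congr (_ + (_ + _)); apply: eq_bigl => z; rewrite andbA.
have mz z : nonadj z x + nonadj z y <= m z.
  by rewrite /m split2 addnA leq_addr.
rewrite /Q split2.
have : \sum_(z in U | (z != x) && (z != y)) (nonadj z x + nonadj z y)
    <= \sum_(z in U | (z != x) && (z != y)) m z by apply: leq_sum.
rewrite big_split /=.
have : m x = 0 + (1 + \sum_(z in U | (z != x) && (z != y)) nonadj z x).
  rewrite {1}/m split2 nonadj_irr Nxy; congr (_ + (_ + _)).
  by apply: eq_bigr => z _; rewrite nonadj_sym.
have : m y = 1 + (0 + \sum_(z in U | (z != x) && (z != y)) nonadj z y).
  rewrite {1}/m split2 nonadj_irr nonadj_sym Nxy; congr (_ + (_ + _)).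
  by apply: eq_bigr => z _; rewrite nonadj_sym.
by lia.
Qed.

Lemma codeg_le x : x \in U -> 2 * m x <= Q.
Proof.
move=> xU; case: (posnP (m x)) => [->//|m_gt0].
have [y yU Nxy] : exists2 y, y \in U & nonadj x y.
  apply/exists_inP; apply: contraLR m_gt0 => /exists_inPn none.
  by rewrite -leqNgt leqn0 /m big1 // => y yU; rewrite (negbTE (none y yU)).
have my_gt0 : 0 < m y by rewrite /m (bigD1 x) //= nonadj_sym Nxy.
by have := codeg_pair xU yU Nxy; lia.
Qed.

Lemma codeg_sqrE : 4 * \sum_(x in U) m x ^ 2 =
  \sum_(x in U) \sum_(y in U) nonadj x y * (2 * (m x + m y)).
Proof.
have e1 : \sum_(x in U) \sum_(y in U) nonadj x y * m x = \sum_(x in U) m x ^ 2.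
  by apply: eq_bigr => x _; rewrite -big_distrl -mulnn.
have e2 : \sum_(x in U) \sum_(y in U) nonadj x y * m y = \sum_(x in U) m x ^ 2.
  rewrite exchange_big -e1; apply: eq_bigr => x _; apply: eq_bigr => y _.
  by rewrite nonadj_sym.
transitivity (2 * (\sum_(x in U) \sum_(y in U) nonadj x y * m x
                 + \sum_(x in U) \sum_(y in U) nonadj x y * m y)); first by rewrite e1 e2; lia.
rewrite -big_split big_distrr; apply: eq_bigr => x _.
rewrite -big_split big_distrr; apply: eq_bigr => y _ /=.
by rewrite -mulnDr mulnCA.
Qed.

Lemma codeg_QE c : Q * c = \sum_(x in U) \sum_(y in U) nonadj x y * c.
Proof. by rewrite big_distrl; apply: eq_bigr => x _; rewrite /m big_distrl. Qed.

(** The sum of the squared codegrees is the sum of m x + m y over the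
    non-adjacent pairs, each bounded by [codeg_pair]. *)
Lemma codeg_sqr_le : 4 * \sum_(x in U) m x ^ 2 <= Q * (Q + 2).
Proof.
rewrite codeg_sqrE codeg_QE; apply: leq_sum => x xU; apply: leq_sum => y yU.
by case Nxy: (nonadj x y); rewrite ?mul0n // !mul1n codeg_pair.
Qed.

Lemma codeg_sqr_eq : Q * (Q + 2) <= 4 * \sum_(x in U) m x ^ 2 ->
  forall x y, x \in U -> y \in U -> nonadj x y -> 2 * (m x + m y) = Q + 2.
Proof.
have pair x y : x \in U -> y \in U -> nonadj x y * (2 * (m x + m y)) <= nonadj x y * (Q + 2).
  by move=> xU yU; case Nxy: (nonadj x y); rewrite ?mul0n // !mul1n codeg_pair.
rewrite codeg_sqrE codeg_QE => le x y xU yU Nxy.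
have row z : z \in U -> \sum_(w in U) nonadj z w * (2 * (m z + m w))
    <= \sum_(w in U) nonadj z w * (Q + 2).
  by move=> zU; apply: leq_sum => w; apply: pair.
have outer := sum_le_eq row le xU.
have := sum_le_eq (fun y => pair x y xU) _ yU.
by rewrite outer leqnn Nxy !mul1n => ->.
Qed.

Section Excess.
Variables (a : nat) (f d : G -> nat).
Hypothesis d_eq : forall x, x \in U -> d x = a + m x + f x.
Hypothesis budget : Q + 2 * (\sum_(x in U) f x) <= 2 * h.
Local Notation F := (\sum_(x in U) f x).

(** The four numbers [star_inv1], ..., [star_inv4] are the values at the extremal
    configuration of the coefficients in the expansion of the Perron root. *)
Definition star_inv1 := (2 * h + 2) * a ^ 2 + 4 * a * h + h ^ 2 + h.

Lemma excess_sqr : 4 * \sum_(x in U) (m x + f x) ^ 2 <=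
  4 * (\sum_(x in U) m x ^ 2) + 4 * Q * F + 4 * F ^ 2.
Proof.
have mf : 2 * \sum_(x in U) m x * f x <= Q * F.
  rewrite !big_distrr; apply: leq_sum => x xU /=.
  by rewrite mulnA leq_mul2r codeg_le ?orbT.
have ff : \sum_(x in U) f x ^ 2 <= F ^ 2.
  rewrite -mulnn big_distrl; apply: leq_sum => x xU /=.
  by rewrite -mulnn leq_mul2l (bigD1 x) //= leq_addr orbT.
have -> : \sum_(x in U) (m x + f x) ^ 2 =
    \sum_(x in U) m x ^ 2 + 2 * (\sum_(x in U) m x * f x) + \sum_(x in U) f x ^ 2.
  rewrite big_distrr -!big_split; apply: eq_bigr => x _ /=.
  by rewrite sqrnD addnAC.
by move: mf ff; rewrite -mulnA; lia.
Qed.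

Lemma sum_d_sqr : \sum_(x in U) d x ^ 2 =
  (2 * h + 2) * a ^ 2 + 2 * a * (Q + F) + \sum_(x in U) (m x + f x) ^ 2.
Proof.
rewrite -U_card -sum_nat_const /Q -big_split big_distrr -!big_split.
by apply: eq_bigr => x xU /=; rewrite d_eq // -addnA sqrnD addnAC mulnA.
Qed.

(** With q and p the sums of m and f over U, four times the sum of (m + f)^2 is at
    most (q + 2p)^2 + 2q, and both q + 2p and q are at most 2h. *)
Lemma level1_le : \sum_(x in U) d x ^ 2 <= star_inv1.
Proof.
rewrite sum_d_sqr /star_inv1; have := excess_sqr; have := codeg_sqr_le.
move: (\sum_(x in U) (m x + f x) ^ 2) (\sum_(x in U) m x ^ 2) budget => A B.
move: Q F => q p bud b1 b2.
have lin : 2 * a * (q + p) <= 4 * a * h.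
  by rewrite [4 * a * h](_ : _ = 2 * a * (2 * h)) ?leq_mul2l; lia.
have : 4 * A <= (q + 2 * p) ^ 2 + 2 * q.
  by move: b1 b2; rewrite -!mulnn; lia.
have : (q + 2 * p) ^ 2 <= (2 * h) ^ 2 by rewrite leq_sqr.
by rewrite expnMn; lia.
Qed.

Lemma level1_eq : \sum_(x in U) d x ^ 2 = star_inv1 ->
  [/\ Q = 2 * h, forall x, x \in U -> f x = 0
    & forall x y, x \in U -> y \in U -> nonadj x y -> m x + m y = h + 1].
Proof.
rewrite sum_d_sqr /star_inv1; have := excess_sqr; have := codeg_sqr_le.
have eqs := codeg_sqr_eq.
move: (\sum_(x in U) (m x + f x) ^ 2) (\sum_(x in U) m x ^ 2) budget eqs => A B.
move=> bud eqs b1 b2 E.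
have lin : 2 * a * (Q + F) <= 4 * a * h.
  by rewrite [4 * a * h](_ : _ = 2 * a * (2 * h)) ?leq_mul2l; lia.
have b3 : 4 * A <= (Q + 2 * F) ^ 2 + 2 * Q.
  by move: b1 b2; rewrite -!mulnn; lia.
have b4 : (Q + 2 * F) ^ 2 <= (2 * h) ^ 2 by rewrite leq_sqr.
rewrite expnMn in b4.
have QE : Q = 2 * h by lia.
have F0 : F = 0 by lia.
split=> // [x xU|x y xU yU Nxy].
  by move/eqP: F0; rewrite sum_nat_eq0 => /forall_inP/(_ x xU)/eqP.
have := eqs _ x y xU yU Nxy; rewrite QE => pair.
suff : 2 * (m x + m y) = 2 * h + 2 by lia.
by apply: pair; move: E b2; rewrite QE F0 -!mulnn; lia.
Qed.
End Excess.

Section Star.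
Variables (a : nat) (d : G -> nat).
Hypothesis d_eq : forall x, x \in U -> d x = a + m x.
Hypothesis Q_eq : Q = 2 * h.
Hypothesis pair_sum :
  forall x y, x \in U -> y \in U -> nonadj x y -> m x + m y = h + 1.

Definition sumd := (2 * h + 2) * a + 2 * h.

Lemma sum_dE : \sum_(x in U) d x = sumd.
Proof.
rewrite /sumd -U_card -Q_eq -sum_nat_const -big_split.
by apply: eq_bigr => x xU; rewrite d_eq.
Qed.

Definition quad (w : G -> nat) := \sum_(x in U) w x * \sum_(y in U) edge x y * w y.
Definition coquad (w : G -> nat) :=
  \sum_(x in U) \sum_(y in U) nonadj x y * (w x * w y).

(** The product of the sum of d with itself, split over adjacent, non-adjacent
    and equal pairs. Maximising [quad d] thus means minimising [coquad d]. *)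
Lemma quad_coquad : quad d + coquad d + \sum_(x in U) d x ^ 2 = sumd ^ 2.
Proof.
rewrite -sum_dE -mulnn big_distrl -!big_split; apply: eq_bigr => x xU /=.
rewrite -(edge_nonadj_sum d xU) !mulnDr; congr (_ + _ + _); rewrite ?mulnn //.
by rewrite big_distrr; apply: eq_bigr => y _; rewrite mulnCA.
Qed.

Lemma coquad_d : coquad d = 2 * h * a ^ 2 + 2 * h * (a * (h + 1)) + coquad m.
Proof.
rewrite -Q_eq !codeg_QE -!big_split; apply: eq_bigr => x xU /=.
rewrite -!big_split; apply: eq_bigr => y yU /=.
case Nxy: (nonadj x y); rewrite ?mul0n // !mul1n -(pair_sum xU yU Nxy) !d_eq //.
by rewrite -mulnn; nia.
Qed.

Lemma codeg_gt0 x y : x \in U -> y \in U -> nonadj x y -> 0 < m x.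
Proof. by move=> xU yU Nxy; rewrite /m (bigD1 y) //= Nxy. Qed.

(** Two positive integers with sum h + 1 have product at least h. *)
Lemma codeg_prod x y : x \in U -> y \in U -> nonadj x y -> h <= m x * m y.
Proof.
move=> xU yU Nxy; have := pair_sum xU yU Nxy; have := codeg_gt0 xU yU Nxy.
rewrite nonadj_sym in Nxy; have := codeg_gt0 yU xU Nxy.
by move: (m x) (m y) => [|p] [|q] //; rewrite mulSn mulnS; lia.
Qed.

Lemma coquad_m_ge : 2 * h * h <= coquad m.
Proof.
rewrite -Q_eq codeg_QE; apply: leq_sum => x xU; apply: leq_sum => y yU.
by case Nxy: (nonadj x y); rewrite ?mul0n // !mul1n codeg_prod.
Qed.

Definition star_inv2 :=
  sumd ^ 2 - (star_inv1 a + (2 * h * a ^ 2 + 2 * h * (a * (h + 1)) + 2 * h * h)).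

Lemma level2_le : \sum_(x in U) d x ^ 2 = star_inv1 a -> quad d <= star_inv2.
Proof.
move=> E1; have := quad_coquad; rewrite coquad_d E1 /star_inv2.
by have := coquad_m_ge; lia.
Qed.

Lemma level2_eq : \sum_(x in U) d x ^ 2 = star_inv1 a -> quad d = star_inv2 ->
  forall x y, x \in U -> y \in U -> nonadj x y -> m x * m y = h.
Proof.
move=> E1 E2 x y xU yU Nxy.
have : coquad m <= 2 * h * h.
  have := quad_coquad; rewrite coquad_d E1 E2 /star_inv2.
  by have := coquad_m_ge; lia.
have pair z w : z \in U -> w \in U -> nonadj z w * h <= nonadj z w * (m z * m w).
  by move=> zU wU; case Nzw: (nonadj z w); rewrite ?mul0n // !mul1n codeg_prod.
rewrite -Q_eq codeg_QE => le.
have row z : z \in U ->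
    \sum_(w in U) nonadj z w * h <= \sum_(w in U) nonadj z w * (m z * m w).
  by move=> zU; apply: leq_sum => w; apply: pair.
have outer := sum_le_eq row le xU.
have := sum_le_eq (fun y => pair x y xU) _ yU.
by rewrite outer leqnn Nxy !mul1n => ->.
Qed.

(** The complement of the graph induced on U is a star with centre c and h edges,
    together with isolated vertices. *)
Definition costar (c : G) := [/\ c \in U, m c = h,
  forall x, x \in U -> x != c -> m x = nonadj c x
  & forall x y, x \in U -> y \in U -> nonadj x y -> x = c \/ y = c].

(** For h > 0, sum h + 1 and product h force the codegrees 1 and h on each
    non-adjacent pair. A vertex of codegree h and its h non-neighbours already
    use up the codegree sum 2h, so nothing else is non-adjacent. *)
Lemma costar_exists :
    (forall x y, x \in U -> y \in U -> nonadj x y -> m x * m y = h) ->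
  exists c, costar c.
Proof.
move=> pair_prod.
have [c cU mc] : exists2 c, c \in U & m c = h.
  case: (posnP h) => [h0|h_gt0].
    have /card_gt0P[c cU] : 0 < #|U| by rewrite U_card; lia.
    exists c => //; move/eqP: Q_eq; rewrite h0 sum_nat_eq0.
    by move=> /forall_inP/(_ c cU)/eqP.
  have [x xU mx] : exists2 x, x \in U & 0 < m x.
    apply/exists_inP; apply: contraLR h_gt0 => /exists_inPn none; rewrite -leqNgt.
    suff : Q = 0 by rewrite Q_eq; lia.
    by apply: big1 => x xU; apply/eqP; rewrite -leqn0 leqNgt none.
  have [y yU Nxy] : exists2 y, y \in U & nonadj x y.
    apply/exists_inP; apply: contraLR mx => /exists_inPn none.
    by rewrite -leqNgt leqn0 /m big1 // => y yU; rewrite (negbTE (none y yU)).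
  have ms := pair_sum xU yU Nxy; have mp := pair_prod x y xU yU Nxy.
  have [mx1|mx1] := eqVneq (m x) 1.
    by exists y => //; move: mp; rewrite mx1 mul1n.
  exists x => //; move: mp ms mx mx1; move: (m x) (m y).
  move=> [|[|p]] // [|q]; first by rewrite muln0; lia.
  by rewrite mulnS mulSn; case: q => [|q]; lia.
(* the centre and its non-neighbours exhaust the codegree sum 2h *)
have rest : \sum_(x in U | x != c) m x <= \sum_(x in U | x != c) nonadj c x.
  have : m c = \sum_(x in U | x != c) nonadj c x.
    by rewrite {1}/m (bigD1 c) //= nonadj_irr.
  by move: Q_eq; rewrite /Q (bigD1 c) //= mc; lia.
have m_nonadj x : x \in U -> x != c -> m x = nonadj c x.
  move=> xU xc; symmetry.
  apply: (sum_le_eq _ rest); last by rewrite xU.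
  by move=> z /andP[zU zc]; rewrite nonadj_sym /m (bigD1 c) //= leq_addr.
exists c; split=> // x y xU yU Nxy.
have [->|xc] := eqVneq x c; [by left | right; apply/eqP/negPn/negP => yc].
have := codeg_gt0 xU yU Nxy; rewrite m_nonadj // lt0b => Ncx.
have : m x = 1 by rewrite m_nonadj // Ncx.
by rewrite /m (bigD1 c) //= nonadj_sym Ncx (bigD1 y) /= ?yU // Nxy; lia.
Qed.
End Star.

Section CostarProfile.
Variables (a : nat) (d : G -> nat) (c : G).
Hypothesis d_eq : forall x, x \in U -> d x = a + m x.
Hypothesis star : costar c.

(** The codegrees in U are h, 1 (h times) and 0 (h + 1 times). All coefficients
    of the expansion are sums over U of functions of the codegree, hence
    determined by this lemma. *)
Lemma costar_profile (w : nat -> nat) :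
  \sum_(x in U) w (m x) = w h + (h * w 1 + (h + 1) * w 0).
Proof.
have [cU mc m_nonadj _] := star.
rewrite (bigD1 c) //= mc; congr (_ + _).
have leaves : \sum_(x in U | x != c) nonadj c x = h.
  by rewrite -[RHS]mc /m [RHS](bigD1 c) //= nonadj_irr.
have others : \sum_(x in U | x != c) ~~ nonadj c x = h + 1.
  have : \sum_(x in U | x != c) nonadj c x + \sum_(x in U | x != c) ~~ nonadj c x = 2 * h + 1.
    rewrite -big_split (eq_bigr (fun=> 1)) => [|x _]; last by case: nonadj.
    apply/eqP; rewrite -(eqn_add2l 1) -{1}[1](_ : \sum_(x in U | x == c) 1 = 1).
      by rewrite -(bigID (fun x => x == c)) sum1_card U_card; lia.
    by rewrite (big_pred1 c) // => x; rewrite /= andbC; case: eqVneq => // ->.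
  by rewrite leaves; lia.
rewrite -[h + 1]others -[X in X * w 1]leaves !big_distrl -big_split.
apply: eq_bigr => x /andP[xU xc] /=.
by rewrite m_nonadj //; case: nonadj; rewrite !(mul1n, mul0n, addn0).
Qed.

Lemma costar_sum : Q = 2 * h.
Proof. by rewrite /Q (costar_profile id); lia. Qed.

Lemma costar_pair x y : x \in U -> y \in U -> nonadj x y ->
  m x + m y = h + 1 /\ m x * m y = h.
Proof.
have [cU mc m_nonadj only] := star.
move=> xU yU Nxy; have [xc|yc] := only x y xU yU Nxy.
  subst x; have yc : y != c by case/andP: Nxy; rewrite eq_sym.
  by rewrite mc (m_nonadj y) // Nxy muln1.
subst y; have xc : x != c by case/andP: Nxy.
by rewrite mc (m_nonadj x) // nonadj_sym Nxy mul1n addnC.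
Qed.

Lemma costar_level1 : \sum_(x in U) d x ^ 2 = star_inv1 a.
Proof.
rewrite (eq_bigr (fun x => (a + m x) ^ 2)) => [|x xU]; last by rewrite d_eq.
by rewrite (costar_profile (fun t => (a + t) ^ 2)) /star_inv1 !sqrnD; nia.
Qed.

Lemma costar_level2 : quad d = star_inv2 a.
Proof.
have pair_sum x y xU yU Nxy := (@costar_pair x y xU yU Nxy).1.
have pair_prod x y xU yU Nxy := (@costar_pair x y xU yU Nxy).2.
have := quad_coquad d_eq costar_sum; rewrite (coquad_d d_eq costar_sum pair_sum).
have -> : coquad m = 2 * h * h.
  rewrite -costar_sum codeg_QE; apply: eq_bigr => x xU; apply: eq_bigr => y yU.
  by case Nxy: (nonadj x y); rewrite ?mul0n // !mul1n pair_prod.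
by rewrite costar_level1 /star_inv2; lia.
Qed.

Definition adj_sum t := sumd a - (a + t) - (a * t + h * (0 < t)).

Lemma costar_adj_sum x : x \in U -> \sum_(y in U) edge x y * d y = adj_sum (m x).
Proof.
have [cU mc m_nonadj only] := star.
move=> xU; have := edge_nonadj_sum d xU; rewrite (sum_dE d_eq costar_sum) d_eq //.
suff -> : \sum_(y in U) nonadj x y * d y = a * m x + h * (0 < m x) by rewrite /adj_sum; lia.
have -> : \sum_(y in U) nonadj x y * d y
        = a * m x + \sum_(y in U) nonadj x y * m y.
  rewrite {2}/m big_distrr -big_split; apply: eq_bigr => y yU /=.
  by rewrite d_eq // mulnDr [a * _]mulnC.
congr (_ + _); have [->|xc] := eqVneq x c.
  rewrite mc -[RHS](_ : m c = _); last by rewrite mc; case: (h) => // h'; rewrite muln1.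
  rewrite {2}/m; apply: eq_bigr => y yU; case Ncy: (nonadj c y) => //.
  by rewrite m_nonadj ?Ncy // eq_sym; case/andP: Ncy.
rewrite (bigD1 c) //= big1 => [|y /andP[yU yc]]; last first.
  case Nxy: (nonadj x y) => //; have [E|E] := only x y xU yU Nxy.
    by rewrite E eqxx in xc.
  by rewrite E eqxx in yc.
by rewrite addn0 mc (m_nonadj x) // [nonadj x c]nonadj_sym mulnC lt0b.
Qed.

Definition star_inv3 := adj_sum h ^ 2 + (h * adj_sum 1 ^ 2 + (h + 1) * adj_sum 0 ^ 2).

Lemma costar_level3 : \sum_(x in U) (\sum_(y in U) edge x y * d y) ^ 2 = star_inv3.
Proof.
rewrite /star_inv3 -(costar_profile (fun t => adj_sum t ^ 2)).
by apply: eq_bigr => x xU; rewrite costar_adj_sum.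
Qed.

Definition min_sum t := let w p := (a + p) * minn (a + t) (a + p) in
  w h + (h * w 1 + (h + 1) * w 0).

(** The sum of d_x d_y min(d_x, d_y) over U, with the codegree profile of a star
    substituted twice; see [costar_min_sum]. *)
Definition star_inv4 := let w t := (a + t) * min_sum t in w h + (h * w 1 + (h + 1) * w 0).

Lemma costar_min_sum :
  \sum_(x in U) d x * \sum_(y in U) minn (d x) (d y) * d y = star_inv4.
Proof.
rewrite /star_inv4 -(costar_profile (fun t => (a + t) * min_sum t)).
apply: eq_bigr => x xU; rewrite -d_eq //; congr (_ * _).
rewrite /min_sum -(costar_profile (fun p => (a + p) * minn (a + m x) (a + p))).
by apply: eq_bigr => y yU; rewrite !d_eq // mulnC.
Qed.
End CostarProfile.
End NonAdjacency.

(** * Comparing radii when the complement of U is a clique *)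

Section CliqueComplement.
Variables (C : numClosedFieldType) (G : sgraph) (U : {set G}).
Local Notation R := (real_of C).
Local Notation B := (~: U).
Implicit Types x y b : G.

Definition codegree x y : nat := (\sum_(b in B) edge x b * edge b y)%N.
Local Notation d := (deg_in B).

Lemma codegree_sym x y : codegree x y = codegree y x.
Proof. by apply: eq_bigr => b _; rewrite mulnC (edge_sym b y) (edge_sym x b). Qed.

Lemma codegree_le x y : (codegree x y <= d x)%N.
Proof. by apply: leq_sum => b _; case: (edge x b) => //; case: edge. Qed.

Variables (r : R) (p : G -> R).
Hypothesis pp : @perron_pair C G r p.
Hypothesis clique : {in B &, forall x y, x != y -> edge x y}.
Hypothesis B_gt0 : (0 < #|B|)%N.

Lemma perron_ge0 : 0 <= r.
Proof.
have [p_gt0 pA] := pp; have /card_gt0P[x _] := B_gt0.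
rewrite -(pmulr_lge0 r (p_gt0 x)) -pA sumr_ge0 // => y _.
by rewrite mulr_ge0 // ltW.
Qed.

(** On the clique, (r + 1) p_b is the total weight S of the clique plus the weight
    of the neighbours of b in U. Substituting this in the eigenvalue equations on
    U, and scaling so that S = r + 1, gives the first equation; summing it over
    the clique gives the second one. *)
Lemma perron_sigma : exists x : G -> R,
  [/\ forall i, 0 <= x i,
      forall i, i \in U -> r * x i = (d i)%:R +
        \sum_(j in U) ((edge i j)%:R + (codegree i j)%:R / (r + 1)) * x j
    & (r + 1) * (r + 1 - #|B|%:R) = \sum_(i in U) (d i)%:R * x i].
Proof.
have [p_gt0 pA] := pp; have r_ge0 := perron_ge0.
have r1_neq0 : r + 1 != 0 by apply: lt0r_neq0; lra.
pose S := \sum_(b in B) p b.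
have S_gt0 : 0 < S.
  have /card_gt0P[b bB] := B_gt0; rewrite /S (bigD1 b) //=.
  by rewrite ltr_wpDr // sumr_ge0 // => y _; apply: ltW.
have S_neq0 : S != 0 by apply: lt0r_neq0.
have split x : r * p x = \sum_(y in U) (edge x y)%:R * p y
                       + \sum_(b in B) (edge x b)%:R * p b.
  rewrite -pA (bigID (mem U)) /=; congr (_ + _).
  by apply: eq_bigl => y; rewrite inE.
have pB b : b \in B -> (r + 1) * p b = S + \sum_(y in U) (edge b y)%:R * p y.
  move=> bB; rewrite mulrDl mul1r split addrAC [RHS]addrC -addrA; congr (_ + _).
  rewrite /S (bigD1 b) //= edge_irr mul0r add0r [RHS](bigD1 b) //=; congr (_ + _).
  apply: eq_bigr => y /andP[yB yb]; rewrite clique ?mul1r //.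
  by rewrite eq_sym.
have pU x : (r + 1) * \sum_(b in B) (edge x b)%:R * p b =
    S * (d x)%:R + \sum_(j in U) (codegree x j)%:R * p j.
  rewrite mulr_sumr (eq_bigr (fun b => S * (edge x b)%:R
      + \sum_(j in U) (edge x b * edge b j)%N%:R * p j)) => [|b bB]; last first.
    rewrite mulrCA pB // mulrDr mulrC; congr (_ + _); rewrite mulr_sumr.
    by apply: eq_bigr => j _; rewrite natrM mulrA.
  rewrite big_split /= -mulr_sumr -natr_sum; congr (_ + _).
  rewrite exchange_big; apply: eq_bigr => j _ /=.
  by rewrite -mulr_suml -natr_sum.
pose x i := p i * ((r + 1) / S).
exists x; split=> [i|i iU|].
- by rewrite mulr_ge0 ?divr_ge0 ?ltW //; lra.
- apply: (mulIf S_neq0); rewrite /x.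
  have -> : r * (p i * ((r + 1) / S)) * S = (r + 1) * (r * p i) by field.
  rewrite split mulrDr pU [RHS]mulrDl addrCA [S * _]mulrC; congr (_ + _).
  rewrite mulr_sumr mulr_suml -big_split; apply: eq_bigr => j _ /=.
  by field; rewrite S_neq0 r1_neq0.
apply: (mulIf S_neq0); rewrite mulr_suml.
have -> : \sum_(i in U) (d i)%:R * x i * S = (r + 1) * \sum_(i in U) (d i)%:R * p i.
  by rewrite mulr_sumr; apply: eq_bigr => i _; rewrite /x; field.
have -> : (r + 1) * (r + 1 - #|B|%:R) * S = (r + 1) * ((r + 1) * S - #|B|%:R * S) by ring.
congr (_ * _).
have -> : (r + 1) * S = #|B|%:R * S + \sum_(b in B) \sum_(y in U) (edge b y)%:R * p y.
  transitivity (\sum_(b in B) (r + 1) * p b); first by rewrite mulr_sumr.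
  by rewrite (eq_bigr _ pB) big_split /= sumr_const mulr_natl.
rewrite addrAC subrr add0r exchange_big; apply: eq_bigr => i _ /=.
rewrite -mulr_suml -natr_sum; congr (_%:R * _).
by apply: eq_bigr => b _; rewrite edge_sym.
Qed.

Definition inv1 := sq_deg U d.
Definition inv2 := form_adj U d (fun x y => edge x y : nat).
Definition inv3 := sq_adj U d (fun x y => edge x y : nat).
Definition inv4 := form_codeg U d codegree.

Variable M : nat.
Hypotheses (M_gt0 : (0 < M)%N) (U_le : (#|U| <= M)%N).
Hypothesis d_le : forall x, x \in U -> (d x <= M)%N.

Lemma perron_expansion : 4 * M%:R ^+ 2 <= r ->
  expansion r inv1 inv2 inv3 inv4
    <= r ^+ 3 * ((r + 1) * (r + 1 - #|B|%:R))
    <= expansion r inv1 inv2 inv3 inv4 + 19 * M%:R ^+ 9 / r.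
Proof.
move=> r_ge; have [x [x_ge0 x_eq ->]] := perron_sigma.
apply: (sigma_expansion (x := x)) => //.
- by move=> i j; case: edge.
- by move=> i j iU _; apply: leq_trans (codegree_le _ _) (d_le iU).
- by move=> i j; rewrite edge_sym.
- exact: codegree_sym.
Qed.

Let sumU_le (w : G -> nat) c : (forall x, x \in U -> w x <= c)%N ->
  (\sum_(x in U) w x <= M * c)%N.
Proof.
move=> wc; apply: (@leq_trans (\sum_(x in U) c)); first exact: leq_sum.
by rewrite sum_nat_const leq_mul2r U_le orbT.
Qed.

Lemma inv_le : [/\ inv2 <= M ^ 7, inv3 <= M ^ 7 & inv4 <= M ^ 7]%N.
Proof.
have M5 : (M ^ 5 <= M ^ 7)%N by rewrite leq_pexp2l.
have row x : (\sum_(j in U) edge x j * d j <= M ^ 3)%N.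
  apply: leq_trans (_ : M * M <= _)%N; last by rewrite mulnn leq_pexp2l.
  by apply: sumU_le => j jU; case: edge; rewrite // mul1n d_le.
split; first 1 last.
- rewrite (expnS M 6); apply: sumU_le => x xU; rewrite (expnM M 3 2).
  by rewrite leq_exp2r.
- apply: leq_trans M5; rewrite (expnS M 4); apply: sumU_le => x xU.
  rewrite (expnS M 3); apply: leq_mul; first exact: d_le.
  rewrite (expnS M 2); apply: sumU_le => j jU; rewrite -mulnn.
  by apply: leq_mul; [apply: leq_trans (codegree_le _ _) (d_le xU) | apply: d_le].
apply: leq_trans M5; rewrite (expnS M 4); apply: sumU_le => x xU.
by rewrite (expnS M 3); apply: leq_mul; [apply: d_le | apply: row].
Qed.

End CliqueComplement.

Section Compare.
Variables (C : numClosedFieldType) (G H : sgraph) (U : {set G}) (W : {set H}) (M : nat).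
Local Notation R := (real_of C).
Variables (r r' : R) (p : G -> R) (p' : H -> R).
Hypotheses (pp : @perron_pair C G r p) (pp' : @perron_pair C H r' p').
Hypothesis clique : {in ~: U &, forall x y, x != y -> edge x y}.
Hypothesis clique' : {in ~: W &, forall x y, x != y -> edge x y}.
Hypotheses (B_gt0 : (0 < #|~: U|)%N) (B_eq : #|~: W| = #|~: U|).
Hypotheses (M_gt0 : (0 < M)%N) (U_le : (#|U| <= M)%N) (W_le : (#|W| <= M)%N).
Hypothesis d_le : forall x, x \in U -> (deg_in (~: U) x <= M)%N.
Hypothesis d_le' : forall x, x \in W -> (deg_in (~: W) x <= M)%N.

(** Both graphs have a clique of the same size N, and (r + 1) (r + 1 - N)
    increases with r for r >= N - 1; so r' <= r passes to the expansions, which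
    are compared by [expansion_lex]. The error 19 M^9 / r also bounds the
    coefficients, and 76 = 4 * 19. *)
Lemma compare_invariants :
    76 * M%:R ^+ 9 < r' -> #|~: U|%:R - 1 <= r' -> r' <= r ->
  [/\ (inv1 U <= inv1 W)%N -> inv1 U = inv1 W,
      inv1 U = inv1 W -> (inv2 U <= inv2 W)%N -> inv2 U = inv2 W
    & inv1 U = inv1 W -> inv2 U = inv2 W -> inv3 U = inv3 W -> (inv4 W <= inv4 U)%N].
Proof.
move=> r'_big r'_ge r'r; set N : R := #|~: U|%:R in r'_ge.
have m_ge1 : 1 <= M%:R :> R by rewrite ler1n.
have pow_le i j : (i <= j)%N -> M%:R ^+ i <= M%:R ^+ j :> R by apply: ler_weXn2l.
have m9_ge1 : 1 <= M%:R ^+ 9 :> R by have := pow_le 0 9 isT; rewrite expr0.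
have m29 := pow_le 2 9 isT; have m79 := pow_le 7 9 isT.
have r'_gt0 : 0 < r' by lra.
have B'_gt0 : (0 < #|~: W|)%N by rewrite B_eq.
have r'_ge4 : 4 * M%:R ^+ 2 <= r' by lra.
have r_ge4 : 4 * M%:R ^+ 2 <= r by lra.
have := perron_expansion pp' clique' B'_gt0 M_gt0 W_le d_le' r'_ge4.
rewrite B_eq -/N => /andP[lo _].
have /andP[_ up] := perron_expansion pp clique B_gt0 M_gt0 U_le d_le r_ge4.
rewrite -/N in up.
have [b2 b3 b4] := inv_le M_gt0 U_le d_le.
have nat_le i : (i <= M ^ 7)%N -> i%:R <= 19 * M%:R ^+ 9 :> R.
  by rewrite -(ler_nat R) natrX; lra.
apply: (@expansion_lex R r (19 * M%:R ^+ 9)); rewrite ?nat_le //; try lra.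
apply: le_trans up.
have s_le : (r' + 1) * (r' + 1 - N) <= (r + 1) * (r + 1 - N) by apply: ler_pM; lra.
have := expansion_mono (inv1 W) (inv2 W) (inv3 W) (inv4 W) r'_gt0 r'r.
have r3_gt0 : 0 < r ^+ 3 by rewrite exprn_gt0 //; lra.
have r'3_gt0 : 0 < r' ^+ 3 by rewrite exprn_gt0.
move=> mono; rewrite -(ler_pM2l r'3_gt0); apply: le_trans mono _.
apply: (@le_trans _ _ (r ^+ 3 * (r' ^+ 3 * ((r' + 1) * (r' + 1 - N))))).
  by rewrite ler_pM2l.
by rewrite mulrCA ler_pM2l // ler_pM2l.
Qed.
End Compare.

(** * The extremal configuration *)

Section Extremal.
Variables (G : sgraph) (U : {set G}) (k h : nat).
Local Open Scope nat_scope.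
Hypotheses (U_card : #|U| = 2 * h + 2) (hk : h < k).
Local Notation a := (k - h - 1).
Local Notation d := (deg_in (~: U)).
Local Notation m := (codeg U).
Implicit Types x y b : G.

(** The neighbourhoods outside U of the vertices of U form a chain, ordered by
    size. *)
Definition nested := {in U &, forall x y, d x <= d y ->
  forall b, b \notin U -> edge x b -> edge y b}.

Lemma codegree_nested x y : x \in U -> y \in U -> nested -> d x <= d y ->
  codegree U x y = d x.
Proof.
move=> xU yU nst dxy; apply: eq_bigr => b; rewrite inE => bU.
case xb: (edge x b) => //; rewrite mul1n edge_sym.
by rewrite (nst x y xU yU dxy b bU xb).
Qed.

Lemma codegree_nested_min x y : x \in U -> y \in U -> nested ->
  codegree U x y = minn (d x) (d y).
Proof.
move=> xU yU nst; case: (leqP (d x) (d y)) => dxy; first exact: codegree_nested.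
by rewrite codegree_sym codegree_nested // ltnW.
Qed.

Lemma codegree_min x y : codegree U x y <= minn (d x) (d y).
Proof. by rewrite leq_min codegree_le codegree_sym codegree_le. Qed.

(** The number of common neighbours of x and y is at most min(d_x, d_y), and it
    reaches this value exactly when one neighbourhood contains the other. *)
Lemma nested_of_inv4 :
    \sum_(x in U) d x * \sum_(y in U) minn (d x) (d y) * d y <= inv4 U -> nested.
Proof.
move=> le x y xU yU dxy b bU xb.
have d_gt0 : 0 < d x by rewrite /deg_in (bigD1 b) ?inE //= xb.
have row z : z \in U -> d z * \sum_(w in U) codegree U z w * d w <=
    d z * \sum_(w in U) minn (d z) (d w) * d w.
  move=> zU; rewrite leq_mul2l; apply/orP; right; apply: leq_sum => w wU.
  by rewrite leq_mul2r codegree_min orbT.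
have /eqP := sum_le_eq row le xU; rewrite eqn_pmul2l // => /eqP E.
have row' w : w \in U -> codegree U x w * d w <= minn (d x) (d w) * d w.
  by move=> wU; rewrite leq_mul2r codegree_min orbT.
have /eqP := sum_le_eq row' (eq_leq (esym E)) yU.
rewrite eqn_pmul2r ?(leq_trans d_gt0) // (minn_idPl dxy) => /eqP cd.
have le' : \sum_(b in ~: U) edge x b <= \sum_(b in ~: U) edge x b * edge b y.
  by rewrite -/(d x) -cd.
have col b' : b' \in ~: U -> edge x b' * edge b' y <= edge x b'.
  by case: (edge x b') => //; case: edge.
have := sum_le_eq col le' (_ : b \in ~: U); rewrite inE bU xb mul1n edge_sym.
by move=> /(_ isT)/eqP; rewrite eqb1.
Qed.

Lemma costar_invariants c : costar U h c ->
    (forall x, x \in U -> d x = a + m x) -> nested ->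
  [/\ inv1 U = star_inv1 h a, inv2 U = star_inv2 h a,
      inv3 U = star_inv3 h a & inv4 U = star_inv4 h a].
Proof.
move=> star d_eq nst; split.
- exact: costar_level1 d_eq star.
- exact: costar_level2 d_eq star.
- exact: costar_level3 d_eq star.
rewrite -(costar_min_sum U_card d_eq star); apply: eq_bigr => x xU.
by congr (_ * _); apply: eq_bigr => y yU; rewrite codegree_nested_min.
Qed.

Section Budget.
Hypothesis deg_ge : forall x, x \in U -> k + h <= degree x.
Hypothesis touch_lt : touch U + 2 <= 2 * k * (2 * h + 2).
Let f x := d x - (a + m x).

Lemma deg_excess x : x \in U -> d x = a + m x + f x.
Proof.
move=> xU; rewrite /f subnKC //; have := deg_ge xU.
by rewrite (degree_split U); have := codeg_deg_in U_card xU; lia.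
Qed.

(** The sizes |U| and k being fixed, m and f determine the number of edges that
    touch U, and the bound on that number becomes this one. *)
Lemma excess_budget : codeg_sum U + 2 * (\sum_(x in U) f x) <= 2 * h.
Proof.
have tE : touch U = \sum_(x in U) deg_in U x + 2 * \sum_(x in U) d x.
  by rewrite /touch big_split /= big_distrr.
have gE : \sum_(x in U) deg_in U x + codeg_sum U = (2 * h + 2) * (2 * h + 1).
  rewrite -big_split -U_card -sum_nat_const; apply: eq_bigr => x xU.
  exact: (codeg_deg_in U_card xU).
have dE : \sum_(x in U) d x = (2 * h + 2) * a + codeg_sum U + \sum_(x in U) f x.
  rewrite -U_card -sum_nat_const -!big_split; apply: eq_bigr => x xU.
  exact: deg_excess.
move: touch_lt; rewrite tE dE; move: gE.
move: (\sum_(x in U) deg_in U x) (codeg_sum U) (\sum_(x in U) f x) => g q s.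
have [a' kE] : exists a', k = a' + h + 1 by exists a; lia.
rewrite kE; have -> : a' + h + 1 - h - 1 = a' by lia.
nia.
Qed.

Lemma extremal_structure :
    (inv1 U <= star_inv1 h a -> inv1 U = star_inv1 h a) ->
    (inv1 U = star_inv1 h a -> inv2 U <= star_inv2 h a -> inv2 U = star_inv2 h a) ->
    (inv1 U = star_inv1 h a -> inv2 U = star_inv2 h a -> inv3 U = star_inv3 h a ->
       star_inv4 h a <= inv4 U) ->
  exists c, [/\ costar U h c, forall x, x \in U -> d x = a + m x & nested].
Proof.
move=> H1 H2 H3.
have E1 := H1 (level1_le U_card deg_excess excess_budget).
have [QE f0 pair_sum] := level1_eq U_card deg_excess excess_budget E1.
have d_eq x : x \in U -> d x = a + m x by move=> xU; rewrite deg_excess // f0 ?addn0.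
have E2 := H2 E1 (level2_le U_card d_eq QE pair_sum E1).
have pair_prod := level2_eq U_card d_eq QE pair_sum E1 E2.
have [c star] := costar_exists U_card QE pair_sum pair_prod.
exists c; split=> //; apply: nested_of_inv4.
rewrite (costar_min_sum U_card d_eq star); apply: H3 => //.
exact: costar_level3 d_eq star.
Qed.
End Budget.
End Extremal.

(** * Nested neighbourhoods determine the graph *)

Section Ranking.
Variables (T : finType) (A : {set T}) (key : T -> nat).
Local Open Scope nat_scope.

(** Enumeration ranks break the ties of [key], so that [position] numbers
    the elements of A in the order of their keys. *)
Definition before (y x : T) : bool :=
  (key y < key x) || (key y == key x) && (enum_rank y < enum_rank x).
Definition position x := #|[set y in A | before y x]|.

Lemma before_irr x : before x x = false.
Proof. by rewrite /before !ltnn andbF. Qed.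

Lemma before_trans y x z : before x y -> before y z -> before x z.
Proof.
rewrite /before; case/orP=> [xy|/andP[/eqP -> xy]]; case/orP=> [yz|/andP[/eqP <- yz]].
- by rewrite (ltn_trans xy yz).
- by rewrite xy.
- by rewrite yz.
by rewrite eqxx (ltn_trans xy yz) orbT.
Qed.

Lemma before_total x y : x != y -> before x y || before y x.
Proof.
move=> xy; rewrite /before; case: (ltngtP (key x) (key y)) => //= _.
by rewrite -neq_ltn; apply: contra xy => /eqP/val_inj/enum_rank_inj ->.
Qed.

Lemma position_before x y : x \in A -> before x y -> position x < position y.
Proof.
move=> xA xy; apply/proper_card/properP; split.
  by apply/subsetP => z; rewrite !inE => /andP[-> /before_trans]; apply.
by exists x; rewrite !inE xA ?before_irr.
Qed.

Lemma position_inj : {in A &, injective position}.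
Proof.
move=> x y xA yA E; apply/eqP; apply: contraT => /before_total/orP[] lt.
  by have := position_before xA lt; rewrite E ltnn.
by have := position_before yA lt; rewrite E ltnn.
Qed.

Lemma position_lt x : x \in A -> position x < #|A|.
Proof.
move=> xA; apply/proper_card/properP; split; first by apply/subsetP => y; rewrite inE => /andP[].
by exists x; rewrite // inE before_irr andbF.
Qed.

(** Everything before an element of P lies in P, and all of P comes before an
    element outside it. *)
Lemma position_initial (P : pred T) :
    {in A &, forall x y, P x -> ~~ P y -> key x < key y} ->
  {in A, forall x, (position x < #|[set y in A | P y]|) = P x}.
Proof.
move=> Pkey x xA; case Px: (P x).
  apply/proper_card/properP; split; last by exists x; rewrite !inE xA ?Px // before_irr.
  apply/subsetP => y; rewrite !inE => /andP[yA yx]; rewrite yA /=.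
  apply: contraT => Py; have := Pkey x y xA yA Px Py; move: yx.
  by rewrite /before; case: ltngtP.
apply/negbTE; rewrite -leqNgt; apply/subset_leq_card/subsetP => y.
by rewrite !inE => /andP[yA Py]; rewrite yA /before Pkey ?Px.
Qed.
End Ranking.

Lemma MstarE h i j :
  Mstar h i j = ((i == 0) && (0 < j <= h) || (j == 0) && (0 < i <= h))%N.
Proof.
case: h => [|[|h]] //=; first by case: i j => [|i] [|j].
by case: i j => [|[|i]] [|[|j]].
Qed.

Lemma XYstarE h i y :
  XYstar h i y = ((i == 0) && (y < h) || (0 < i <= h) && (y == 0))%N.
Proof.
case: h => [|[|h]] //=; first by case: i y => [|i] [|y].
by case: i y => [|[|i]] [|[|y]].
Qed.

Section ThresholdIsomorphism.
Variables (G : sgraph) (U : {set G}) (h k n : nat) (c : G).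
Local Open Scope nat_scope.
Hypotheses (U_card : #|U| = 2 * h + 2) (G_card : #|G| = n).
Hypotheses (hk : h < k) (kn : k + h + 1 <= n).
Local Notation a := (k - h - 1).
Local Notation d := (deg_in (~: U)).
Local Notation m := (codeg U).
Hypothesis star : costar U h c.
Hypothesis d_eq : forall x, x \in U -> d x = a + m x.
Hypothesis nst : nested U.
Hypothesis clique : {in ~: U &, forall x y, x != y -> edge x y}.

Let keyU x := if x == c then 0 else if nonadj c x then 1 else 2.
Let keyB b := #|[set x in U | ~~ edge x b]|.
Let posU := position U keyU.
Let posB := position (~: U) keyB.

Let posU_center x : x \in U -> (posU x == 0) = (x == c).
Proof.
move=> xU; have [cU _ _ _] := star.
have := position_initial (A := U) (key := keyU) (P := pred1 c) _ xU.
rewrite (_ : #|[set y in U | pred1 c y]| = 1) => [|].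
  rewrite ltnS leqn0 => -> // y z yU zU /=; rewrite /keyU => /eqP -> /negbTE ->.
  by rewrite eqxx; case: nonadj.
rewrite (_ : [set y in U | _] = [set c]) ?cards1 //.
by apply/setP => y; rewrite !inE; case: eqVneq => [->|]; rewrite ?cU // andbF.
Qed.

Let posU_leaf x : x \in U -> (0 < posU x <= h) = nonadj c x.
Proof.
move=> xU; have [cU mc _ _] := star.
rewrite lt0n posU_center //.
have := position_initial (A := U) (key := keyU) (P := fun y => (y == c) || nonadj c y) _ xU.
rewrite (_ : #|[set y in U | _]| = h.+1) => [|].
  rewrite ltnS => -> /=.
    by case: eqVneq => //= ->; rewrite nonadj_irr.
  move=> y z yU zU; rewrite /keyU => Py; rewrite negb_or => /andP[/negbTE -> /negbTE ->].
  by case/orP: Py => [->//|->]; case: eqP.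
rewrite (_ : [set y in U | _] = c |: [set y in U | nonadj c y]); last first.
  apply/setP => y; rewrite !inE; case: eqVneq => [->|_] //=; rewrite cU.
  by [].
rewrite cardsU1 !inE nonadj_irr andbF add1n; congr _.+1.
rewrite -mc /codeg -sum1dep_card [LHS]big_mkcondr; apply: eq_bigr => y _.
by case: nonadj.
Qed.

Let posB_edge x b : x \in U -> b \notin U -> edge x b = (posB b < d x).
Proof.
move=> xU bU; have bB : b \in ~: U by rewrite inE.
have <- := position_initial (A := ~: U) (key := keyB) (P := edge x) _ bB.
  by rewrite deg_in_card.
move=> b1 b2; rewrite !inE => b1U b2U xb1 xb2.
apply/proper_card/properP; split.
  apply/subsetP => z; rewrite !inE => /andP[zU zb1]; rewrite zU /=.
  apply: contra zb1 => zb2; case: (leqP (d z) (d x)) => [dzx|/ltnW dxz].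
    by rewrite (nst zU xU dzx b2U zb2) in xb2.
  exact: nst xU zU dxz _ b1U xb1.
by exists x; rewrite !inE xU // xb1.
Qed.

Let place x (v : star_vertex h k n) : bool :=
  match v with
  | inl (inl i) => (x \in U) && (posU x == i)
  | inl (inr w) => (x \notin U) && (posB x == w)
  | inr y => (x \notin U) && (posB x == a + y)
  end.

Let B_card : #|~: U| = n - 2 * h - 2.
Proof. by have := cardsC U; rewrite U_card G_card; lia. Qed.

Let place_exists x : exists v, place x v.
Proof.
case: (boolP (x \in U)) => xU.
  have lt : posU x < 2 * h + 2 by rewrite -U_card; apply: position_lt.
  by exists (inl (inl (Ordinal lt))); rewrite /= xU eqxx.
have lt : posB x < n - 2 * h - 2 by rewrite -B_card; apply: position_lt; rewrite inE.
case: (ltnP (posB x) a) => xa.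
  by exists (inl (inr (Ordinal xa))); rewrite /= xU eqxx.
have lt' : posB x - a < n - k - h - 1 by lia.
by exists (inr (Ordinal lt')); rewrite /= xU subnKC // eqxx.
Qed.

Let place_inj x y v : place x v -> place y v -> x = y.
Proof.
case: v => [[i|w]|v] /andP[xU /eqP px] /andP[yU /eqP py].
- by apply: (@position_inj _ U keyU x y xU yU); rewrite [LHS]px [RHS]py.
- by apply: (@position_inj _ (~: U) keyB); rewrite ?inE // [LHS]px [RHS]py.
by apply: (@position_inj _ (~: U) keyB); rewrite ?inE // [LHS]px [RHS]py.
Qed.

(** Number U with the centre first and the leaves next, and number the clique by
    decreasing number of neighbours in U. As neighbourhoods are nested, x in U is
    adjacent exactly to the first d_x vertices of the clique, which is how G* is
    defined. *)
Lemma threshold_isomorphic : isomorphic G (Gstar h k n).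
Proof.
have [f fP] := fin_all_exists place_exists.
have f_inj : injective f.
  by move=> x y E; apply: (@place_inj x y (f y)); rewrite // -E.
exists f.
  apply: inj_card_bij f_inj _; rewrite G_card !card_sum !card_ord; lia.
have f_neq x y : (f x != f y) = (x != y) by rewrite (inj_eq f_inj).
have outer x y : x \notin U -> y \notin U -> edge x y = (f x != f y).
  move=> xU yU; rewrite f_neq; case: eqVneq => [->|xy]; first by rewrite edge_irr.
  by rewrite clique // inE.
have mixed_W x b i w : f x = inl (inl i) -> f b = inl (inr w) -> edge x b.
  move=> fx fb; have := fP x; rewrite fx => /andP[xU _].
  have := fP b; rewrite fb => /andP[bU /eqP pb].
  by rewrite posB_edge // pb d_eq // ltn_addr.
have mixed_Y x b i y : f x = inl (inl i) -> f b = inr y -> edge x b = XYstar h i y.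
  move=> fx fb; have := fP x; rewrite fx => /andP[xU /eqP pi].
  have := fP b; rewrite fb => /andP[bU /eqP pb].
  rewrite posB_edge // pb d_eq // ltn_add2l XYstarE -pi posU_center // posU_leaf //.
  have [cU mc m_nonadj _] := star.
  case: eqVneq => [->|xc]; first by rewrite mc nonadj_irr /= orbF.
  by rewrite m_nonadj //=; case: nonadj => //; rewrite ltnS leqn0.
move=> x y; change (star_edge (f x) (f y) = edge x y).
have := fP x; have := fP y.
case fx: (f x) => [[i|w]|v]; case fy: (f y) => [[j|w']|v'] /andP[yU py] /andP[xU px].
- rewrite /= -val_eqE /= -(eqP px) -(eqP py) MstarE.
  have -> : (posU x == posU y) = (x == y) := inj_in_eq (@position_inj _ U keyU) xU yU.
  rewrite !posU_center // !posU_leaf //.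
  have := edge_nonadj x y; have [_ _ _ only] := star.
  case: (eqVneq x y) => [->|xy]; first by rewrite edge_irr.
  have -> : (x == c) && nonadj c y || (y == c) && nonadj c x = nonadj x y.
    apply/idP/idP; first by case/orP=> /andP[/eqP -> //]; rewrite nonadj_sym.
    move=> Nxy; have [E|E] := only x y xU yU Nxy.
      by rewrite -E eqxx Nxy.
    by rewrite -E eqxx nonadj_sym Nxy orbT.
  by case: edge; case: nonadj.
- by rewrite /= (mixed_W x y i w').
- by rewrite /= (mixed_Y x y i v').
- by rewrite /= edge_sym (mixed_W y x j w).
- by rewrite (outer x y xU yU) fx fy.
- by rewrite (outer x y xU yU) fx fy.
- by rewrite /= edge_sym (mixed_Y y x j v).
- by rewrite (outer x y xU yU) fx fy.
by rewrite (outer x y xU yU) fx fy.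
Qed.
End ThresholdIsomorphism.

(** * The graph G* *)

Lemma min_degree_le (G : sgraph) (x : G) : (min_degree G <= degree x)%N.
Proof.
rewrite /min_degree; elim: (index_enum _) (mem_index_enum x) => // y s IHs.
rewrite in_cons big_cons => /predU1P[<-|/IHs]; first exact: geq_minl.
by apply: leq_trans; apply: geq_minr.
Qed.

Lemma sum_ltn_ord N m : (m <= N)%N -> (\sum_(y < N) (y < m) = m)%N.
Proof.
move=> mN; rewrite -big_mkcond -(big_ord_widen N (fun=> 1)%N mN).
by rewrite sum_nat_const card_ord muln1.
Qed.

Section StarGraph.
Variables (h k n : nat).
Local Open Scope nat_scope.
Hypotheses (hk : h < k) (k_ge2 : 2 <= k) (n_big : 2 * k + 4 * h + 4 <= n).
Local Notation a := (k - h - 1).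
Local Notation S := (Gstar h k n).

Definition star_core : {set S} :=
  [set x : S | if x is inl (inl _) then true else false].
Local Notation U := star_core.

(** The number of missing edges at the i-th vertex of X, which is also its number
    of neighbours in Y. Vertex 0 is the centre and 1, ..., h are the leaves; this
    covers h = 0 and h = 1 as well, by [MstarE] and [XYstarE]. *)
Definition star_codeg i : nat := if i == 0 then h else i <= h.

Local Notation X i := (inl (inl i) : S).
Local Notation Wv w := (inl (inr w) : S).
Local Notation Yv y := (inr y : S).

Lemma star_sum (F : S -> nat) : \sum_x F x =
  \sum_i F (X i) + \sum_w F (Wv w) + \sum_y F (Yv y).
Proof. by rewrite big_sumType big_sumType. Qed.

Lemma star_core_sum (F : S -> nat) : \sum_(x in U) F x = \sum_i F (X i).
Proof.
rewrite big_mkcond star_sum /=; transitivity (\sum_i F (X i) + 0 + 0); last by rewrite !addn0.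
by congr (_ + _ + _); [apply: eq_bigr|apply: big1|apply: big1] => v _; rewrite inE.
Qed.

Lemma star_outer_sum (F : S -> nat) :
  \sum_(x in ~: U) F x = \sum_w F (Wv w) + \sum_y F (Yv y).
Proof.
rewrite big_mkcond star_sum /= -[RHS]add0n addnA.
by congr (_ + _ + _); [apply: big1|apply: eq_bigr|apply: eq_bigr] => v _; rewrite !inE.
Qed.

Lemma star_card : #|S| = n.
Proof. by rewrite !card_sum !card_ord; lia. Qed.

Lemma star_core_card : #|U| = 2 * h + 2.
Proof. by rewrite -sum1_card star_core_sum sum_nat_const card_ord muln1. Qed.

Lemma star_outer_card : #|~: U| = n - 2 * h - 2.
Proof. by have := cardsC U; rewrite star_core_card star_card; lia. Qed.

Lemma star_coreP x : x \in U -> exists i, x = X i.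
Proof. by rewrite inE; case: x => [[i|]|] // _; exists i. Qed.

Lemma XYstar_codeg i y : XYstar h i y = (y < star_codeg i).
Proof.
rewrite XYstarE /star_codeg; case: i => [|i] /=; first by rewrite orbF.
by case: (i < h); rewrite ?ltnS ?leqn0.
Qed.

Lemma star_codeg_le i : star_codeg i <= h.
Proof.
rewrite /star_codeg; case: i => //= i.
by case: (ltnP i h) => // /(leq_ltn_trans _); apply.
Qed.

Lemma star_deg i : deg_in (~: U) (X i) = a + star_codeg i.
Proof.
rewrite /deg_in star_outer_sum sum_nat_const card_ord muln1; congr (_ + _).
rewrite -[RHS](@sum_ltn_ord (n - k - h - 1)); last first.
  by have := star_codeg_le i; lia.
by apply: eq_bigr => y _; rewrite -XYstar_codeg.
Qed.

Lemma star_nonadj i j : nonadj (X i) (X j) = Mstar h i j.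
Proof.
rewrite /nonadj /= -[X i == X j]/(i == j) MstarE.
case: eqVneq => [->|_] /=; last by rewrite negbK.
by case: (val j) => [|j'] //=; rewrite andbF.
Qed.

Lemma star_codegE i : codeg U (X i) = star_codeg i.
Proof.
rewrite /codeg star_core_sum /star_codeg; under eq_bigr do rewrite star_nonadj MstarE.
move: (nat_of_ord i) => {}i; rewrite addn2 big_ord_recl /=; case: eqP => [->|/eqP i0] /=.
  rewrite -[RHS](@sum_ltn_ord (2 * h).+1); last by lia.
  by apply: eq_bigr => j _; rewrite /= orbF.
by rewrite lt0n i0 big1 ?addn0.
Qed.

Lemma star_core_deg x : x \in U -> deg_in (~: U) x = a + codeg U x.
Proof. by case/star_coreP=> i ->; rewrite star_deg star_codegE. Qed.

Lemma star_nested : nested U.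
Proof.
move=> x y /star_coreP[i ->] /star_coreP[j ->]; rewrite !star_deg leq_add2l => le.
case=> [[l|w]|v] //; first by rewrite inE.
by rewrite /= !XYstar_codeg => _ /leq_trans; apply.
Qed.

Lemma star_clique : {in ~: U &, forall x y, x != y -> edge x y}.
Proof. by case=> [[i|w]|v] [[j|w']|v']; rewrite !inE. Qed.

Lemma star_costar : exists c, costar U h c.
Proof.
have lt0 : 0 < 2 * h + 2 by lia.
exists (X (Ordinal lt0)); split.
- by rewrite inE.
- by rewrite star_codegE.
- move=> _ /star_coreP[i ->] iN0; rewrite star_codegE star_nonadj MstarE.
  have /negbTE i0 : i != 0 :> nat.
    by apply: contra iN0 => /eqP i0; apply/eqP; congr (inl (inl _)); apply: val_inj.
  by rewrite /star_codeg i0 /= orbF lt0n i0.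
move=> _ _ /star_coreP[i ->] /star_coreP[j ->]; rewrite star_nonadj MstarE.
by case/orP=> /andP[/eqP E _]; [left|right]; congr (inl (inl _)); apply: val_inj.
Qed.

(** The edges that touch X are one short of k |X|, so they cannot serve k
    edge-disjoint spanning trees, see [star_tau]. *)
Lemma star_touch : touch U + 2 = 2 * k * (2 * h + 2).
Proof.
have [c star] := star_costar.
have Q_eq := costar_sum star_core_card star.
have tE : touch U = \sum_(x in U) deg_in U x + 2 * \sum_(x in U) deg_in (~: U) x.
  by rewrite /touch big_split /= big_distrr.
have gE : \sum_(x in U) deg_in U x + codeg_sum U = (2 * h + 2) * (2 * h + 1).
  rewrite -big_split -{1}star_core_card -sum_nat_const; apply: eq_bigr => x xU.
  exact: (codeg_deg_in star_core_card xU).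
have dE : \sum_(x in U) deg_in (~: U) x = (2 * h + 2) * a + codeg_sum U.
  rewrite -{1}star_core_card -sum_nat_const -!big_split; apply: eq_bigr => x xU.
  exact: star_core_deg.
rewrite tE dE Q_eq; rewrite Q_eq in gE.
by have [a' kE] : exists a', k = a' + h + 1 by [exists a; lia]; nia.
Qed.

Lemma star_core_degree x : x \in U -> degree x = k + h.
Proof.
move=> xU; rewrite (degree_split U) star_core_deg //.
by have := codeg_deg_in star_core_card xU; lia.
Qed.

Lemma star_outer_degree x : x \notin U -> k + h <= degree x.
Proof.
move=> xU; apply: (@leq_trans #|~: U :\ x|).
  by have := cardsD1 x (~: U); rewrite star_outer_card inE xU; lia.
apply/subset_leq_card/subsetP => y; rewrite in_setD1 => /andP[yx yU].
suff : edge x y by rewrite inE.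
by apply: star_clique; rewrite // ?in_setC // eq_sym.
Qed.

Lemma star_degree (x : S) : k + h <= degree x.
Proof. by case: (boolP (x \in U)) => xU; [rewrite star_core_degree | apply: star_outer_degree]. Qed.

Lemma star_min_degree : min_degree S = k + h.
Proof.
have lt0 : 0 < 2 * h + 2 by lia.
apply/eqP; rewrite eqn_leq; apply/andP; split.
  by rewrite -(@star_core_degree (X (Ordinal lt0))) ?inE // min_degree_le.
rewrite /min_degree; apply: (big_ind (fun t => k + h <= t)) => [|p q|x _].
  by rewrite star_card; lia.
  by rewrite leq_min => -> ->.
exact: star_degree.
Qed.

Lemma star_connected : connected_rel (@edge S).
Proof.
have ltY : 0 < n - k - h - 1 by lia.
have ltX : 0 < 2 * h + 2 by lia.
pose y0 : S := Yv (Ordinal ltY).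
have outer x : x \notin U -> connect (@edge S) x y0.
  move=> xU; have [->|xy] := eqVneq x y0; first exact: connect0.
  have y0U : y0 \in ~: U by rewrite !inE.
  by apply/connect1/star_clique; rewrite // in_setC.
have to_y0 x : connect (@edge S) x y0.
  case: (boolP (x \in U)) => [/star_coreP[i ->]|]; last exact: outer.
  have [h0|h_gt0] := posnP h.
    have lta : 0 < a by lia.
    apply: (@connect_trans _ _ (Wv (Ordinal lta))); first exact: connect1.
    by apply: outer; rewrite inE.
  have c_y0 : edge (X (Ordinal ltX)) y0 by rewrite /= XYstar_codeg.
  have [i_le|i_gt] := leqP i h.
    by apply: connect1; rewrite /= XYstar_codeg /star_codeg /= i_le; case: eqP.
  apply: (connect_trans (y := X (Ordinal ltX))); last exact: connect1.
  apply: connect1; rewrite /= MstarE -val_eqE /=.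
  by rewrite (leqNgt i h) i_gt !andbF /= -lt0n (leq_ltn_trans _ i_gt).
apply/forallP => x; apply/forallP => y; apply: connect_trans (to_y0 x) _.
by rewrite (sym_connect_sym (@edge_sym S)).
Qed.

Lemma star_tau : tau S < k.
Proof.
have ltY : 0 < n - k - h - 1 by lia.
apply: (@tau_lt_touch S U (Yv (Ordinal ltY))); first by rewrite inE.
by rewrite star_core_card -star_touch; lia.
Qed.

Lemma star_class : graph_class n (k + h) S.
Proof. split; [exact: star_connected | exact: star_card | exact: star_min_degree]. Qed.
End StarGraph.

(** * The quotient matrices of G* *)

(** A cell without vertices is dropped together with its row and column. *)
Lemma equitable_del_radius (C : numClosedFieldType) (G : sgraph) m
    (Q : 'M[C]_m.+1) (cell : G -> 'I_m.+1) (i0 : 'I_m.+1) :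
    (0 < #|G|)%N -> connected_rel (@edge G) ->
    (forall x, cell x != i0) ->
    (forall i, i != i0 -> exists x, cell x = i) ->
    (forall x i, (\sum_(y | cell y == i) edge x y)%:R = Q (cell x) i) ->
  spectral_radius (del_row_col i0 Q : 'M[C]_m) = rho C G.
Proof.
move=> G_gt0 conn cell_i0 cell_surj QE.
have cellP x : exists i, cell x == lift i0 i.
  by case: (unliftP i0 (cell x)) => [i ->|E]; [exists i | move: (cell_i0 x); rewrite E eqxx].
pose cell' x := xchoose (cellP x).
have cellE x : cell x = lift i0 (cell' x) := eqP (xchooseP (cellP x)).
apply: (equitable_quotient_radius (cell := cell')) => // [i|x i].
  have i_neq : lift i0 i != i0 by rewrite eq_sym neq_lift.
  have [x xi] := cell_surj _ i_neq.
  by exists x; apply: (@lift_inj _ i0); rewrite -cellE.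
rewrite !mxE -cellE -QE; congr _%:R; apply: eq_bigl => y.
by rewrite cellE (inj_eq (@lift_inj _ i0)).
Qed.

Lemma sum_range_but N l u e (P : nat -> bool) :
    (l <= u <= N)%N ->
    (forall j, (j < N)%N -> P j = (l <= j < u)%N && (j != e)) ->
  (\sum_(j < N) P j = (u - l) - (l <= e < u))%N.
Proof.
move=> /andP[lu uN] PE.
have range_sum : (\sum_(j < N) (l <= j < u) = u - l)%N.
  have : (\sum_(j < N) (l <= j < u) + \sum_(j < N) (j < l) = \sum_(j < N) (j < u))%N.
    rewrite -big_split; apply: eq_bigr => j _ /=.
    by case: (leqP l j) => /=; lia.
  by rewrite !sum_ltn_ord //; [lia | apply: leq_trans uN].
have point_sum : (\sum_(j < N) ((l <= j < u) && (j == e :> nat)) = (l <= e < u))%N.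
  case: (ltnP e N) => eN; last first.
    rewrite big1; first by lia.
    by move=> j _; have := ltn_ord j; lia.
  rewrite (bigD1 (Ordinal eN)) //= eqxx andbT big1 ?addn0 // => j.
  by rewrite -val_eqE /= => /negbTE ->; rewrite andbF.
have : (\sum_(j < N) P j + \sum_(j < N) ((l <= j < u) && (j == e :> nat))
      = \sum_(j < N) (l <= j < u))%N.
  rewrite -big_split; apply: eq_bigr => j _ /=; rewrite PE //.
  by case: (l <= j < u)%N => //=; case: eqP.
by rewrite range_sum point_sum; lia.
Qed.

(** Cells of G* are given by functions of the index in X and in Y, and by one
    value on W. In all partitions below, the neighbours of a vertex in a cell form
    an interval of indices, from which one index e, that of the vertex itself, may
    have to be removed; an e outside the interval removes nothing. *)
Section StarCells.
Variables (h k n m : nat) (cX : nat -> nat) (cW : nat) (cY : nat -> nat).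
Local Open Scope nat_scope.
Hypotheses (cX_le : forall j, cX j <= m) (cW_le : cW <= m) (cY_le : forall j, cY j <= m).
Local Notation a := (k - h - 1).
Local Notation b := (n - k - h - 1).
Local Notation S := (Gstar h k n).
Local Notation X i := (inl (inl i) : S).
Local Notation Wv w := (inl (inr w) : S).
Local Notation Yv y := (inr y : S).

Definition star_cell_nat (v : S) : nat :=
  match v with inl (inl i) => cX i | inl (inr _) => cW | inr y => cY y end.
Definition star_cell (v : S) : 'I_m.+1 := inord (star_cell_nat v).

Lemma star_cell_val v : star_cell v = star_cell_nat v :> nat.
Proof. by rewrite inordK // ltnS; case: v => [[i|w]|y] /=. Qed.

Lemma star_cell_split v (i : 'I_m.+1) :
  \sum_(y | star_cell y == i) edge v y =
    \sum_(j < 2 * h + 2) ((cX j == i) && edge v (X j)) +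
    \sum_(w < a) ((cW == i) && edge v (Wv w)) +
    \sum_(y < b) ((cY y == i) && edge v (Yv y)).
Proof.
rewrite big_mkcond star_sum; congr (_ + _ + _); apply: eq_bigr => j _;
by rewrite -val_eqE /= star_cell_val /=; case: eqP.
Qed.

Lemma star_count_X (v : 'I_(2 * h + 2)) (i : 'I_m.+1) lx ux ex ly uy ey :
    lx <= ux <= 2 * h + 2 -> ly <= uy <= b ->
    (forall j, j < 2 * h + 2 -> (cX j == i) && ((v != j :> nat) && ~~ Mstar h v j)
       = (lx <= j < ux) && (j != ex)) ->
    (forall j, j < b -> (cY j == i) && XYstar h v j = (ly <= j < uy) && (j != ey)) ->
  \sum_(y | star_cell y == i) edge (X v) y =
    (ux - lx - (lx <= ex < ux)) + a * (cW == i) + (uy - ly - (ly <= ey < uy)).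
Proof.
move=> bx by_ PX PY; rewrite star_cell_split; congr (_ + _ + _).
- rewrite -(@sum_range_but (2 * h + 2) lx ux ex
    (fun j => (cX j == i) && ((v != j :> nat) && ~~ Mstar h v j))) //.
- by under eq_bigr do rewrite /= andbT; rewrite sum_nat_const card_ord.
by rewrite -(@sum_range_but b ly uy ey (fun j => (cY j == i) && XYstar h v j)).
Qed.

Lemma star_count_W (v : 'I_a) (i : 'I_m.+1) lx ux ly uy :
    lx <= ux <= 2 * h + 2 -> ly <= uy <= b ->
    (forall j, j < 2 * h + 2 -> (cX j == i) = (lx <= j < ux)) ->
    (forall j, j < b -> (cY j == i) = (ly <= j < uy)) ->
  \sum_(y | star_cell y == i) edge (Wv v) y =
    (ux - lx) + (a - 1) * (cW == i) + (uy - ly).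
Proof.
move=> bx by_ PX PY; rewrite star_cell_split; congr (_ + _ + _).
- rewrite (eq_bigr (fun j : 'I_(2 * h + 2) => nat_of_bool (cX j == i))) => [|j _];
    last by rewrite andbT.
  rewrite (@sum_range_but (2 * h + 2) lx ux (2 * h + 2) (fun j => cX j == i)) //; first by lia.
  by move=> j jN; rewrite PX // -[LHS]andbT; congr (_ && _); lia.
- case: (cW == i) => /=; last by rewrite muln0 big1.
  rewrite (@sum_range_but a 0 a v (fun w => val v != w)) ?leqnn //.
    by rewrite ltn_ord; lia.
  by move=> j ja; rewrite ja /= eq_sym.
rewrite (eq_bigr (fun j : 'I_b => nat_of_bool (cY j == i))) => [|j _]; last by rewrite andbT.
rewrite (@sum_range_but b ly uy b (fun j => cY j == i)) //; first by lia.
by move=> j jN; rewrite PY // -[LHS]andbT; congr (_ && _); lia.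
Qed.

Lemma star_count_Y (v : 'I_b) (i : 'I_m.+1) lx ux ly uy ey :
    lx <= ux <= 2 * h + 2 -> ly <= uy <= b ->
    (forall j, j < 2 * h + 2 -> (cX j == i) && XYstar h j v = (lx <= j < ux)) ->
    (forall j, j < b -> (cY j == i) && (v != j :> nat) = (ly <= j < uy) && (j != ey)) ->
  \sum_(y | star_cell y == i) edge (Yv v) y =
    (ux - lx) + a * (cW == i) + (uy - ly - (ly <= ey < uy)).
Proof.
move=> bx by_ PX PY; rewrite star_cell_split; congr (_ + _ + _).
- rewrite (@sum_range_but (2 * h + 2) lx ux (2 * h + 2) (fun j => (cX j == i) && XYstar h j v)) //.
    by lia.
  by move=> j jN; rewrite PX // -[LHS]andbT; congr (_ && _); lia.
- by under eq_bigr do rewrite /= andbT; rewrite sum_nat_const card_ord.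
by rewrite -(@sum_range_but b ly uy ey (fun j => (cY j == i) && (v != j :> nat))).
Qed.
End StarCells.

(** The three matrices are checked entry by entry. An entry is given by the
    interval [lx, ux) of neighbours in X without ex, the interval [ly, uy) of
    neighbours in Y without ey, and its value t in the additive parameters. *)
Ltac star_range :=
  let j := fresh in let j_lt := fresh in
  move=> j j_lt /=; rewrite ?MstarE ?XYstarE /=;
  by lia.

Ltac star_entry t :=
  let E := fresh in
  match goal with |- (?e%:R = _)%R => have E : e = t by rewrite /=; lia end;
  rewrite E {E} /= ?natrD ?mulnS ?mulSn ?muln0 ?natrD; by ring.

Section QuotientCases.
Variable C : numClosedFieldType.
Local Open Scope nat_scope.

Section CaseZero.
Variables (p q : nat).
Local Notation k := (p + 2).
Local Notation n := (q + 1 + k + 1).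
Hypothesis n_big : 2 * k + 4 * 0 + 4 <= n.
Local Notation cell := (@star_cell 0 k n 2 (fun=> 0) 1 (fun=> 2)).

Ltac entryX lx ux ex ly uy ey t :=
  rewrite (@star_count_X 0 k n 2 (fun=> 0) 1 (fun=> 2) _ _ _ _ _ lx ux ex ly uy ey);
  [ star_entry t | by [] | by [] | by [] | by lia | by lia | star_range | star_range ].
Ltac entryW lx ux ly uy t :=
  rewrite (@star_count_W 0 k n 2 (fun=> 0) 1 (fun=> 2) _ _ _ _ _ lx ux ly uy);
  [ star_entry t | by [] | by [] | by [] | by lia | by lia | star_range | star_range ].
Ltac entryY lx ux ly uy ey t :=
  rewrite (@star_count_Y 0 k n 2 (fun=> 0) 1 (fun=> 2) _ _ _ _ _ lx ux ly uy ey);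
  [ star_entry t | by [] | by [] | by [] | by lia | by lia | star_range | star_range ].

Lemma star_quotient0 : rho C (Gstar 0 k n) = spectral_radius (Q0 C k n).
Proof.
have k_ge2 : 2 <= k by lia.
have k_gt0 : 0 < k by lia.
symmetry; apply: (equitable_quotient_radius (cell := cell)).
- by rewrite (star_card k_gt0 k_ge2 n_big); lia.
- exact: star_connected.
- have ltW : 0 < k - 0 - 1 by lia.
  have ltY : 0 < n - k - 0 - 1 by lia.
  case=> -[|[|[|//]]] lt_i.
  + by exists (inl (inl ord0)); apply/val_inj; rewrite /= star_cell_val.
  + by exists (inl (inr (Ordinal ltW))); apply/val_inj; rewrite /= star_cell_val.
  + by exists (inr (Ordinal ltY)); apply/val_inj; rewrite /= star_cell_val.
move=> x i; rewrite mxE star_cell_val // /star_cell_nat.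
case: x => [[v|v]|v]; have v_lt := ltn_ord v; case: i => -[|[|[|//]]] lt_i.
- entryX 0 2 v 0 0 0 1.
- entryX 0 0 0 0 0 0 p.+1.
- entryX 0 0 0 0 0 0 0.
- entryW 0 2 0 0 2.
- entryW 0 0 0 0 p.
- entryW 0 0 0 q.+1 q.+1.
- entryY 0 0 0 0 0 0.
- entryY 0 0 0 0 0 p.+1.
- entryY 0 0 0 q.+1 v q.
Qed.
End CaseZero.

Ltac star_entryB t :=
  let E := fresh in
  match goal with |- (?e%:R = _)%R => have E : e = t by rewrite /=; lia end;
  rewrite E {E} /= ?natrD natrB; [by ring | by lia].

Section CaseOne.
Variables (p q : nat).
Local Notation k := (p + 2).
Local Notation n := (q + 1 + k + 3).
Hypothesis n_big : 2 * k + 4 * 1 + 4 <= n.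
Local Notation cX := (fun j => nat_of_bool (1 < j)).
Local Notation cY := (fun j => 3 + (0 < j)).
Local Notation cell := (@star_cell 1 k n 4 cX 2 cY).

Let cX_le j : cX j <= 4. Proof. by rewrite /=; lia. Qed.
Let cY_le j : cY j <= 4. Proof. by rewrite /=; lia. Qed.
Let k_ge2 : 2 <= k. Proof. by lia. Qed.
Let k_gt1 : 1 < k. Proof. by lia. Qed.

Ltac entryX lx ux ex ly uy ey t :=
  rewrite (@star_count_X 1 k n 4 cX 2 cY cX_le isT cY_le _ _ lx ux ex ly uy ey);
  [ star_entry t | by lia | by lia | star_range | star_range ].
Ltac entryW lx ux ly uy tac :=
  rewrite (@star_count_W 1 k n 4 cX 2 cY cX_le isT cY_le _ _ lx ux ly uy);
  [ tac | by lia | by lia | star_range | star_range ].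
Ltac entryY lx ux ly uy ey t :=
  rewrite (@star_count_Y 1 k n 4 cX 2 cY cX_le isT cY_le _ _ lx ux ly uy ey);
  [ star_entry t | by lia | by lia | star_range | star_range ].

Let count x i : ((\sum_(y | cell y == i) edge x y)%:R = Q1 C k n (cell x) i)%R.
Proof.
rewrite mxE star_cell_val // /star_cell_nat.
case: x => [[v|v]|v]; have v_lt := ltn_ord v.
- case: (ltnP 1 v) => v1; case: i => -[|[|[|[|[|//]]]]] lt_i.
  + entryX 0 2 4 0 0 0 2.
  + entryX 2 4 v 0 0 0 1.
  + entryX 0 0 0 0 0 0 p.
  + entryX 0 0 0 0 0 0 0.
  + entryX 0 0 0 0 0 0 0.
  + entryX 0 0 0 0 0 0 0.
  + entryX 2 4 0 0 0 0 2.
  + entryX 0 0 0 0 0 0 p.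
  + entryX 0 0 0 0 1 1 1.
  + entryX 0 0 0 0 0 0 0.
- case: i => -[|[|[|[|[|//]]]]] lt_i.
  + entryW 0 2 0 0 ltac:(star_entry 2).
  + entryW 2 4 0 0 ltac:(star_entry 2).
  + entryW 0 0 0 0 ltac:(star_entryB (p - 1)).
  + entryW 0 0 0 1 ltac:(star_entry 1).
  + entryW 0 0 1 q.+2 ltac:(star_entry q.+1).
case: (posnP v) => v0; case: i => -[|[|[|[|[|//]]]]] lt_i; rewrite ?v0.
- entryY 0 2 0 0 0 2.
- entryY 0 0 0 0 0 0.
- entryY 0 0 0 0 0 p.
- entryY 0 0 0 0 0 0.
- entryY 0 0 1 q.+2 0 q.+1.
- entryY 0 0 0 0 0 0.
- entryY 0 0 0 0 0 0.
- entryY 0 0 0 0 0 p.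
- entryY 0 0 0 1 1 1.
- entryY 0 0 1 q.+2 v q.
Qed.

Let reach i : i != inord 2 \/ 0 < p -> exists x, cell x = i.
Proof.
have ltY0 : 0 < n - k - 1 - 1 by lia.
have ltY1 : 1 < n - k - 1 - 1 by lia.
case: i => -[|[|[|[|[|//]]]]] lt_i h_i.
- by exists (inl (inl ord0)); apply/val_inj; rewrite /= star_cell_val.
- by exists (inl (inl ord_max)); apply/val_inj; rewrite /= star_cell_val.
- have lta : 0 < k - 1 - 1.
    by case: h_i => [|p0]; [rewrite -val_eqE /= inordK | lia].
  by exists (inl (inr (Ordinal lta))); apply/val_inj; rewrite /= star_cell_val.
- by exists (inr (Ordinal ltY0)); apply/val_inj; rewrite /= star_cell_val.
by exists (inr (Ordinal ltY1)); apply/val_inj; rewrite /= star_cell_val.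
Qed.

Lemma star_quotient1 : rho C (Gstar 1 k n) =
  if k == 2 then spectral_radius (del_row_col (inord 2) (Q1 C k n))
  else spectral_radius (Q1 C k n).
Proof.
have S_gt0 : 0 < #|Gstar 1 k n| by rewrite (star_card k_gt1 k_ge2 n_big); lia.
have conn := star_connected k_gt1 k_ge2 n_big.
symmetry; case: eqP => k2; last first.
  by apply: (equitable_quotient_radius (cell := cell)) => // i; apply: reach; right; lia.
apply: (equitable_del_radius (cell := cell)) => // [x|i i2]; last by apply: reach; left.
rewrite -val_eqE /= star_cell_val // inordK //.
by case: x => [[v|v]|v] /=; have := ltn_ord v; [case: (1 < v) | lia | case: (0 < v)].
Qed.
End CaseOne.

Section CaseMany.
Variables (g p q : nat).
Local Notation h := (g + 2).
Local Notation k := (p + h + 1).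
Local Notation n := (q + 1 + k + 2 * h + 1).
Hypothesis n_big : 2 * k + 4 * h + 4 <= n.
Local Notation cX := (fun j => (0 < j) + (h < j)).
Local Notation cY := (fun j => 4 + ((0 < j) + (h <= j))).
Local Notation cell := (@star_cell h k n 6 cX 3 cY).

Let cX_le j : cX j <= 6. Proof. by rewrite /=; lia. Qed.
Let cY_le j : cY j <= 6. Proof. by rewrite /=; lia. Qed.
Let k_ge2 : 2 <= k. Proof. by lia. Qed.
Let k_gth : h < k. Proof. by lia. Qed.

Ltac entryX lx ux ex ly uy ey t :=
  rewrite (@star_count_X h k n 6 cX 3 cY cX_le isT cY_le _ _ lx ux ex ly uy ey);
  [ star_entry t | by lia | by lia | star_range | star_range ].
Ltac entryW lx ux ly uy tac :=
  rewrite (@star_count_W h k n 6 cX 3 cY cX_le isT cY_le _ _ lx ux ly uy);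
  [ tac | by lia | by lia | star_range | star_range ].
Ltac entryY lx ux ly uy ey t :=
  rewrite (@star_count_Y h k n 6 cX 3 cY cX_le isT cY_le _ _ lx ux ly uy ey);
  [ star_entry t | by lia | by lia | star_range | star_range ].

Let countX (v : 'I_(2 * h + 2)) i (x : Gstar h k n := inl (inl v)) :
  ((\sum_(y | cell y == i) edge x y)%:R = Q2 C h k n (cell x) i)%R.
Proof.
rewrite /x mxE star_cell_val // /star_cell_nat; have v_lt := ltn_ord v.
case: (posnP v) => v0; [|case: (leqP v h) => vh];
  rewrite ?v0; case: i => -[|[|[|[|[|[|[|//]]]]]]] lt_i.
- entryX 0 0 0 0 0 0 0.
- entryX 0 0 0 0 0 0 0.
- entryX (h + 1) (2 * h + 2) 0 0 0 0 (g + 3).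
- entryX 0 0 0 0 0 0 p.
- entryX 0 0 0 0 1 1 1.
- entryX 0 0 0 1 (g + 2) 0 (g + 1).
- entryX 0 0 0 0 0 0 0.
- entryX 0 0 0 0 0 0 0.
- entryX 1 (h + 1) v 0 0 0 (g + 1).
- entryX (h + 1) (2 * h + 2) 0 0 0 0 (g + 3).
- entryX 0 0 0 0 0 0 p.
- entryX 0 0 0 0 1 1 1.
- entryX 0 0 0 0 0 0 0.
- entryX 0 0 0 0 0 0 0.
- entryX 0 1 1 0 0 0 1.
- entryX 1 (h + 1) 0 0 0 0 (g + 2).
- entryX (h + 1) (2 * h + 2) v 0 0 0 (g + 2).
- entryX 0 0 0 0 0 0 p.
- entryX 0 0 0 0 0 0 0.
- entryX 0 0 0 0 0 0 0.
- entryX 0 0 0 0 0 0 0.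
Qed.

Let countW (v : 'I_(k - h - 1)) i (x : Gstar h k n := inl (inr v)) :
  ((\sum_(y | cell y == i) edge x y)%:R = Q2 C h k n (cell x) i)%R.
Proof.
rewrite /x mxE star_cell_val // /star_cell_nat; have v_lt := ltn_ord v.
case: i => -[|[|[|[|[|[|[|//]]]]]]] lt_i.
- entryW 0 1 0 0 ltac:(star_entry 1).
- entryW 1 (h + 1) 0 0 ltac:(star_entry (g + 2)).
- entryW (h + 1) (2 * h + 2) 0 0 ltac:(star_entry (g + 3)).
- entryW 0 0 0 0 ltac:(star_entryB (p - 1)).
- entryW 0 0 0 1 ltac:(star_entry 1).
- entryW 0 0 1 (g + 2) ltac:(star_entry (g + 1)).
- entryW 0 0 (g + 2) (n - k - (h) - 1) ltac:(star_entry (q + 1)).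
Qed.

Let countY (v : 'I_(n - k - h - 1)) i (x : Gstar h k n := inr v) :
  ((\sum_(y | cell y == i) edge x y)%:R = Q2 C h k n (cell x) i)%R.
Proof.
rewrite /x mxE star_cell_val // /star_cell_nat; have v_lt := ltn_ord v.
case: (ltnP v h) => vh; [case: (posnP v) => v0|have v0 : 0 < v by lia];
  rewrite ?v0; case: i => -[|[|[|[|[|[|[|//]]]]]]] lt_i.
- entryY 0 1 0 0 0 1.
- entryY 1 (h + 1) 0 0 0 (g + 2).
- entryY 0 0 0 0 0 0.
- entryY 0 0 0 0 0 p.
- entryY 0 0 0 0 0 0.
- entryY 0 0 1 (g + 2) 0 (g + 1).
- entryY 0 0 (g + 2) (n - k - h - 1) 0 (q + 1).
- entryY 0 1 0 0 0 1.
- entryY 0 0 0 0 0 0.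
- entryY 0 0 0 0 0 0.
- entryY 0 0 0 0 0 p.
- entryY 0 0 0 1 1 1.
- entryY 0 0 1 (g + 2) v g.
- entryY 0 0 (g + 2) (n - k - h - 1) 0 (q + 1).
- entryY 0 0 0 0 0 0.
- entryY 0 0 0 0 0 0.
- entryY 0 0 0 0 0 0.
- entryY 0 0 0 0 0 p.
- entryY 0 0 0 1 1 1.
- entryY 0 0 1 (g + 2) 0 (g + 1).
- entryY 0 0 (g + 2) (n - k - h - 1) v q.
Qed.

Let count x i : ((\sum_(y | cell y == i) edge x y)%:R = Q2 C h k n (cell x) i)%R.
Proof. by case: x => [[v|v]|v]; [apply: countX|apply: countW|apply: countY]. Qed.

Let reach i : i != inord 3 \/ 0 < p -> exists x, cell x = i.
Proof.
have ltX0 : 0 < 2 * h + 2 by lia.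
have ltX1 : 1 < 2 * h + 2 by lia.
have ltX2 : h + 1 < 2 * h + 2 by lia.
have ltY0 : 0 < n - k - h - 1 by lia.
have ltY1 : 1 < n - k - h - 1 by lia.
have ltY2 : h < n - k - h - 1 by lia.
case: i => -[|[|[|[|[|[|[|//]]]]]]] lt_i h_i.
- by exists (inl (inl (Ordinal ltX0))); apply/val_inj; rewrite /= star_cell_val //=; lia.
- by exists (inl (inl (Ordinal ltX1))); apply/val_inj; rewrite /= star_cell_val //=; lia.
- by exists (inl (inl (Ordinal ltX2))); apply/val_inj; rewrite /= star_cell_val //=; lia.
- have lta : 0 < k - h - 1.
    by case: h_i => [|p0]; [rewrite -val_eqE /= inordK | lia].
  by exists (inl (inr (Ordinal lta))); apply/val_inj; rewrite /= star_cell_val.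
- by exists (inr (Ordinal ltY0)); apply/val_inj; rewrite /= star_cell_val //=; lia.
- by exists (inr (Ordinal ltY1)); apply/val_inj; rewrite /= star_cell_val //=; lia.
by exists (inr (Ordinal ltY2)); apply/val_inj; rewrite /= star_cell_val //=; lia.
Qed.

Lemma star_quotient2 : rho C (Gstar h k n) =
  if k == h.+1 then spectral_radius (del_row_col (inord 3) (Q2 C h k n))
  else spectral_radius (Q2 C h k n).
Proof.
have S_gt0 : 0 < #|Gstar h k n| by rewrite (star_card k_gth k_ge2 n_big); lia.
have conn := star_connected k_gth k_ge2 n_big.
symmetry; case: eqP => kh; last first.
  by apply: (equitable_quotient_radius (cell := cell)) => // i; apply: reach; right; lia.
apply: (equitable_del_radius (cell := cell)) => // [x|i i3]; last by apply: reach; left.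
rewrite -val_eqE /= star_cell_val // inordK //.
by case: x => [[v|v]|v] /=; have := ltn_ord v; lia.
Qed.
End CaseMany.

Lemma star_quotient h k n : h < k -> 2 <= k -> 2 * k + 4 * h + 4 <= n ->
  rho C (Gstar h k n) = rhoQ C h k n.
Proof.
case: h => [|[|g]] hk k_ge2 n_big.
- have [p kE] : exists p, k = p + 2 by exists (k - 2); lia.
  have [q nE] : exists q, n = q + 1 + k + 1 by exists (n - k - 2); lia.
  by subst k n; apply: star_quotient0.
- have [p kE] : exists p, k = p + 2 by exists (k - 2); lia.
  have [q nE] : exists q, n = q + 1 + k + 3 by exists (n - k - 4); lia.
  by subst k n; apply: star_quotient1.
have [p kE] : exists p, k = p + (g + 2) + 1 by exists (k - g - 3); lia.
have [q nE] : exists q, n = q + 1 + k + 2 * (g + 2) + 1 by exists (n - k - 2 * g - 6); lia.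
rewrite -[g.+2]addn2 in n_big *; subst k n; rewrite star_quotient2 //.
by rewrite addn2.
Qed.
End QuotientCases.

(** * The extremal graph *)

Lemma clique_perron_ge (C : numClosedFieldType) (G : sgraph) (U : {set G}) r p :
    @perron_pair C G r p -> (0 < #|~: U|)%N ->
    {in ~: U &, forall x y, x != y -> edge x y} ->
  #|~: U|%:R - 1 <= r.
Proof.
move=> pp B_gt0 clique; pose z x : real_of C := (x \notin U)%:R.
apply: (perron_test_ge pp (z := z)) => [x||x].
- by rewrite /z; case: (x \in U).
- by have /card_gt0P[x] := B_gt0; rewrite inE /z => xU; exists x; rewrite xU ltr01.
rewrite /z; case: (boolP (x \in U)) => xU /=.
  by rewrite mulr0 sumr_ge0 // => y _; rewrite mulr_ge0.
have -> : \sum_y (edge x y)%:R * (y \notin U)%:R = (deg_in (~: U) x)%:R :> real_of C.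
  rewrite /deg_in natr_sum [RHS]big_mkcond; apply: eq_bigr => y _.
  by rewrite inE; case: (y \in U); rewrite ?mulr0 ?mulr1.
rewrite mulr1 lerBlDr natr1 ler_nat deg_in_card.
have xB : x \in ~: U by rewrite inE.
rewrite (cardsD1 x (~: U)) xB add1n ltnS; apply/subset_leq_card/subsetP => y.
by rewrite !inE => /andP[yx yU]; rewrite yU clique ?inE // eq_sym.
Qed.

Section Completion.
Variables (G : sgraph) (U : {set G}).

Definition completion_edge : rel G := fun x y =>
  edge x y || [&& x != y, x \notin U & y \notin U].

Lemma completion_sym : symmetric completion_edge.
Proof.
by move=> x y; rewrite /completion_edge edge_sym eq_sym; congr (_ || (_ && _)); rewrite andbC.
Qed.

Lemma completion_irr : irreflexive completion_edge.
Proof. by move=> x; rewrite /completion_edge edge_irr eqxx. Qed.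

Definition completion := SGraph completion_sym completion_irr.

Lemma completion_clique : {in ~: U &, forall x y : completion, x != y -> edge x y}.
Proof. by move=> x y; rewrite !inE => xU yU xy; rewrite /= /completion_edge xy xU yU orbT. Qed.

Lemma completion_connected :
  connected_rel (@edge G) -> connected_rel (@edge completion).
Proof.
move=> conn; apply/forallP => x; apply/forallP => y.
have /forallP/(_ x)/forallP/(_ y) := conn; apply: connect_sub => {}x {}y xy.
by apply: connect1; rewrite /= /completion_edge xy.
Qed.

Lemma completion_edge_core x y : x \in U -> edge (x : completion) y = edge x y.
Proof. by move=> xU; rewrite /= /completion_edge xU andbF orbF. Qed.

Lemma completion_deg_in (A : {set G}) x : x \in U ->
  @deg_in completion A x = deg_in A x.
Proof. by move=> xU; apply: eq_bigr => y _; rewrite completion_edge_core. Qed.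

Lemma completion_touch : @touch completion U = touch U.
Proof. by apply: eq_bigr => x xU; rewrite !completion_deg_in. Qed.

Lemma completion_degree (x : G) : (degree x <= @degree completion x)%N.
Proof.
apply/subset_leq_card/subsetP => y; rewrite !inE => xy.
by rewrite /= /completion_edge xy.
Qed.
End Completion.

Lemma isomorphic_trans (G H K : sgraph) :
  isomorphic G H -> isomorphic H K -> isomorphic G K.
Proof.
move=> [f f_bij f_edge] [g g_bij g_edge]; exists (g \o f); first exact: bij_comp.
by move=> x y; rewrite /= g_edge f_edge.
Qed.

Section Extremality.
Variables (C : numClosedFieldType) (k h n : nat).
Local Open Scope nat_scope.
Local Notation M := (2 * k * (2 * h + 2)).
Hypotheses (k_ge2 : 2 <= k) (hk : h < k).

(** The summands serve, in this order: the comparison of expansions, whose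
    coefficients are bounded by powers of 2k (2h + 2); the inequality
    r >= n - 2h - 3; the sparse cut; and the shape of G* itself. *)
Definition order_bound : nat :=
  76 * M ^ 9 + (2 * h + 4) + sparse_cut_bound k h + (2 * k + 4 * h + 4).

Hypothesis n_big : order_bound <= n.
Local Notation S := (Gstar h k n).

Let n_big' : 2 * k + 4 * h + 4 <= n.
Proof. by move: n_big; rewrite /order_bound; lia. Qed.

Let S_card : #|S| = n. Proof. exact: star_card. Qed.

Let star_radius : exists r p, real_val r = rho C S /\ @perron_pair C S r p.
Proof.
have [||r [rE [p pp]]] := @perron_exists C S; last by exists r, p.
  by rewrite S_card; lia.
exact: star_connected.
Qed.

Let star_radius_ge r p : @perron_pair C S r p ->
  (#|~: star_core h k n|%:R - 1 <= r)%R.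
Proof.
move=> pp; apply: clique_perron_ge pp _ (@star_clique h k n).
by rewrite star_outer_card //; lia.
Qed.

Let M_gt0 : 0 < M. Proof. by rewrite muln_gt0; lia. Qed.
Let core_le_M : 2 * h + 2 <= M. Proof. by rewrite leq_pmull //; lia. Qed.

Let touch_deg_le (G : sgraph) (U : {set G}) x : touch U + 2 <= M -> x \in U ->
  deg_in (~: U) x <= M.
Proof. by move=> tU xU; move: tU; rewrite /touch (bigD1 x) //=; lia. Qed.

(** The lexicographic optimisation, for a graph whose outer part is already a
    clique. *)
Lemma completion_extremal (G : sgraph) (U : {set G}) r p r' p' :
    #|G| = n -> #|U| = 2 * h + 2 -> touch U + 2 <= M ->
    (forall x, x \in U -> k + h <= degree x) ->
    {in ~: U &, forall x y, x != y -> edge x y} ->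
    @perron_pair C G r p -> @perron_pair C S r' p' -> (r' <= r)%R ->
  isomorphic G S.
Proof.
move=> G_card U_card tU deg_ge clique pp pp' r'r.
have W_card := star_core_card h k n.
have BW : #|~: star_core h k n| = #|~: U|.
  by rewrite star_outer_card //; have := cardsC U; rewrite U_card G_card; lia.
have r'_ge := star_radius_ge pp'.
have r'_big : (76 * M%:R ^+ 9 < r')%R.
  apply: lt_le_trans r'_ge; rewrite ltrBrDr -natrX -natrM natr1 ltr_nat star_outer_card //.
  by move: n_big; rewrite /order_bound; lia.
rewrite BW in r'_ge.
have [c star] := star_costar hk k_ge2 n_big'.
have [I1W I2W I3W I4W] := costar_invariants W_card star
  (star_core_deg hk k_ge2 n_big') (star_nested hk k_ge2 n_big').
have [] := compare_invariants pp pp' clique (@star_clique h k n) _ BW M_gt0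
  _ _ _ _ r'_big r'_ge r'r.
- by rewrite -BW star_outer_card //; lia.
- by rewrite U_card.
- by rewrite W_card.
- by move=> x; apply: touch_deg_le.
- by move=> x; apply: touch_deg_le; rewrite star_touch.
rewrite I1W I2W I3W I4W => H1 H2 H3.
have [c' [star' d_eq nst]] := extremal_structure U_card hk deg_ge tU H1 H2 H3.
by apply: threshold_isomorphic star' d_eq nst clique => //; lia.
Qed.

(** Completing the outer part to a clique gives a graph isomorphic to G*. Thus
    the radius of G is at least that of G* by assumption and at most that of G*
    by monotonicity, and equality means that the completion added no edge. *)
Lemma large_radius_isomorphic (G : sgraph) :
    graph_class n (k + h) G -> tau G < k -> (rho C S <= rho C G)%R ->
  isomorphic G S.
Proof.
move=> [conn G_card G_deg] tau_lt rho_le.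
have deg_ge (x : G) : k + h <= degree x by rewrite -G_deg min_degree_le.
have G_gt0 : 0 < #|G| by rewrite G_card; lia.
have /card_gt0P[x0 _] := G_gt0.
have [r [rE [p pp]]] := perron_exists C G_gt0 conn.
have [r' [p' [r'E pp']]] := star_radius.
have r'r : (r' <= r)%R by rewrite -real_val_le rE r'E.
have r_ge : (#|G|%:R - (2 * h + 3)%:R <= r)%R.
  apply: le_trans r'r; apply: le_trans (star_radius_ge pp').
  rewrite star_outer_card // G_card -subnDA natrB; last by lia.
  have -> : 2 * h + 3 = (2 * h + 2).+1 by lia.
  by rewrite -natr1; lra.
have cut_bound : sparse_cut_bound k h <= #|G|.
  by rewrite G_card; move: n_big; rewrite /order_bound; lia.
have [U [U_card tU]] := sparse_cut hk cut_bound deg_ge tau_lt pp r_ge.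
pose G' := completion U.
have conn' : connected_rel (@edge G') := completion_connected U conn.
have [r'' [_ [p'' pp'']]] := @perron_exists C G' G_gt0 conn'.
have sub : {homo (id : G -> G') : x y / edge x y}.
  by move=> x y xy; rewrite /= /completion_edge xy.
have id_bij : bijective (id : G -> G') by exists id.
have [r_le r_eq] := perron_monotone x0 id_bij sub pp pp''.
have iso' : isomorphic G' S.
  apply: (@completion_extremal G' U r'' p'' r' p') => //.
  - by rewrite completion_touch.
  - by move=> x _; apply: leq_trans (deg_ge x) (completion_degree _ _).
  - exact: (@completion_clique G U).
  - exact: le_trans r'r r_le.
have r''E : r'' = r' := perron_iso (x0 : G') iso' pp'' pp'.
apply: isomorphic_trans iso'; exists id => // x y.
by apply: r_eq; apply/le_anti; rewrite r_le r''E r'r.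
Qed.

Lemma isomorphic_rho (G : sgraph) : graph_class n (k + h) G ->
  isomorphic G S -> rho C G = rho C S.
Proof.
move=> [conn G_card _] iso.
have G_gt0 : 0 < #|G| by rewrite G_card; lia.
have /card_gt0P[x0 _] := G_gt0.
have [r [<- [p pp]]] := perron_exists C G_gt0 conn.
have [r' [p' [<- pp']]] := star_radius.
by rewrite (perron_iso x0 iso pp pp').
Qed.

Lemma rho_comparable (G : sgraph) : graph_class n (k + h) G ->
  (rho C G <= rho C S)%R \/ (rho C S <= rho C G)%R.
Proof.
move=> [conn G_card _].
have G_gt0 : 0 < #|G| by rewrite G_card; lia.
have [r [<- _]] := perron_exists C G_gt0 conn.
have [r' [p' [<- _]]] := star_radius.
by rewrite !real_val_le; apply/orP; apply: le_total.
Qed.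
End Extremality.

Theorem corollary2p16 (C : numClosedFieldType) (k d : nat)
    (hk : (2 <= k)%N) (hd : (k <= d <= 2 * k - 1)%N) :
  let h := (d - k)%N in
  exists n0 : nat, forall n : nat, (n0 <= n)%N ->
  [/\ (forall G : sgraph, graph_class n d G -> (tau G <= k - 1)%N ->
         rho C G <= rho C (Gstar h k n) /\
         (rho C G = rho C (Gstar h k n) <-> isomorphic G (Gstar h k n))),
      (forall G : sgraph, graph_class n d G ->
         rho C (Gstar h k n) <= rho C G ->
         (k <= tau G)%N \/ isomorphic G (Gstar h k n)),
      (forall G : sgraph, graph_class n d G ->
         rho C (Gstar h k n) < rho C G -> (k <= tau G)%N),
      graph_class n d (Gstar h k n) /\ (tau (Gstar h k n) <= k - 1)%N
    & rho C (Gstar h k n) = rhoQ C h k n].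
Proof.
move=> h; have h_lt : (h < k)%N by lia.
have dE : d = (k + h)%N by lia.
exists (order_bound k h) => n n_big; rewrite dE.
have n_big' : (2 * k + 4 * h + 4 <= n)%N by move: n_big; rewrite /order_bound; lia.
have radius G := @large_radius_isomorphic C k h n hk h_lt n_big G.
have tau_le G : (tau G <= k - 1)%N = (tau G < k)%N by lia.
split.
- move=> G Gc; rewrite tau_le => tau_lt; have iso_eq := isomorphic_rho C hk h_lt n_big Gc.
  split; last by split=> [E|//]; apply: (radius G Gc tau_lt); rewrite E.
  have [//|ge] := rho_comparable C hk h_lt n_big Gc.
  by rewrite iso_eq //; apply: radius.
- move=> G Gc ge; case: (leqP k (tau G)) => [|tau_lt]; first by left.
  by right; apply: radius ge.
- move=> G Gc gt; rewrite leqNgt; apply/negP => tau_lt.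
  have := isomorphic_rho C hk h_lt n_big Gc (radius G Gc tau_lt (ltW gt)).
  by move=> E; rewrite E ltxx in gt.
- split; first exact: star_class.
  by rewrite tau_le star_tau.
exact: star_quotient.
Qed.
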